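(* Let $d\ge2$, $G=\mathrm{GSp}_{2d}(\mathbb{Q}_p)$, and let $\phi$, $C^{(\bullet)}$, $\tau$ be as in the context, i.e. $\phi=(p\cdot\mathrm{id})\dot s_d\dot s_{d-1}\cdots\dot s_1\dot s_0$, $C^{(a(d+1)+b)}=\phi^as_d\cdots s_{d-b+1}C$ for $a\ge 0$, $0\le b<d+1$, and $\tau(x)=\mathrm{diag}(xE_d,E_d)$. (a) We have $\phi^d\in T$ and $\phi^dN_0\phi^{-d}\subset N_0$. The sequence $C=C^{(0)},C^{(1)},C^{(2)},\dots$ satisfies, with $N_0^{(i)}=I_{C^{(i)}}\cap N$: $N_0=N_0^{(0)}\supset N_0^{(1)}\supset N_0^{(2)}\supset\cdots$ with $[N_0^{(i)}:N_0^{(i+1)}]=p$ for all $i\ge0$. In particular one may define $\alpha^{(j)}\in\Phi^+$ for all $j\ge0$ (see context). (b) For all $j\ge0$ we have $\alpha^{(j)}\circ\tau=\mathrm{id}_{\mathbb{Z}_p^\times}$. (c) We have $\tau(a)\phi=\phi\tau(a)$ for all $a\in\mathbb{Z}_p^\times$.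
   Context: $p$ is a prime; $E_m$ is the identity matrix; $\widehat S_m=\begin{pmatrix}0&E_m\\-E_m&0\end{pmatrix}$. $G=\{A\in\mathrm{GL}_{2d}(\mathbb{Q}_p): {}^tA\widehat S_dA=\kappa(A)\widehat S_d,\ \kappa(A)\in\mathbb{Q}_p^\times\}$, $Z$ its center, $T$ its diagonal torus, $T_0$ the maximal bounded subgroup of $T$. For $1\le i,j\le d$, $\epsilon_1,\epsilon_2\in\{\pm1\}$ the character $\epsilon_1e_i+\epsilon_2e_j$ of $T$ is $A=\mathrm{diag}(x_1,\dots,x_{2d})\mapsto x_i^{\epsilon_1}x_j^{\epsilon_2}\kappa(A)^{(-\epsilon_1-\epsilon_2)/2}$. $\Phi=\{\pm e_i\pm e_j: i\neq j\}\cup\{\pm2e_i\}$, $\Phi^+=\{e_i\pm e_j: i<j\}\cup\{2e_i\}$. $N_\alpha$ are the root subgroups, $N_\alpha^0=N_\alpha\cap\mathrm{GL}_{2d}(\mathbb{Z}_p)$, $N=\prod_{\alpha\in\Phi^+}N_\alpha$, $N_0$ is generated by the $N_\alpha^0$, $\alpha\in\Phi^+$. $I_0$ is the pro-$p$-Iwahori subgroup generated by $N_\alpha^0$ ($\alpha\in\Phi^+$), $(N_\alpha^0)^p$ ($\alpha\in-\Phi^+$) and the maximal pro-$p$ subgroup of $T_0$; $I$ is the Iwahori subgroup containing $I_0$; $C$ is the chamber fixed by $I$ in the apartment $A$ of $T$ in the semisimple Bruhat–Tits building; $I_D$ is the Iwahori subgroup fixing a chamber $D$. $\dot s_i=\mathrm{diag}(E_{i-1},\widehat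 S_1,E_{d-i-1},E_{i-1},\widehat S_1,E_{d-i-1})$ for $1\le i\le d-1$; $\dot s_d$ is the identity outside rows and columns $d,2d$, with $(d,2d)$-entry $1$, $(2d,d)$-entry $-1$, $(d,d)$- and $(2d,2d)$-entries $0$; $\dot s_0$ is the identity outside rows and columns $1,d+1$, with $(1,d+1)$-entry $-p^{-1}$, $(d+1,1)$-entry $p$, $(1,1)$- and $(d+1,d+1)$-entries $0$. $s_i$ is the image of $\dot s_i$ in $N(T)/ZT_0$. $\tau:\mathbb{Z}_p^\times\to T_0$. Definition of $\alpha^{(j)}$: for adjacent distinct chambers $D_1,D_2$ of $A$ there is a unique $\delta\in\Phi$ with $I_{D_1}\cap N_{\delta'}=I_{D_2}\cap N_{\delta'}$ for $\delta'\ne\pm\delta$, and with $I_{D_1}\cap N_{-\delta}\subset I_{D_2}\cap N_{-\delta}$ and $I_{D_2}\cap N_\delta\subset I_{D_1}\cap N_\delta$ both of index $p$. For $D_1=C^{(j)}$, $D_2=C^{(j+1)}$ one puts $\alpha^{(j)}=\delta$; the index-$p$ chain condition means precisely that all $\alpha^{(j)}$ lie in $\Phi^+$. *)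

(* Defs.v *)
From HB Require Import structures.
From mathcomp Require Import all_boot all_order all_algebra.
From mathcomp Require Import boolp classical_sets functions cardinality.
Set Implicit Arguments.
Unset Strict Implicit.
Unset Printing Implicit Defensive.
Import Order.TTheory GRing.Theory Num.Theory.
Local Open Scope ring_scope.

(** * The p-adic integers and the p-adic numbers *)

(* Z_p is the inverse limit of the rings Z/p^n, n >= 1 (so the index n below
   stands for the modulus p^(n+1), as 'Z_1 is not the trivial ring), and Q_p
   is its field of fractions. *)

(* The argument p_pr lets the ring structure be inferred from the type. *)
Record padic_int (p : nat) (p_pr : prime p) : Type := PadicInt {
  residue : forall n : nat, 'Z_(p ^ n.+1);
  residue_compat : forall n : nat, residue n = (residue n.+1 : nat)%:R }.

Section PadicIntegers.
Variables (p : nat) (p_pr : prime p).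

Local Notation Zp := (padic_int p_pr).

HB.instance Definition _ := gen_eqMixin Zp.
HB.instance Definition _ := gen_choiceMixin Zp.

Lemma padic_intP (x y : Zp) :
  (forall n, residue x n = residue y n) -> x = y.
Proof.
case: x y => [x hx] [y hy] /= exy.
have exy' : x = y by apply: functional_extensionality_dep.
by subst y; congr PadicInt; apply: Prop_irrelevance.
Qed.

Lemma modulus_gt1 n : (1 < p ^ n.+1)%N.
Proof.
by rewrite -[1%N](expn0 p) ltn_exp2l // prime_gt1.
Qed.

Lemma natr_modulus n (k : nat) :
  ((k %% p ^ n.+2)%N)%:R = k%:R :> 'Z_(p ^ n.+1).
Proof.
apply: val_inj => /=; rewrite !val_Zp_nat ?modulus_gt1 //.
by rewrite modn_dvdm // dvdn_exp2l.
Qed.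

Lemma natrK n (x : 'Z_(p ^ n.+1)) : (x : nat)%:R = x.
Proof. by rewrite natr_Zp. Qed.

Lemma val_addZ n (x y : 'Z_(p ^ n.+1)) :
  ((x + y)%R : nat) = (addn x y %% p ^ n.+1)%N.
Proof. by rewrite /= [X in modn _ X]Zp_cast // modulus_gt1. Qed.

Lemma val_mulZ n (x y : 'Z_(p ^ n.+1)) :
  ((x * y)%R : nat) = (muln x y %% p ^ n.+1)%N.
Proof. by rewrite /= [X in modn _ X]Zp_cast // modulus_gt1. Qed.

Lemma compat_const (k : nat) n :
  (k%:R : 'Z_(p ^ n.+1)) = ((k%:R : 'Z_(p ^ n.+2)) : nat)%:R.
Proof. by rewrite val_Zp_nat ?modulus_gt1 // natr_modulus. Qed.

Definition padic0 : Zp := PadicInt p_pr (compat_const 0).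
Definition padic1 : Zp := PadicInt p_pr (compat_const 1).

Lemma compat_add (x y : Zp) n :
  residue x n + residue y n = ((residue x n.+1 + residue y n.+1)%R : nat)%:R.
Proof. by rewrite val_addZ natr_modulus natrD -!residue_compat. Qed.
Definition padic_add x y : Zp := PadicInt p_pr (compat_add x y).

Lemma compat_mul (x y : Zp) n :
  residue x n * residue y n = ((residue x n.+1 * residue y n.+1)%R : nat)%:R.
Proof. by rewrite val_mulZ natr_modulus natrM -!residue_compat. Qed.
Definition padic_mul x y : Zp := PadicInt p_pr (compat_mul x y).

Lemma compat_opp (x : Zp) n :
  - residue x n = ((- residue x n.+1)%R : nat)%:R.
Proof.
apply/eqP; rewrite eq_sym -addr_eq0 [residue x n]residue_compat -natrD.
by rewrite -natr_modulus -val_addZ addNr.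
Qed.
Definition padic_opp x : Zp := PadicInt p_pr (compat_opp x).

Lemma padic_addA : associative padic_add.
Proof. by move=> x y z; apply: padic_intP => n; apply: addrA. Qed.
Lemma padic_addC : commutative padic_add.
Proof. by move=> x y; apply: padic_intP => n; apply: addrC. Qed.
Lemma padic_add0 : left_id padic0 padic_add.
Proof. by move=> x; apply: padic_intP => n; apply: add0r. Qed.
Lemma padic_addN : left_inverse padic0 padic_opp padic_add.
Proof. by move=> x; apply: padic_intP => n; apply: addNr. Qed.

HB.instance Definition _ := GRing.isZmodule.Build Zp
  padic_addA padic_addC padic_add0 padic_addN.

Lemma padic_mulA : associative padic_mul.
Proof. by move=> x y z; apply: padic_intP => n; apply: mulrA. Qed.
Lemma padic_mulC : commutative padic_mul.
Proof. by move=> x y; apply: padic_intP => n; apply: mulrC. Qed.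
Lemma padic_mul1 : left_id padic1 padic_mul.
Proof. by move=> x; apply: padic_intP => n; apply: mul1r. Qed.
Lemma padic_mulDl : left_distributive padic_mul padic_add.
Proof. by move=> x y z; apply: padic_intP => n; apply: mulrDl. Qed.
Lemma padic1_neq0 : padic1 != 0.
Proof.
apply/eqP => /(congr1 (fun x : Zp => residue x 0)) /= /eqP.
by rewrite oner_eq0.
Qed.

HB.instance Definition _ := GRing.Zmodule_isComNzRing.Build Zp
  padic_mulA padic_mulC padic_mul1 padic_mulDl padic1_neq0.

Definition padic_unit : {pred Zp} :=
  fun x => `[< exists y : Zp, y * x = 1 >].
Definition padic_inv (x : Zp) : Zp :=
  if pselect (exists y : Zp, y * x = 1) is left e then sval (cid e)
  else x.

Lemma padic_mulVx : {in padic_unit, left_inverse 1 padic_inv *%R}.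
Proof.
move=> x /asboolP ex; rewrite /padic_inv; case: pselect => // e.
by case: (cid e).
Qed.
Lemma padic_unitPl (x y : Zp) : y * x = 1 -> padic_unit x.
Proof. by move=> yx; apply/asboolP; exists y. Qed.
Lemma padic_inv_out : {in [predC padic_unit], padic_inv =1 id}.
Proof.
move=> x /asboolP nx; rewrite /padic_inv.
by case: pselect.
Qed.

HB.instance Definition _ := GRing.ComNzRing_hasMulInverse.Build Zp
  padic_mulVx padic_unitPl padic_inv_out.

Lemma residue_mod (x : Zp) m k :
  ((residue x (k + m) : nat) = residue x m %[mod p ^ m.+1])%N.
Proof.
elim: k => [//|k <-]; rewrite addSn (residue_compat x (k + m)).
rewrite val_Zp_nat ?modulus_gt1 // modn_dvdm // dvdn_exp2l //.
by rewrite ltnS leq_addl.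
Qed.

Lemma residue_lt (x : Zp) m : (residue x m < p ^ m.+1)%N.
Proof.
by have := ltn_ord (residue x m); rewrite [X in (_ < X)%N]Zp_cast ?modulus_gt1.
Qed.

Lemma residue_neq0 (x : Zp) : x != 0 -> exists m, forall k,
  ~~ (p ^ m.+1 %| residue x (k + m))%N.
Proof.
move=> x0; have [m xm] : exists m, residue x m != 0.
  apply: contrapT => nex; case/eqP: x0; apply: padic_intP => n.
  by apply: contrapT => /eqP xn; apply: nex; exists n.
exists m => k; apply: contraNN xm => /eqP.
rewrite residue_mod modn_small ?residue_lt // => xm.
by apply/eqP/val_inj.
Qed.

Lemma padic_integral : GRing.integral_domain_axiom Zp.
Proof.
move=> x y xy0; apply: contrapT => /negP; rewrite negb_or => /andP[x0 y0].
have [m hm] := residue_neq0 x0; have [n hn] := residue_neq0 y0.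
set N := (n.+1 + m)%N.
have hx : ~~ (p ^ m.+1 %| residue x N)%N by apply: hm.
have hy : ~~ (p ^ n.+1 %| residue y N)%N.
  have -> : N = (m.+1 + n)%N by rewrite /N addSnnS addnC addSnnS.
  exact: hn.
have : (p ^ N.+1 %| residue x N * residue y N)%N.
  have := congr1 (fun z : Zp => residue z N : nat) xy0.
  rewrite [residue (x * y) N : nat]val_mulZ => h.
  by apply/eqP.
have posx : (0 < residue x N)%N.
  by rewrite lt0n; apply: contraNneq hx => ->; rewrite dvdn0.
have posy : (0 < residue y N)%N.
  by rewrite lt0n; apply: contraNneq hy => ->; rewrite dvdn0.
rewrite pfactor_dvdn ?muln_gt0 ?posx // lognM // => le.
move: hx hy; rewrite !pfactor_dvdn // -!ltnNge !ltnS => hx hy.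
have := leq_trans le (leq_add hx hy).
by rewrite /N addSn [(n + m)%N]addnC => /ltnW; rewrite ltnn.
Qed.

HB.instance Definition _ :=
  GRing.ComUnitRing_isIntegral.Build Zp padic_integral.

Definition padic : fieldType := {fraction Zp}.

Definition of_int : Zp -> padic := @tofrac Zp.

End PadicIntegers.

(** * Groups of matrices *)

Local Open Scope classical_set_scope.

Section MatrixGroups.
Variables (F : fieldType) (n : nat).
Implicit Types (g : 'M[F]_n) (H S : set 'M[F]_n).

Definition subgroup H :=
  [/\ forall g, H g -> g \in unitmx,
      H 1%:M,
      forall g h, H g -> H h -> H (g *m h)
    & forall g, H g -> H (invmx g)].

Definition generated S : set 'M[F]_n :=
  [set g | forall H, subgroup H -> S `<=` H -> H g].

Definition conjugate g H : set 'M[F]_n :=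
  [set g *m h *m invmx g | h in H].

Definition left_cosets H K : set (set 'M[F]_n) :=
  [set [set h *m k | k in K] | h in H].

Definition index_eq H K (m : nat) := K `<=` H /\ (left_cosets H K #= `I_m)%card.

End MatrixGroups.

Section GSp.
Variables (p : nat) (p_pr : prime p) (d : nat).

Local Notation Zp := (padic_int p_pr).
Local Notation Qp := (padic p_pr).
Local Notation "x %:Qp" := (of_int x) (at level 2, format "x %:Qp").
Local Notation mat := 'M[Qp]_(d + d).
Local Notation vec := 'cV[Qp]_(d + d).

Implicit Types (A B t u g : mat) (v w : vec) (L M : set vec).
Implicit Types (lam alpha delta : 'rV[int]_d).

Definition GLZp : set mat :=
  [set map_mx (@of_int p p_pr) B
     | B in [set B : 'M[Zp]_(d + d) | B \in unitmx]].

Definition Shat : mat := block_mx 0 1%:M (- 1%:M) 0.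

Definition similitude A (c : Qp) := A^T *m Shat *m A = c *: Shat.

Definition GSp : set mat :=
  [set A | A \in unitmx /\ exists2 c : Qp, c != 0 & similitude A c].

Definition kappa A : Qp := xget 0 [set c | similitude A c].

(** * The diagonal torus *)

Definition torus : set mat := [set A | GSp A /\ is_diag_mx A].

Definition bounded (H : set mat) := exists m : nat,
  forall A, H A -> forall i j, exists z : Zp, p%:R ^+ m * A i j = z%:Qp.

(* The union of the bounded subgroups of the torus, itself a bounded subgroup. *)
Definition torus0 : set mat :=
  [set t | exists H, [/\ subgroup H, H `<=` torus, bounded H & H t]].

Definition congr_mod (m : nat) A B :=
  forall i j, exists z : Zp, A i j - B i j = p%:R ^+ m * z%:Qp.

(* For a subgroup H of GL(Z_p): H is closed, and its image in GL(Z/p^m) is a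
   p-group for every m. *)
Definition pro_p (H : set mat) :=
  [/\ subgroup H, H `<=` GLZp,
      forall A, (forall m, exists2 B, H B & congr_mod m A B) -> H A
    & forall A m, H A -> exists k : nat, congr_mod m (A ^+ (p ^ k)) 1%:M].

(* The union of the pro-p subgroups of torus0, itself a pro-p subgroup. *)
Definition torus0_pro_p : set mat :=
  [set t | exists H, [/\ pro_p H, H `<=` torus0 & H t]].

Definition tau (x : Zp) : mat := block_mx (x%:Qp)%:M 0 0 1%:M.

(** * Roots *)

(* The integral combinations of e_1, ..., e_d are written as row vectors; the
   one with coordinates lam_i, with even sum, is the character
   diag(x_1, ..., x_2d) |-> x_1^lam_1 ... x_d^lam_d kappa^(- sum_i lam_i / 2). *)
Definition char lam A : Qp :=
  (\prod_(i < d) A (lshift d i) (lshift d i) ^ lam 0 i)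
    * kappa A ^ ((- \sum_(i < d) lam 0 i) %/ 2)%Z.

Definition evec (i : 'I_d) : 'rV[int]_d := delta_mx 0 i.

Definition Phi : set 'rV[int]_d :=
  [set lam | (exists (i j : 'I_d) (s1 s2 : bool),
                i != j /\ lam = (-1) ^+ s1 *: evec i + (-1) ^+ s2 *: evec j)
          \/ (exists (i : 'I_d) (s : bool), lam = (-1) ^+ s *: (evec i *+ 2))].

Definition Phi_pos : set 'rV[int]_d :=
  [set lam | (exists (i j : 'I_d) (s : bool),
                (i < j)%N /\ lam = evec i + (-1) ^+ s *: evec j)
          \/ (exists i : 'I_d, lam = evec i *+ 2)].

(* For a root alpha the matrices X of weight alpha under the torus satisfy X^2 = 0, so
   that 1 + X = exp X. *)
Definition Nroot alpha : set mat :=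
  [set u | GSp u /\ forall t, torus t ->
     t *m (u - 1%:M) *m invmx t = char alpha t *: (u - 1%:M)].

Definition Nroot0 alpha : set mat := Nroot alpha `&` GLZp.

(* The product does not depend on the order s of the positive roots. *)
Definition Npos : set mat :=
  [set g | exists (s : seq 'rV[int]_d) (u : 'rV[int]_d -> mat),
     [/\ uniq s, forall alpha, alpha \in s <-> Phi_pos alpha,
         forall alpha, Phi_pos alpha -> Nroot alpha (u alpha)
       & g = \prod_(alpha <- s) u alpha]].

Definition N0 : set mat :=
  generated (\bigcup_(alpha in Phi_pos) Nroot0 alpha).

Definition I0 : set mat :=
  generated ((\bigcup_(alpha in Phi_pos) Nroot0 alpha)
    `|` (\bigcup_(alpha in Phi_pos) [set u ^+ p | u in Nroot0 (- alpha)])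
    `|` torus0_pro_p).

(** * The semisimple Bruhat-Tits building *)

(* The building of GSp is taken in its lattice model: facets are the nonempty
   chains of lattices that are stable under homothety and under duality, and
   a facet is a face of another one if it is contained in it.  Thus chambers
   are the maximal facets. *)

Definition lattice L := exists2 g, g \in unitmx &
  L = [set g *m map_mx (@of_int p p_pr) v | v in [set: 'cV[Zp]_(d + d)]].

Definition homothetic (c : Qp) L : set vec := [set c *: v | v in L].

Definition dual L : set vec :=
  [set v | forall w, L w -> exists z : Zp, (v^T *m Shat *m w) 0 0 = z%:Qp].

Definition facet (D : set (set vec)) :=
  [/\ D !=set0,
      forall L, D L -> lattice L,
      forall L M, D L -> D M -> L `<=` M \/ M `<=` L,
      forall L (c : Qp), D L -> c != 0 -> D (homothetic c L)
    & forall L, D L -> D (dual L)].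

Definition chamber (D : set (set vec)) :=
  facet D /\ forall D', facet D' -> D `<=` D' -> D' = D.

Definition panel (P D : set (set vec)) :=
  [/\ facet P, P `<` D
    & forall P', facet P' -> P `<=` P' -> P' `<` D -> P' = P].

Definition adjacent (D1 D2 : set (set vec)) :=
  D1 <> D2 /\ exists2 P, panel P D1 & panel P D2.

(* The apartment of the torus consists of the facets whose lattices are direct sums
   of lattices in the coordinate lines, its weight lines. *)
Definition split_lattice L := exists m : 'I_(d + d) -> int,
  L = [set v | forall i, exists z : Zp, v i 0 = p%:R ^ m i * z%:Qp].

Definition apartment_chamber (D : set (set vec)) :=
  chamber D /\ forall L, D L -> split_lattice L.

Definition act_lattice g L : set vec := [set g *m v | v in L].

Definition act g (D : set (set vec)) : set (set vec) :=
  [set act_lattice g L | L in D].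

(* Fixing every lattice of D, and not only its homothety class, amounts to
   fixing D pointwise and having a unit as similitude factor. *)
Definition Iwahori (D : set (set vec)) : set mat :=
  [set g | GSp g /\ forall L, D L -> act_lattice g L = L].

(* delta is the root attached to the adjacent chambers D1 and D2. *)
Definition wall_root (D1 D2 : set (set vec)) delta :=
  [/\ [/\ apartment_chamber D1, apartment_chamber D2 & adjacent D1 D2],
      Phi delta,
      forall delta', Phi delta' -> delta' <> delta -> delta' <> - delta ->
        Iwahori D1 `&` Nroot delta' = Iwahori D2 `&` Nroot delta',
      index_eq (Iwahori D2 `&` Nroot (- delta))
               (Iwahori D1 `&` Nroot (- delta)) p
    & index_eq (Iwahori D1 `&` Nroot delta)
               (Iwahori D2 `&` Nroot delta) p].

(** * The gallery *)

(* Identity outside rows and columns a and b (counted from 0), with entries x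
   at (a, b), y at (b, a) and 0 at (a, a), (b, b). *)
Definition swap_mx (m a b : nat) (x y : Qp) : 'M[Qp]_m :=
  \matrix_(i, j)
    if (i == a :> nat) && (j == b :> nat) then x
    else if (i == b :> nat) && (j == a :> nat) then y
    else ((i == j) && (i != a :> nat) && (i != b :> nat))%:R.

Definition sdot (i : nat) : mat :=
  if i == 0%N then swap_mx (d + d) 0 d (- (p%:R)^-1) p%:R
  else if i == d then swap_mx (d + d) d.-1 (d + d).-1 1 (- 1)
  else block_mx (swap_mx d i.-1 i 1 (- 1)) 0 0 (swap_mx d i.-1 i 1 (- 1)).

(* sdot_d sdot_(d-1) ... sdot_(d-b+1), with b factors *)
Definition sdots (b : nat) : mat := \prod_(0 <= k < b) sdot (d - k).

Definition phi : mat := (p%:R)%:M *m sdots d.+1.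

Definition gallery (C : set (set vec)) (j : nat) : set (set vec) :=
  act (phi ^+ (j %/ d.+1) *m sdots (j %% d.+1)) C.

Definition Nfilt (C : set (set vec)) (i : nat) : set mat :=
  Iwahori (gallery C i) `&` Npos.

End GSp.

(* Main.v *)
Require Import Defs.
From HB Require Import structures.
From mathcomp Require Import all_boot all_order all_algebra.
From mathcomp Require Import boolp classical_sets functions cardinality.
From mathcomp Require Import zify ring.
Set Implicit Arguments.
Unset Strict Implicit.
Unset Printing Implicit Defensive.
Import Order.TTheory GRing.Theory Num.Theory.
Local Open Scope ring_scope.
Local Open Scope classical_set_scope.

(* A chamber of the apartment is encoded by integer weights w on the 2d coordinates,
   distinct modulo 2d and with w x + w (bar x) constant, where bar exchanges the two halves:
   its lattices are { v | val (v x) >= (w x + t) / 2d for all x }, t an integer, and its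
   Iwahori subgroup is cut out of GSp by val (g x y) >= (w x - w y) / 2d for g and its
   inverse.  A monomial matrix permutes and shifts the weights.  All steps of the gallery
   are translates, under phi^a s_d ... s_(d-b+1), of the step from C to s_(d-b) C: for b = d
   this is because the scalar p acts trivially on homothety classes.  A step increases w at
   two coordinates a, b of the first half (equal if b = 0 or b = d) and decreases it at bar a
   and bar b, so that among the conditions on Iwahori subgroups only those at the positions
   of the roots e_a + e_b and - e_a - e_b change, by one digit each.  Every such
   root restricts to the identity along tau. *)

(** After rescaling by 2d, one integer per coordinate records both a valuation and a place in the
    lattice chain. A bound k / (2d) on an integral valuation matters only through its ceiling, so k
    may be raised by one for free unless 2d divides it; for separated weights that never happens off
    the diagonal. Crossing a wall raises several bounds, but only at the positions of its root does
    this cost anything: there the bound passes from 2de - 1 to 2de + 1, hence the valuation from e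
    to e + 1, which is the source of every index p. The signs of the roots come from the order of
    the reflections. Seen from C, the walls of s_d, s_k and s_0 have the roots 2e_d, e_k - e_(k+1)
    and - 2e_1. In a product s_d s_(d-1) ... the factor s_d moves one coordinate into the second
    half, and the following factors carry it along until s_0 takes it back. Transport along such a
    product turns each of these roots into some e_a + e_b. A unitriangular symplectic matrix has
    similitude factor 1, and its inverse is its reflection under x, y -> bar y, bar x up to signs;
    bounds on inverses therefore follow from bounds on the matrix. *)

Lemma fraction_numden (R : idomainType) (z : {fraction R}) :
  exists a b : R, b != 0 /\ z * tofrac b = tofrac a.
Proof.
elim/quotW: z => z; exists (\n_z), (\d_z); split; first exact: denom_ratioP.
unlock FracField.tofrac; rewrite -[LHS]FracField.pi_mul.
apply/eqmodP; rewrite /= FracField.equivfE /FracField.mulf.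
by rewrite !numden_Ratio ?mulf_neq0 ?denom_ratioP ?oner_eq0 // !mulr1 mulrC.
Qed.

(** * Valuations of p-adic numbers *)

Section PadicValuation.
Variables (p : nat) (p_pr : prime p).
Local Notation Zp := (padic_int p_pr).
Local Notation Qp := (padic p_pr).

Lemma of_intD (x y : Zp) : of_int (x + y) = of_int x + of_int y.
Proof. exact: rmorphD. Qed.
Lemma of_intM (x y : Zp) : of_int (x * y) = of_int x * of_int y.
Proof. exact: rmorphM. Qed.
Lemma of_intN (x : Zp) : of_int (- x) = - of_int x.
Proof. exact: rmorphN. Qed.
Lemma of_int1 : of_int (1 : Zp) = 1.
Proof. exact: rmorph1. Qed.
Lemma of_int0 : of_int (0 : Zp) = 0.
Proof. exact: rmorph0. Qed.
Lemma of_int_nat n : of_int (n%:R : Zp) = n%:R.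
Proof. exact: rmorph_nat. Qed.
Lemma of_intX (x : Zp) n : of_int (x ^+ n) = of_int x ^+ n.
Proof. exact: rmorphXn. Qed.
Lemma of_int_eq0 (x : Zp) : (of_int x == 0) = (x == 0).
Proof. exact: tofrac_eq0. Qed.

Lemma residueD (x y : Zp) n : residue (x + y) n = residue x n + residue y n.
Proof. by []. Qed.
Lemma residueN (x : Zp) n : residue (- x) n = - residue x n.
Proof. by []. Qed.
Lemma residueM (x y : Zp) n : residue (x * y) n = residue x n * residue y n.
Proof. by []. Qed.
Lemma residue_nat k n : residue (k%:R : Zp) n = k%:R.
Proof. by elim: k => // k IH; rewrite !mulrS residueD IH. Qed.

Lemma natr_Zpexp_eq n (k l : nat) :
  (k = l %[mod p ^ n.+1])%N -> k%:R = l%:R :> 'Z_(p ^ n.+1).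
Proof.
by move=> e; apply: val_inj; rewrite /= !val_Zp_nat ?modulus_gt1.
Qed.

(** Division by [p] costs one digit: the residue of the quotient modulo [p ^ n.+1] is read off from
    that of [x] modulo [p ^ n.+2]. *)
Lemma residue0_dvd (x : Zp) : residue x 0 = 0 -> exists y : Zp, x = p%:R * y.
Proof.
move=> x0; pose r n : nat := residue x n.
have p0 : (0 < p)%N by exact: prime_gt0.
have rd n : (p %| r n)%N.
  have := residue_mod x 0 n; rewrite addn0 x0 expn1 mod0n.
  by move/eqP.
have rS n : (r n.+1 = r n %[mod p ^ n.+1])%N by exact: (residue_mod x n 1).
pose y n : 'Z_(p ^ n.+1) := (r n.+1 %/ p)%:R.
have yc n : y n = (y n.+1 : nat)%:R.
  rewrite /y val_Zp_nat ?modulus_gt1 // (natr_modulus p_pr).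
  apply: natr_Zpexp_eq; apply/eqP.
  rewrite -(eqn_pmul2l p0) !muln_modr //; rewrite -!expnS.
  by rewrite ![(p * (_ %/ p))%N]mulnC !divnK // eq_sym; apply/eqP.
exists (PadicInt p_pr yc); apply: padic_intP => n.
rewrite residueM residue_nat /= /y -natrM mulnC divnK //.
by rewrite -[LHS]Defs.natrK; apply: natr_Zpexp_eq; rewrite rS.
Qed.

(** The inverses at the finite levels are compatible because inverses are unique. *)
Lemma residue0_unit (x : Zp) : residue x 0 != 0 -> exists y : Zp, y * x = 1.
Proof.
move=> x0; have p0 : (0 < p)%N by exact: prime_gt0.
have cop n : coprime (p ^ n.+1) (residue x n).
  rewrite coprime_pexpl // prime_coprime //; apply: contra x0 => pd.
  apply/eqP; rewrite -[LHS]Defs.natrK -[RHS]/(0%:R); apply: natr_Zpexp_eq.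
  have := residue_mod x 0 n; rewrite addn0 => <-.
  by rewrite expn1 mod0n; apply/eqP.
have un n : residue x n \is a GRing.unit.
  by rewrite -[residue x n]Defs.natrK unitZpE ?modulus_gt1.
pose y n : 'Z_(p ^ n.+1) := (residue x n)^-1.
have yc n : y n = (y n.+1 : nat)%:R.
  apply: (mulrI (un n)); rewrite [LHS]mulrV ?un // {1}(residue_compat x n).
  rewrite -[RHS]natrM -[RHS](natr_modulus p_pr) -(val_mulZ p_pr).
  by rewrite [_ * y _]mulrV ?un //; exact: (compat_const p_pr 1 n).
exists (PadicInt p_pr yc); apply: padic_intP => n.
by rewrite residueM /= mulVr ?un.
Qed.

Lemma residue0_nat (k : nat) : residue (k%:R : Zp) 0 = 0 -> (p %| k)%N.
Proof.
rewrite residue_nat => /(congr1 (@nat_of_ord _)).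
by rewrite val_Zp_nat ?modulus_gt1 // expn1 /= => /eqP.
Qed.

Lemma p_neq0 : (p%:R : Zp) != 0.
Proof.
apply/eqP => /(congr1 (fun z : Zp => residue z 1 : nat)).
rewrite residue_nat val_Zp_nat ?modulus_gt1 // modn_small; last first.
  by rewrite -[X in (X < _)%N]expn1 ltn_exp2l // prime_gt1.
by move/eqP; rewrite (negPf (lt0n_neq0 (prime_gt0 p_pr))).
Qed.

Lemma pQ_neq0 : (p%:R : Qp) != 0.
Proof. by rewrite -of_int_nat of_int_eq0 p_neq0. Qed.

Lemma p_nunit (y : Zp) : p%:R * y != 1.
Proof.
apply/eqP => /(congr1 (fun z : Zp => residue z 0)).
rewrite residueM residue_nat; have -> : (p%:R : 'Z_(p ^ 1)) = 0.
  by rewrite -[RHS]/(0%:R); apply: natr_Zpexp_eq; rewrite expn1 modnn mod0n.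
by rewrite mul0r => /eqP; rewrite eq_sym oner_eq0.
Qed.

(** Induction on a level at which [x] is visibly nonzero: each division by [p] lowers it by one. *)
Lemma padic_int_unit_part (x : Zp) : x != 0 ->
  exists (m : nat) (u v : Zp), u * v = 1 /\ x = p%:R ^+ m * u.
Proof.
move=> /residue_neq0[m /(_ 0%N)]; rewrite add0n.
elim: m x => [|m IH] x xm.
  have [|v vx] := @residue0_unit x; last first.
    by exists 0%N, x, v; rewrite expr0 mul1r mulrC.
  by apply: contraNneq xm => ->; rewrite dvdn0.
have [x0|/residue0_unit[v vx]] := eqVneq (residue x 0) 0; last first.
  by exists 0%N, x, v; rewrite expr0 mul1r mulrC.
have [y xy] := residue0_dvd x0.
have [|k [u [v [uv ey]]]] := IH y.
  apply: contra xm; rewrite xy residueM residue_nat => yd.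
  have := residue_mod y m 1; rewrite add1n => ym.
  rewrite (val_mulZ p_pr) val_Zp_nat ?modulus_gt1 // modnMml.
  move: (nat_of_ord (residue y m.+1)) ym => r ym; rewrite /dvdn modn_dvdm //.
  rewrite -/(dvdn _ _) expnS dvdn_pmul2l ?prime_gt0 //.
  by rewrite /dvdn ym.
by exists k.+1, u, v; split=> //; rewrite xy ey exprS mulrA.
Qed.

Lemma padic_unit_part (z : Qp) : z != 0 ->
  exists (m : int) (u v : Zp), u * v = 1 /\ z = p%:R ^ m * of_int u.
Proof.
move=> z0; have [a [b [b0 zb]]] := fraction_numden z.
have a0 : a != 0.
  by rewrite -of_int_eq0 /of_int -zb mulf_neq0 // tofrac_eq0.
have [m [u [v [uv ea]]]] := padic_int_unit_part a0.
have [k [u' [v' [uv' eb]]]] := padic_int_unit_part b0.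
exists (m%:Z - k%:Z), (u * v'), (u' * v); split.
  have -> : u * v' * (u' * v) = (u * v) * (u' * v') by ring.
  by rewrite uv uv' mulr1.
have vb : of_int b != 0 by rewrite of_int_eq0.
apply: (mulIf vb); rewrite [LHS]zb -/(of_int a) ea eb.
rewrite !of_intM !of_intX !of_int_nat expfzDr ?pQ_neq0 // -invr_expz -!exprnP.
have pk : (p%:R : Qp) ^+ k != 0 by rewrite expf_neq0 ?pQ_neq0.
have -> : p%:R ^+ m * p%:R ^- k * (of_int u * of_int v') * (p%:R ^+ k * of_int u')
  = p%:R ^+ m * (p%:R ^- k * p%:R ^+ k) * of_int u * (of_int u' * of_int v') by ring.
by rewrite mulVf // -of_intM uv' of_int1 !mulr1.
Qed.

(** The valuation of [z] is at least [m]. Used as a predicate, it holds of 0 for every [m], and no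
    infinite value has to be handled. *)
Definition pdvd (m : int) (z : Qp) := exists c : Zp, z = p%:R ^ m * of_int c.

Lemma pdvd0 m : pdvd m 0.
Proof. by exists 0; rewrite of_int0 mulr0. Qed.

Lemma pdvdD m x y : pdvd m x -> pdvd m y -> pdvd m (x + y).
Proof. by case=> a -> [b ->]; exists (a + b); rewrite of_intD mulrDr. Qed.

Lemma pdvdN m x : pdvd m x -> pdvd m (- x).
Proof. by case=> a ->; exists (- a); rewrite of_intN mulrN. Qed.

Lemma pdvdM m k x y : pdvd m x -> pdvd k y -> pdvd (m + k) (x * y).
Proof.
case=> a -> [b ->]; exists (a * b).
by rewrite of_intM expfzDr ?pQ_neq0 // mulrACA.
Qed.

Lemma pdvd_int (c : Zp) : pdvd 0 (of_int c).
Proof. by exists c; rewrite expr0z mul1r. Qed.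

Lemma pdvd_le m k x : k <= m -> pdvd m x -> pdvd k x.
Proof.
move=> km [a ->]; exists (p%:R ^+ `|m - k|%N * a).
rewrite of_intM of_intX of_int_nat mulrA.
congr (_ * _); rewrite exprnP abszE ger0_norm ?subr_ge0 // -expfzDr ?pQ_neq0 //.
by rewrite subrKC.
Qed.

Lemma pdvd_exp m : pdvd m (p%:R ^ m).
Proof. by exists 1; rewrite of_int1 mulr1. Qed.

Lemma pdvd_unit (u v : Zp) m k : u * v = 1 -> pdvd k (p%:R ^ m * of_int u) -> k <= m.
Proof.
move=> uv [c e]; rewrite leNgt; apply/negP => mk.
have pm : (p%:R : Qp) ^ m != 0 by rewrite expfz_neq0 // pQ_neq0.
have : pdvd (k - m) (of_int u).
  exists c; apply: (mulfI pm); rewrite e mulrA -expfzDr ?pQ_neq0 //.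
  by rewrite addrC subrK.
move/(@pdvd_le _ 1 _); case=> [|c']; first by rewrite -gtz0_ge1 subr_gt0.
rewrite expr1z -of_int_nat -of_intM => eu.
have {}eu : u = p%:R * c'.
  by apply/eqP; rewrite -(tofrac_eq u); apply/eqP.
by have /eqP := p_nunit (c' * v); apply; rewrite mulrA -eu.
Qed.

Lemma pdvd_val (z : Qp) : z != 0 -> exists m : int,
  [/\ pdvd m z, pdvd (- m) z^-1 & ~ pdvd (m + 1) z].
Proof.
move=> /padic_unit_part[m [u [v [uv ->]]]]; exists m; split.
- by exists u.
- exists v; rewrite invfM -invr_expz; congr (_ * _).
  have u0 : of_int u != 0 by rewrite of_int_eq0; apply: contraPneq uv => ->;
    rewrite mul0r => /eqP; rewrite eq_sym oner_eq0.
  by apply: (mulfI u0); rewrite mulfV // -of_intM uv of_int1.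
- by move/(pdvd_unit uv); rewrite gerDl.
Qed.

Lemma pdvd_sum m (I : Type) (r : seq I) (P : pred I) (F : I -> Qp) :
  (forall i, P i -> pdvd m (F i)) -> pdvd m (\sum_(i <- r | P i) F i).
Proof. by move=> h; elim/big_ind: _ => //; [exact: pdvd0 | exact: pdvdD]. Qed.

Lemma pdvd_ex (z : Qp) : exists m, pdvd m z.
Proof.
have [->|/pdvd_val[m []]] := eqVneq z 0; first by exists 0; exact: pdvd0.
by exists m.
Qed.

(** Together with [pdvd_digit_inj]: the multiples of p^m by digits represent the p classes of p^m
    Z_p modulo p^(m+1) Z_p. Every index p is counted here. *)
Lemma pdvd_digit m (z : Qp) : pdvd m z ->
  exists k : 'I_p, pdvd (m + 1) (z - k%:R * p%:R ^ m).
Proof.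
case=> c ->; have kp : (residue c 0 < p)%N.
  by rewrite -[X in (_ < X)%N]expn1; exact: residue_lt.
exists (Ordinal kp) => /=.
have [y ey] : exists y : Zp, c - (residue c 0 : nat)%:R = p%:R * y.
  apply: residue0_dvd; rewrite residueD residueN residue_nat Defs.natrK.
  exact: subrr.
exists y; rewrite [_%:R * _]mulrC -mulrBr expfzDr ?pQ_neq0 // expr1z -mulrA.
by rewrite -!of_int_nat -of_intN -of_intD ey of_intM.
Qed.

Lemma pdvd_digit_inj m (k l : 'I_p) :
  pdvd (m + 1) (k%:R * p%:R ^ m - l%:R * p%:R ^ m) -> k = l.
Proof.
wlog kl : k l / (l <= k)%N => [hw h|].
  case/orP: (leq_total l k) => lk; first exact: hw.
  by apply/esym/(hw l k) => //; rewrite -opprB; exact: pdvdN.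
case=> c; rewrite -mulrBl -natrB // expfzDr ?pQ_neq0 // expr1z => e.
have pm : (p%:R : Qp) ^ m != 0 by rewrite expfz_neq0 // pQ_neq0.
have : (k - l)%:R = p%:R * c.
  apply/eqP; rewrite -(@tofrac_eq (padic_int p_pr)); apply/eqP.
  apply: (mulfI pm); rewrite -!/(of_int _) of_intM !of_int_nat mulrA -e.
  by rewrite mulrC.
move/(congr1 (fun z : Zp => residue z 0)); rewrite residueM (residue_nat p 0).
have -> : (p%:R : 'Z_(p ^ 1)) = 0.
  by rewrite -[RHS]/(0%:R); apply: natr_Zpexp_eq; rewrite expn1 modnn mod0n.
rewrite mul0r => /residue0_nat; rewrite /dvdn modn_small; last first.
  by rewrite (leq_ltn_trans (leq_subr _ _)).
by rewrite subn_eq0 => kl'; apply/val_inj/eqP; rewrite eqn_leq kl kl'.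
Qed.

End PadicValuation.

(** * Symplectic matrices *)

Section Halves.
Variable d : nat.
Local Notation I := 'I_(d + d).

Definition ix (h : bool) (i : 'I_d) : I := if h then rshift d i else lshift d i.
Definition half (x : I) : bool := if fintype.split x is inr _ then true else false.
Definition pos (x : I) : 'I_d := match fintype.split x with inl i => i | inr i => i end.
Definition bar (x : I) : I := ix (~~ half x) (pos x).

Lemma half_ix h i : half (ix h i) = h.
Proof.
by rewrite /half /ix; case: h; [rewrite -[rshift d i]/(unsplit (inr i))|
  rewrite -[lshift d i]/(unsplit (inl i))]; rewrite unsplitK.
Qed.
Lemma pos_ix h i : pos (ix h i) = i.
Proof.
by rewrite /pos /ix; case: h; [rewrite -[rshift d i]/(unsplit (inr i))|
  rewrite -[lshift d i]/(unsplit (inl i))]; rewrite unsplitK.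
Qed.
Lemma ixK x : ix (half x) (pos x) = x.
Proof. by rewrite -[RHS]splitK /half /pos /ix; case: (fintype.split x). Qed.
Lemma ixP x : exists h i, x = ix h i.
Proof. by exists (half x), (pos x); rewrite ixK. Qed.
Lemma ix_eq h i h' i' : (ix h i == ix h' i') = (h == h') && (i == i').
Proof.
apply/eqP/andP => [e|[/eqP-> /eqP->]] //.
  by have := congr1 half e; have := congr1 pos e; rewrite !half_ix !pos_ix => -> ->.
Qed.
Lemma eq_half_pos x y : (x == y) = (half x == half y) && (pos x == pos y).
Proof. by rewrite -ix_eq !ixK. Qed.
Lemma bar_ix h i : bar (ix h i) = ix (~~ h) i.
Proof. by rewrite /bar half_ix pos_ix. Qed.
Lemma barK : involutive bar.
Proof. by move=> x; rewrite /bar half_ix pos_ix negbK ixK. Qed.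
Lemma half_bar x : half (bar x) = ~~ half x.
Proof. by rewrite half_ix. Qed.
Lemma pos_bar x : pos (bar x) = pos x.
Proof. by rewrite pos_ix. Qed.
Lemma bar_neq x : bar x != x.
Proof. by apply/eqP => /(congr1 half); rewrite half_bar; case: half. Qed.
Lemma bar_eq x y : (bar x == y) = (x == bar y).
Proof. by rewrite -[y in LHS]barK (inj_eq (can_inj barK)). Qed.

(** The weight of the coordinate line [x], taken up to half the similitude character: e_i on the
    first half, - e_i on the second. The roots are the sums [wt x + wt y] with [y != bar x]. *)
Definition wt (x : I) : 'rV[int]_d := (-1) ^+ half x *: delta_mx 0 (pos x).

Lemma wt_ix h i : wt (ix h i) = (-1) ^+ h *: delta_mx 0 i.
Proof. by rewrite /wt half_ix pos_ix. Qed.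

Lemma wt_bar x : wt (bar x) = - wt x.
Proof. by rewrite /wt half_bar pos_bar signrN scaleNr. Qed.

Lemma wtE x y : (-1) ^+ half y * wt x 0 (pos y) = (x == y)%:R - (x == bar y)%:R.
Proof.
rewrite !mxE eqxx /= !(eq_half_pos x) half_bar pos_bar [pos y == _]eq_sym.
by case: (half x); case: (half y); case: (_ == _).
Qed.

Lemma wt_inj : injective wt.
Proof.
move=> x y e; have := wtE x y; rewrite e wtE eqxx [y == bar y]eq_sym (negPf (bar_neq y)).
by case: eqP => // _; case: (x == bar y).
Qed.

(** Pairing with the signed coordinate of [x] gives a positive number on the left, because
    [y != bar x]; so [x] must occur on the right. *)
Lemma wtD_inj x y x' y' : y != bar x -> wt x + wt y = wt x' + wt y' ->
  (x = x' /\ y = y') \/ (x = y' /\ y = x').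
Proof.
move=> yx e; have D (u v : 'rV[int]_d) k : (u + v) 0 k = u 0 k + v 0 k by rewrite mxE.
have : (x' == x) || (y' == x).
  have := congr1 (fun v : 'rV[int]_d => (-1) ^+ half x * v 0 (pos x)) e.
  rewrite /= !D !mulrDr !wtE eqxx [x == bar x]eq_sym (negPf (bar_neq x)).
  by rewrite (negPf yx); case: (y == x); case: (x' == x); case: (y' == x);
    case: (x' == bar x); case: (y' == bar x).
case/orP => /eqP ex; [left|right]; move: e; rewrite ex.
  by move/addrI/wt_inj.
by rewrite [RHS]addrC => /addrI/wt_inj.
Qed.

Definition barsym (w : I -> int) := exists k, forall x, w x + w (bar x) = k.

Lemma barsym_lt (w : I -> int) x y : barsym w -> (w (bar x) < w (bar y)) = (w y < w x).
Proof. by case=> k e; have := e x; have := e y; lia. Qed.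

End Halves.

Section Symplectic.
Variables (p : nat) (p_pr : prime p) (d : nat).
Local Notation Qp := (padic p_pr).
Local Notation mat := 'M[Qp]_(d + d).
Local Notation S := (Shat p_pr d).
Implicit Types (A B g u : mat) (x y z : 'I_(d + d)).

Definition sg x : Qp := if half x then -1 else 1.

Lemma sgM x : sg x * sg x = 1.
Proof. by rewrite /sg; case: half; rewrite ?mulrNN mulr1. Qed.
Lemma sg_bar x : sg (bar x) = - sg x.
Proof. by rewrite /sg half_bar; case: half; rewrite ?opprK. Qed.
Lemma sg_neq0 x : sg x != 0.
Proof. by apply/eqP => e; have := sgM x; rewrite e mul0r => /eqP; rewrite eq_sym oner_eq0. Qed.

Lemma ShatE x y : S x y = (y == bar x)%:R * sg x.
Proof.
have [h [i ->]] := ixP x; have [h' [j ->]] := ixP y.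
rewrite /sg bar_ix ix_eq half_ix /ix; case: h; case: h'; rewrite /=.
- by rewrite [LHS]block_mxEdr mxE mul0r.
- by rewrite [LHS]block_mxEdl !mxE [j == i]eq_sym mulrN1.
- by rewrite [LHS]block_mxEur !mxE [j == i]eq_sym mulr1.
- by rewrite [LHS]block_mxEul mxE mul0r.
Qed.

Lemma mul_mxShat m (A : 'M[Qp]_(m, d + d)) i x : (A *m S) i x = - (A i (bar x) * sg x).
Proof.
rewrite mxE (bigD1 (bar x)) //= big1 ?addr0; last first.
  move=> y yx; rewrite ShatE -bar_eq.
  by rewrite eq_sym (negPf yx) mul0r mulr0.
by rewrite ShatE barK eqxx mul1r sg_bar mulrN.
Qed.

Lemma mul_Shatmx m (A : 'M[Qp]_(d + d, m)) x i : (S *m A) x i = sg x * A (bar x) i.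
Proof.
rewrite mxE (bigD1 (bar x)) //= big1 ?addr0; last first.
  by move=> y yx; rewrite ShatE (negPf yx) !mul0r.
by rewrite ShatE eqxx mul1r.
Qed.

Lemma sympE A B x y : (A^T *m S *m B) x y = \sum_z A z x * sg z * B (bar z) y.
Proof.
rewrite -mulmxA mxE; apply: eq_bigr => z _.
by rewrite mul_Shatmx mxE mulrA.
Qed.

Lemma ShatK : S *m S = - 1%:M.
Proof.
apply/matrixP => x y; rewrite mul_mxShat ShatE (inj_eq (can_inj (@barK d))) !mxE.
rewrite [y == x]eq_sym; case: eqP => [->|_]; last by rewrite !mul0r oppr0.
by rewrite mul1r sgM.
Qed.

Lemma similitude1 : similitude (1%:M : mat) 1.
Proof. by rewrite /similitude trmx1 mul1mx mulmx1 scale1r. Qed.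

Lemma similitudeM A B a b :
  similitude A a -> similitude B b -> similitude (A *m B) (a * b).
Proof.
rewrite /similitude => ea eb; rewrite trmx_mul -!mulmxA [S *m (A *m B)]mulmxA.
by rewrite [A^T *m _]mulmxA [A^T *m _]mulmxA ea -!scalemxAl -scalemxAr mulmxA eb scalerA.
Qed.

(** [A^T *m S *m A = c *: S] and [S *m S = - 1%:M] give the inverse as - c^-1 S A^T S, which is [A]
    reflected under x, y -> bar y, bar x, up to signs and the factor. *)
Lemma similitude_invE A c : c != 0 -> similitude A c ->
  A \in unitmx /\ forall x y, invmx A x y = c^-1 * sg x * sg y * A (bar y) (bar x).
Proof.
move=> c0 e; have e1 : (- (c^-1 *: (S *m A^T *m S))) *m A = 1%:M.
  rewrite mulNmx -scalemxAl -!mulmxA [A^T *m _]mulmxA e -scalemxAr scalerA.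
  by rewrite mulVf // scale1r ShatK opprK.
have [_ uA] := mulmx1_unit e1; split => // x y.
have -> : invmx A = - (c^-1 *: (S *m A^T *m S)).
  by rewrite -[RHS]mulmx1 -(mulmxV uA) mulmxA e1 mul1mx.
rewrite [LHS]mxE [X in - X]mxE mul_mxShat mul_Shatmx [_^T _ _]mxE; ring.
Qed.

Lemma GSp_similitude g : GSp g <-> exists2 c, c != 0 & similitude g c.
Proof.
split=> [[]//|[c c0 e]]; split; last by exists c.
by have [] := similitude_invE c0 e.
Qed.

Lemma GSp1 : GSp (1%:M : mat).
Proof. by apply/GSp_similitude; exists 1; [exact: oner_neq0|exact: similitude1]. Qed.

Lemma GSpM g h : GSp g -> GSp h -> GSp (g *m h).
Proof.
move=> [_ [a a0 ea]] [_ [b b0 eb]]; apply/GSp_similitude.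
by exists (a * b); [rewrite mulf_neq0|exact: similitudeM].
Qed.

Lemma similitudeV g c : c != 0 -> similitude g c -> similitude (invmx g) c^-1.
Proof.
move=> c0 e; have [ug _] := similitude_invE c0 e.
have eS : S = c^-1 *: (g^T *m S *m g) by rewrite e scalerA mulVf // scale1r.
rewrite /similitude {1}eS -scalemxAr -scalemxAl; congr (_ *: _).
by rewrite -!mulmxA (mulmxV ug) mulmx1 mulmxA -trmx_mul (mulmxV ug) trmx1 mul1mx.
Qed.

Lemma GSpV g : GSp g -> GSp (invmx g).
Proof.
move=> [_ [c c0 e]]; apply/GSp_similitude.
by exists c^-1; [rewrite invr_eq0|exact: similitudeV].
Qed.

Lemma kappaE g c : (0 < d)%N -> similitude g c -> kappa g = c.
Proof.
move=> d0 e; have S0 : S (ix false (Ordinal d0)) (ix true (Ordinal d0)) = 1.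
  by rewrite ShatE bar_ix eqxx /sg half_ix mulr1.
have D k : (k *: S) (ix false (Ordinal d0)) (ix true (Ordinal d0)) = k.
  by rewrite mxE S0 mulr1.
have ek : similitude g (kappa g) by exact: (@xgetI _ 0 [set c | similitude g c] c e).
by rewrite -[LHS]D -ek e D.
Qed.
End Symplectic.

Lemma mulf_divK (F : fieldType) (a b s t : F) : s != 0 -> t != 0 ->
  a * b * ((s * t)^-1 * t) = a / s * b.
Proof. by move=> s0 t0; field; rewrite s0 t0. Qed.

Lemma mulf_if_div (F : fieldType) (a b c : F) (s t : bool) : c != 0 ->
  (if s then a / c else a) * (if t then b / c else b) *
    (if s && t then c else if s || t then 1 else c^-1) = a * b / c.
Proof. by case: s; case: t => c0 /=; field. Qed.

(** * Unitriangular subgroups of GSp and the weights of the torus *)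

Section Unitriangular.
Variables (p : nat) (p_pr : prime p) (d : nat) (d_gt0 : (0 < d)%N).
Local Notation Qp := (padic p_pr).
Local Notation I := 'I_(d + d).
Local Notation mat := 'M[Qp]_(d + d).
Implicit Types (A B g h u t : mat) (x y z : I) (w : I -> int).

(** For an injective symmetric [w], the unipotent radical of the Borel subgroup stabilizing the
    coordinate flag ordered by [w]. With the order left variable, the same lemmas serve for N and
    for root subgroups of either sign. *)
Definition unitri w : set mat :=
  [set g | [/\ GSp g, forall x, g x x = 1
    & forall x y, g x y != 0 -> x = y \/ w x < w y]].

(** In the entry [(x, bar x)] of [g^T *m S *m g] a term with [z != x] would need both [w z < w x]
    and [w (bar z) < w (bar x)], which the symmetry of [w] makes contradictory. The term [z = x] has
    coefficient 1. *)
Lemma unitri_similitude w g : barsym w -> unitri w g -> similitude g 1.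
Proof.
move=> ws [[_ [c c0 e]] g1 gu]; suff <- : c = 1 by [].
pose x := ix false (Ordinal d_gt0).
have := congr1 (fun M : mat => M x (bar x)) e.
rewrite /= sympE mxE ShatE eqxx (bigD1 x) //= !g1 mulr1 big1 ?addr0; last first.
  move=> z zx; apply/eqP; apply: contraT; rewrite !mulf_eq0 !negb_or.
  case/andP => /andP[/gu h1 _] /gu h2.
  case: h1 => [e1|h1]; first by rewrite e1 eqxx in zx.
  case: h2 => [/(can_inj (@barK d)) e1|]; first by rewrite e1 eqxx in zx.
  by rewrite barsym_lt // => h2; have := lt_trans h1 h2; rewrite ltxx.
rewrite !mul1r => e1; apply: (mulIf (sg_neq0 p_pr x)).
by rewrite mul1r -e1.
Qed.

Lemma unitri_invE w g : barsym w -> unitri w g ->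
  g \in unitmx /\ forall x y, invmx g x y = sg p_pr x * sg p_pr y * g (bar y) (bar x).
Proof.
move=> ws /(unitri_similitude ws) /similitude_invE[]; first exact: oner_neq0.
by move=> ug e; split=> // x y; rewrite e invr1 mul1r.
Qed.

Lemma unitri1 w : unitri w 1%:M.
Proof.
split=> [|x|x y]; [exact: GSp1|by rewrite mxE eqxx|].
by rewrite mxE; case: (x =P y) => [|_]; [left|rewrite eqxx].
Qed.

Lemma unitriM w g h : unitri w g -> unitri w h -> unitri w (g *m h).
Proof.
move=> [Gg g1 gu] [Gh h1 hu]; split=> [|x|x y]; first exact: GSpM.
  rewrite mxE (bigD1 x) //= g1 h1 mulr1 big1 ?addr0 // => z zx.
  apply/eqP; apply: contraT; rewrite mulf_eq0 negb_or.
  case/andP => /gu h2 /hu h3.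
  case: h2 => [e|h2]; first by rewrite e eqxx in zx.
  case: h3 => [e|h3]; first by rewrite e eqxx in zx.
  by have := lt_trans h2 h3; rewrite ltxx.
rewrite mxE => H; have [z hz] : exists z, g x z * h z y != 0.
  apply/existsP; apply: contraNT H; rewrite negb_exists => /forallP H.
  by rewrite big1 // => z _; have := H z; rewrite negbK => /eqP.
move: hz; rewrite mulf_eq0 negb_or => /andP[/gu h2 /hu h3].
case: h2 h3 => [->|h2] // [<-|h3]; first by right.
by right; exact: lt_trans h2 h3.
Qed.

Lemma unitriV w g : barsym w -> unitri w g -> unitri w (invmx g).
Proof.
move=> ws Ug; have [ug gE] := unitri_invE ws Ug; case: Ug => Gg g1 gu.
split=> [|x|x y]; first exact: GSpV.
  by rewrite gE g1 mulr1 sgM.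
rewrite gE !mulf_eq0 !negb_or => /andP[_ /gu].
by rewrite barsym_lt // => -[/(can_inj (@barK d))|]; [left|right].
Qed.

Lemma unitri_subgroup w : barsym w -> subgroup (unitri w).
Proof.
move=> ws; split=> [g Ug||g h|g]; [|exact: unitri1|exact: unitriM|exact: unitriV].
by have [] := unitri_invE ws Ug.
Qed.

Lemma subgroupI (F : fieldType) n (H K : set 'M[F]_n) :
  subgroup H -> subgroup K -> subgroup (H `&` K).
Proof.
move=> [Hu H1 HM HV] [Ku K1 KM KV]; split=> [g [/Hu]||g h [Hg Kg] [Hh Kh]|g [Hg Kg]] //.
- by split; [exact: HM|exact: KM].
- by split; [exact: HV|exact: KV].
Qed.

Lemma pexp_inj m k : (p%:R : Qp) ^ m = p%:R ^ k -> m = k.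
Proof.
move=> e; have E m' k' : (p%:R : Qp) ^ m' = p%:R ^ k' -> m' <= k'.
  move=> {}e; apply: (@pdvd_unit _ p_pr 1 1); first by rewrite mulr1.
  by rewrite of_int1 mulr1 -e; exact: pdvd_exp.
by apply/eqP; rewrite eq_le (E _ _ e) (E _ _ (esym e)).
Qed.

Lemma torus_entries t : torus t -> exists2 c, c != 0 &
  [/\ kappa t = c, forall x y, x != y -> t x y = 0,
      forall x, t x x != 0 & forall x, t x x * t (bar x) (bar x) = c].
Proof.
move=> [[_ [c c0 e]] /is_diag_mxP td]; exists c => //.
have tm x : t x x * t (bar x) (bar x) = c.
  have := congr1 (fun M : mat => M x (bar x)) e.
  rewrite /= sympE mxE ShatE eqxx (bigD1 x) //= big1 ?addr0; last first.
    by move=> z zx; rewrite td // !mul0r.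
  rewrite mul1r mulrAC => e1.
  by apply: (mulIf (sg_neq0 p_pr x)).
split=> //; first exact: kappaE.
  by move=> x; apply/eqP => e0; move: c0; rewrite -(tm x) e0 mul0r eqxx.
Qed.

Lemma torus_diag (f : I -> Qp) c : c != 0 -> (forall x, f x * f (bar x) = c) ->
  torus (\matrix_(x, y) if x == y then f x else 0).
Proof.
move=> c0 fc; split; last by apply/is_diag_mxP => x y; rewrite mxE -val_eqE => /negPf->.
apply/GSp_similitude; exists c => //; apply/matrixP => x y.
rewrite sympE mxE ShatE (bigD1 x) //= big1 ?addr0; last first.
  by move=> z zx; rewrite !mxE (negPf zx) !mul0r.
rewrite !mxE eqxx [bar x == y]eq_sym; case: eqP => [_|_]; last by rewrite mul0r !mulr0.
by rewrite mul1r mulrAC fc.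
Qed.

Lemma torus_conjE t A x y : torus t ->
  (t *m A *m invmx t) x y = t x x / t y y * A x y.
Proof.
move=> Tt; have [c c0 [kt t0 tn tc]] := torus_entries Tt.
case: Tt => [[_ [c' c'0 e]] _].
have ec : c' = c by rewrite -kt (kappaE _ e).
have [ut tV] := similitude_invE c'0 e.
rewrite mxE (bigD1 y) //= big1 ?addr0; last first.
  move=> z zy; rewrite tV t0 ?mulr0 //.
  by apply: contra zy => /eqP/(can_inj (@barK d)) ->.
rewrite mxE (bigD1 x) //= big1 ?addr0; last first.
  by move=> z zx; rewrite t0 ?mul0r // eq_sym.
rewrite tV -(mulrA c'^-1) sgM mulr1 ec -(tc y).
exact: (mulf_divK _ _ (tn _) (tn _)).
Qed.

(** A coordinate of the second half contributes the inverse of its partner's entry, that is, its own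
    entry divided by [kappa t]; the power of [kappa] in [char] makes up for the difference. *)
Lemma char_wtD t x y : torus t -> char (wt x + wt y) t = t x x * t y y / kappa t.
Proof.
move=> Tt; have [c c0 [kt t0 tn tc]] := torus_entries Tt.
have lix i : lshift d i = ix false i by [].
pose e x : int := (-1) ^+ half x.
have prodE z : \prod_(i < d) t (lshift d i) (lshift d i) ^ (wt z 0 i) =
    t (ix false (pos z)) (ix false (pos z)) ^ e z.
  rewrite (bigD1 (pos z)) //= big1 ?mulr1; last first.
    by move=> i iz; rewrite !mxE (negPf iz) mulr0 expr0z.
  by rewrite !mxE !eqxx mulr1 lix.
have sumE z : \sum_(i < d) wt z 0 i = e z.
  rewrite (bigD1 (pos z)) //= big1 ?addr0; last first.
    by move=> i iz; rewrite !mxE (negPf iz) mulr0.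
  by rewrite !mxE !eqxx mulr1.
have tE z : t (ix false (pos z)) (ix false (pos z)) ^ e z =
    if half z then t z z / c else t z z.
  have [h [i ->]] := ixP z; rewrite /e half_ix pos_ix; case: h; last by rewrite expr1z.
  by rewrite exprN1 -(tc (ix true i)) bar_ix /= invfM mulrA mulfV ?mul1r.
rewrite /char kt.
under eq_bigr do rewrite mxE expfzDr ?lix ?tn // -lix.
rewrite big_split /= !prodE !tE.
under eq_bigr do rewrite mxE.
rewrite big_split /= !sumE /e.
rewrite -(mulf_if_div _ _ (half x) (half y) c0); congr (_ * _).
by case: (half x); case: (half y); rewrite /= ?expr1z ?exprN1 ?expr0z.
Qed.

Lemma char_wtB t x y : torus t -> char (wt x - wt y) t = t x x / t y y.
Proof.
move=> Tt; have [c c0 [kt t0 tn tc]] := torus_entries Tt.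
rewrite -wt_bar char_wtD // kt -(tc y) invfM -mulrA; congr (_ * _).
by rewrite mulrCA mulfV ?mulr1.
Qed.

Lemma NrootP alpha u :
  Nroot alpha u <-> GSp u /\ forall x y, (u - 1%:M) x y != 0 -> alpha = wt x - wt y.
Proof.
split=> [[Gu h]|[Gu h]]; split=> //; last first.
  move=> t Tt; apply/matrixP => x y; rewrite torus_conjE // [RHS]mxE.
  have [->|uxy] := eqVneq ((u - 1%:M) x y) 0; first by rewrite !mulr0.
  by rewrite (h _ _ uxy) char_wtB.
move=> x y uxy; apply/rowP => k.
(* The value at p of the cocharacter dual to e_k. Distinct powers of p have distinct exponents, so
   conjugation by this element reveals the k-th coordinate of [alpha]. *)
pose f z : Qp := p%:R ^ (wt z 0 k).
have fc z : f z * f (bar z) = 1.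
  have N (v : 'rV[int]_d) : (- v) 0 k = - v 0 k by rewrite mxE.
  by rewrite /f wt_bar N -expfzDr ?pQ_neq0 // subrr expr0z.
have Tt := torus_diag (oner_neq0 _) fc; set t := (\matrix_(_, _) _) in Tt.
have tE z : t z z = f z by rewrite mxE eqxx.
have kt : kappa t = 1.
  by have [c _ [-> _ _ tc]] := torus_entries Tt; rewrite -(tc x) !tE.
have := congr1 (fun M : mat => M x y) (h t Tt).
rewrite torus_conjE // [RHS]mxE => /(mulIf uxy); rewrite !tE /char kt exp1rz mulr1.
rewrite (bigD1 k) //= big1 ?mulr1; last first.
  move=> i ik; rewrite tE /f -/(ix false i) wt_ix expr0 scale1r mxE.
  by rewrite [k == i]eq_sym (negPf ik) andbF expr0z exp1rz.
rewrite tE /f -[lshift d k]/(ix false k) [wt (ix _ _)]wt_ix expr0 scale1r.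
rewrite [delta_mx _ _ _ _]mxE !eqxx expr1z.
by rewrite invr_expz -expfzDr ?pQ_neq0 // => /pexp_inj <-; rewrite !mxE.
Qed.
End Unitriangular.

Lemma addmxE (V : nmodType) m n (A B : 'M[V]_(m, n)) i j :
  (A + B) i j = A i j + B i j.
Proof. exact: mxE. Qed.

Lemma oppmxE (V : zmodType) m n (A : 'M[V]_(m, n)) i j : (- A) i j = - A i j.
Proof. exact: mxE. Qed.

(** * Root groups *)

Section Roots.
Variable d : nat.
Local Notation I := 'I_(d + d).
Implicit Types (x y z a b : I) (alpha : 'rV[int]_d).

(** A uniform shape for long roots ([a = b]) and short ones. The root subgroup occupies the
    positions [(a, bar b)] and [(b, bar a)], which coincide for a long root. *)
Lemma PhiP alpha : Phi alpha <-> exists a b, b != bar a /\ alpha = wt a + wt b.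
Proof.
split=> [[[i [j [s1 [s2 [ij ->]]]]]|[i [s ->]]]|[a [b [ba ->]]]].
- exists (ix s1 i), (ix s2 j); rewrite !wt_ix bar_ix ix_eq; split=> //.
  by rewrite [j == i]eq_sym (negPf ij) andbF.
- exists (ix s i), (ix s i); rewrite !wt_ix bar_ix ix_eq eqxx andbT; split; first by case: s.
  by rewrite mulr2n scalerDr.
have [h [i e]] := ixP a; have [k [j e']] := ixP b; subst a b.
rewrite !wt_ix; have [ij|ij] := eqVneq i j; last by left; exists i, j, h, k.
move: ba; rewrite ij bar_ix ix_eq eqxx andbT => kh; right; exists j, h.
by rewrite mulr2n scalerDr; case: h k kh => [] [].
Qed.

(** The place of a coordinate in the order of weights e_1, ..., e_d, - e_d, ..., - e_1, for which
    the positive roots are those of the positions above the diagonal. *)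
Definition w0 x : int := if half x then (d + d)%:Z - 1 - (pos x)%:Z else (pos x)%:Z.

Lemma w0_ix h i : w0 (ix h i) = if h then (d + d)%:Z - 1 - i%:Z else i%:Z.
Proof. by rewrite /w0 half_ix pos_ix. Qed.

Lemma w0_barsym : barsym w0.
Proof.
exists ((d + d)%:Z - 1) => x; have [h [i ->]] := ixP x; rewrite bar_ix !w0_ix.
by case: h; rewrite /= ?subrK // addrC subrK.
Qed.

Lemma w0_bound x : 0 <= w0 x < (d + d)%:Z.
Proof. by have [h [i ->]] := ixP x; rewrite w0_ix; have := ltn_ord i; case: h; lia. Qed.

Lemma w0_inj : injective w0.
Proof.
move=> x y; have [h [i ->]] := ixP x; have [k [j ->]] := ixP y; rewrite !w0_ix.
have := ltn_ord i; have := ltn_ord j => lj li e; apply/eqP; rewrite ix_eq -val_eqE /=.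
by case: h e; case: k => e /=; lia.
Qed.

Lemma w0_lt_half x y : half x = false -> half y = true -> w0 x < w0 y.
Proof. by rewrite /w0 => -> ->; have := ltn_ord (pos x); have := ltn_ord (pos y); lia. Qed.

Lemma Phi_posP alpha :
  Phi_pos alpha <-> exists x y, w0 x < w0 y /\ alpha = wt x - wt y.
Proof.
split=> [[[i [j [s [ij ->]]]]|[i ->]]|[x [y [xy ->]]]].
- exists (ix false i), (ix (~~ s) j); rewrite !w0_ix; split.
    by have := ltn_ord i; have := ltn_ord j; case: s => /=; lia.
  by rewrite !wt_ix expr0 scale1r signrN scaleNr opprK.
- exists (ix false i), (ix true i); rewrite !w0_ix; split.
    by have := ltn_ord i; lia.
  by rewrite !wt_ix expr0 scale1r expr1 scaleN1r opprK mulr2n.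
move: xy; have [h [i ->]] := ixP x; have [k [j ->]] := ixP y; rewrite !w0_ix !wt_ix.
have := ltn_ord i; have := ltn_ord j => lj li.
case: h; case: k => /= xy; rewrite ?expr0 ?expr1 ?scale1r ?scaleN1r.
- by left; exists j, i, true; rewrite expr1 scaleN1r opprK [LHS]addrC; split=> //; lia.
- lia.
- rewrite opprK; have [ij|ij|ij] := ltngtP i j.
  + by left; exists i, j, false; rewrite expr0 scale1r.
  + by left; exists j, i, false; rewrite expr0 scale1r addrC.
  + by right; exists i; rewrite mulr2n; congr (_ + delta_mx _ _); apply/val_inj.
- by left; exists i, j, true; rewrite expr1 scaleN1r; split=> //; lia.
Qed.

(** The coefficients 2d - 1, 2d - 3, ..., 1 are those of the sum of the positive coroots, so on
    roots this is twice the height. *)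
Definition ht alpha : int := \sum_(k < d) alpha 0 k * ((d + d)%:Z - 1 - k%:Z *+ 2).

Lemma ht_wtB x y : ht (wt x - wt y) = (w0 y - w0 x) *+ 2.
Proof.
have hD (u v : 'rV[int]_d) : ht (u - v) = ht u - ht v.
  by rewrite /ht -sumrB; apply: eq_bigr => k _; rewrite !mxE mulrBl.
have hw z : ht (wt z) = (d + d)%:Z - 1 - w0 z *+ 2.
  rewrite /ht (bigD1 (pos z)) //= big1 ?addr0; last first.
    by move=> k kz; rewrite !mxE (negPf kz) mulr0 mul0r.
  by rewrite !mxE !eqxx mulr1 /w0; case: (half z); rewrite /=; lia.
by rewrite hD !hw; lia.
Qed.
End Roots.

Section RootGroups.
Variables (p : nat) (p_pr : prime p) (d : nat) (d_gt0 : (0 < d)%N).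
Local Notation Qp := (padic p_pr).
Local Notation I := 'I_(d + d).
Local Notation mat := 'M[Qp]_(d + d).
Local Notation S := (Shat p_pr d).
Implicit Types (A B g h u t : mat) (x y z a b : I) (w : I -> int) (alpha : 'rV[int]_d).

Lemma Nroot_supp a b u x y : b != bar a -> Nroot (wt a + wt b) u ->
  (u - 1%:M) x y != 0 -> (x = a /\ y = bar b) \/ (x = b /\ y = bar a).
Proof.
move=> ba /(NrootP d_gt0)[_ h] /h; rewrite -wt_bar => /(wtD_inj ba)[[-> ->]|[-> ->]].
  by left; rewrite barK.
by right; rewrite barK.
Qed.

(** The rows [a], [b] of the support never meet its columns [bar a], [bar b]. Hence a root subgroup
    is additive in its off-diagonal part. *)
Lemma Nroot_mul0 a b u u' : b != bar a ->
  Nroot (wt a + wt b) u -> Nroot (wt a + wt b) u' -> (u - 1%:M) *m (u' - 1%:M) = 0.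
Proof.
move=> ba Nu Nu'; apply/matrixP => x y; rewrite !mxE big1 // => z _.
apply/eqP; apply: contraT; rewrite mulf_eq0 negb_or.
case/andP => /(Nroot_supp ba Nu) h1 /(Nroot_supp ba Nu') h2.
have ba' := bar_neq a; have bb' := bar_neq b; have ab : a != bar b by rewrite -bar_eq eq_sym.
case: h1 => -[_ ez]; case: h2 => -[ez' _]; rewrite ez in ez'.
- by rewrite ez' eqxx in ab.
- by rewrite ez' eqxx in bb'.
- by rewrite ez' eqxx in ba'.
- by rewrite ez' eqxx in ba.
Qed.

Lemma NrootM a b u u' : b != bar a -> Nroot (wt a + wt b) u ->
  Nroot (wt a + wt b) u' -> Nroot (wt a + wt b) (u *m u') /\
  u *m u' = 1%:M + (u - 1%:M) + (u' - 1%:M).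
Proof.
move=> ba Nu Nu'.
have e : u *m u' = 1%:M + (u - 1%:M) + (u' - 1%:M).
  have := Nroot_mul0 ba Nu Nu'; rewrite mulmxBl mulmxBr mul1mx mulmx1 => /eqP.
  by rewrite subr_eq0 subr_eq => /eqP->; rewrite [1%:M + (u - _)]addrC subrK addrC.
split=> //; apply/(NrootP d_gt0); split.
  by move/(NrootP d_gt0): Nu => [Gu _]; move/(NrootP d_gt0): Nu' => [Gu' _]; exact: GSpM.
have -> : u *m u' - 1%:M = (u - 1%:M) + (u' - 1%:M).
  by rewrite e -[1%:M + _ + _]addrA [LHS]addrC addKr.
move=> x y H.
have [h|h] : (u - 1%:M) x y != 0 \/ (u' - 1%:M) x y != 0.
- have [h|] := eqVneq ((u - 1%:M) x y) 0; [right|by left].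
  by move: H; rewrite addmxE h add0r.
- by move/(NrootP d_gt0): Nu => [_]; exact.
- by move/(NrootP d_gt0): Nu' => [_]; exact.
Qed.

Lemma Nroot1 alpha : Nroot alpha (1%:M : mat).
Proof.
by apply/(NrootP d_gt0); split=> [|x y]; [exact: GSp1|rewrite subrr mxE eqxx].
Qed.

Lemma NrootV a b u : b != bar a -> Nroot (wt a + wt b) u ->
  [/\ u \in unitmx, Nroot (wt a + wt b) (invmx u) & invmx u - 1%:M = - (u - 1%:M)].
Proof.
move=> ba Nu; have e : u *m (1%:M - (u - 1%:M)) = 1%:M.
  have := Nroot_mul0 ba Nu Nu; rewrite mulmxBl mul1mx => /eqP; rewrite subr_eq0 => /eqP e.
  by rewrite mulmxBr mulmx1 e opprB addrC subrK.
have [uu _] := mulmx1_unit e.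
have e' : invmx u - 1%:M = - (u - 1%:M).
  have -> : invmx u = 1%:M - (u - 1%:M) by rewrite -[RHS](mulKmx uu) e mulmx1.
  by rewrite addrC addKr.
split=> //; apply/(NrootP d_gt0); move/(NrootP d_gt0): Nu => [Gu h]; split.
  exact: GSpV.
by move=> x y; rewrite e' mxE oppr_eq0; exact: h.
Qed.

Lemma Nroot_subgroup alpha : Phi alpha -> subgroup (@Nroot _ p_pr _ alpha).
Proof.
move=> /PhiP[a [b [ba ->]]]; split=> [g Ng||g h Ng Nh|g Ng].
- by have [] := NrootV ba Ng.
- exact: Nroot1.
- by have [] := NrootM ba Ng Nh.
- by have [] := NrootV ba Ng.
Qed.

Lemma Nroot_unitri w a b : barsym w -> b != bar a -> w a < w (bar b) ->
  @Nroot _ p_pr _ (wt a + wt b) `<=` unitri w.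
Proof.
move=> ws ba wab u Nu; have E x y : u x y = (x == y)%:R + (u - 1%:M) x y.
  by rewrite addmxE oppmxE [_%:M _ _]mxE [RHS]addrC subrK.
have ab : a != bar b by rewrite -bar_eq eq_sym.
split; first by move/(NrootP d_gt0): Nu => [].
- move=> x; rewrite E eqxx; have [->|/(Nroot_supp ba Nu)] := eqVneq ((u - 1%:M) x x) 0.
    by rewrite addr0.
  by case=> -[-> e]; [rewrite -e eqxx in ab|rewrite -e eqxx in ba].
- move=> x y; rewrite E; have [->|xy] := eqVneq x y; first by left.
  rewrite add0r => /(Nroot_supp ba Nu)[] [-> ->]; right=> //.
  by rewrite -[b]barK (barsym_lt _ _ ws).
Qed.

Lemma Nroot_pos_unitri alpha : Phi_pos alpha -> @Nroot _ p_pr _ alpha `<=` unitri (@w0 d).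
Proof.
move=> /Phi_posP[x [y [xy ->]]]; rewrite -wt_bar; apply: Nroot_unitri.
- exact: w0_barsym.
- by rewrite (inj_eq (can_inj (@barK d))); apply: contraTneq xy => ->; rewrite ltxx.
- by rewrite barK.
Qed.

(* The sign [sg x] makes [Shat *m (rootmx a b c - 1)] symmetric. *)
Definition rootmx a b (c : Qp) : mat := 1%:M +
  \matrix_(x, y) if (x == a) && (bar y == b) || (x == b) && (bar y == a)
                 then c * sg p_pr x else 0.

Lemma rootmxE a b c x y : (rootmx a b c - 1%:M) x y =
  if (x == a) && (bar y == b) || (x == b) && (bar y == a) then c * sg p_pr x else 0.
Proof. by rewrite addrC addKr mxE. Qed.

Lemma rootmx_GSp a b c : b != bar a -> GSp (rootmx a b c).
Proof.
move=> ba; apply/GSp_similitude; exists 1; first exact: oner_neq0.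
have ab : a != bar b by rewrite -bar_eq eq_sym.
have := bar_neq a; have := bar_neq b => bb aa.
set X := rootmx a b c - 1%:M; have -> : rootmx a b c = 1%:M + X by rewrite addrC subrK.
have tX : (1%:M + X)^T = 1%:M + X^T by rewrite [LHS]raddfD /= trmx1.
(* Since [S *m X] is symmetric and [S] alternating, [X^T *m S] is the opposite of [S *m X]; as
   moreover [X *m X = 0], the expansion reduces to [S]. *)
rewrite /similitude tX mulmxDl mulmxDr !mulmxDl !mulmx1 !mul1mx scale1r.
have -> : X^T *m S = - (S *m X).
  apply/matrixP => x y; rewrite mul_mxShat oppmxE mul_Shatmx [X^T _ _]mxE !rootmxE; congr (- _).
  rewrite orbC ![(bar y == _) && _]andbC; case: ifP => _; last by rewrite mul0r mulr0.
  by rewrite !sg_bar [sg _ x * _]mulrC -!mulrA !mulNr !sgM.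
rewrite mulNmx; have -> : S *m X *m X = 0.
  rewrite -mulmxA; suff -> : X *m X = 0 by rewrite mulmx0.
  apply/matrixP => x y; rewrite mxE [RHS]mxE big1 // => z _; rewrite !rootmxE.
  case: ifP => [h1|]; last by rewrite mul0r.
  case: ifP => [h2|]; last by rewrite mulr0.
  move: h1 h2; rewrite !(bar_eq z).
  case/orP => /andP[_ /eqP ez]; case/orP => /andP[/eqP ez' _]; rewrite ez in ez'.
  - by rewrite ez' eqxx in ab.
  - by rewrite ez' eqxx in bb.
  - by rewrite ez' eqxx in aa.
  - by rewrite ez' eqxx in ba.
by rewrite oppr0 addr0 subrK.
Qed.

Lemma rootmx_Nroot a b c : b != bar a -> Nroot (wt a + wt b) (rootmx a b c).
Proof.
move=> ba; apply/(NrootP d_gt0); split=> [|x y]; first exact: rootmx_GSp.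
rewrite rootmxE -wt_bar; case: ifP => [|_]; last by rewrite eqxx.
by case/orP => /andP[/eqP-> /eqP->] _ //; rewrite addrC.
Qed.

Lemma rootmxM a b c c' : b != bar a -> rootmx a b c *m rootmx a b c' = rootmx a b (c + c').
Proof.
move=> ba; have [_ ->] := NrootM ba (rootmx_Nroot c ba) (rootmx_Nroot c' ba).
rewrite -addrA; congr (_ + _); apply/matrixP => x y; rewrite mxE !rootmxE mxE.
by case: ifP => _; rewrite ?addr0 // mulrDl.
Qed.

Lemma rootmx0 a b : rootmx a b 0 = 1%:M.
Proof.
rewrite /rootmx -[RHS]addr0; congr (_ + _); apply/matrixP => x y; rewrite !mxE.
by case: ifP; rewrite ?mul0r.
Qed.
End RootGroups.

(** * Factorization of unitriangular matrices into root elements *)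

Section Factorization.
Variables (p : nat) (p_pr : prime p) (d : nat) (d_gt0 : (0 < d)%N).
Local Notation Zp := (padic_int p_pr).
Local Notation Qp := (padic p_pr).
Local Notation I := 'I_(d + d).
Local Notation mat := 'M[Qp]_(d + d).
Implicit Types (A B g h u t : mat) (x y z a b : I) (w : I -> int) (alpha : 'rV[int]_d).
Local Notation w0 := (@w0 d).

Definition intmx g := forall x y, pdvd 0 (g x y).

Lemma intmxM g h : intmx g -> intmx h -> intmx (g *m h).
Proof.
by move=> ig ih x y; rewrite mxE; apply: pdvd_sum => z _; rewrite -[0]addr0; exact: pdvdM.
Qed.

Lemma intmx1 : intmx 1%:M.
Proof.
by move=> x y; rewrite mxE; case: eqP => _; rewrite -of_int_nat; exact: pdvd_int.
Qed.

Lemma pdvd_sg x : pdvd 0 (sg p_pr x).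
Proof.
by rewrite /sg; case: half; rewrite -of_int1 -?of_intN; exact: pdvd_int.
Qed.

Lemma intmx_unitriV w g : barsym w -> unitri w g -> intmx g -> intmx (invmx g).
Proof.
move=> ws Ug ig x y; have [_ ->] := unitri_invE d_gt0 ws Ug.
by rewrite -[0]addr0; apply: pdvdM => //; rewrite -[0]addr0; apply: pdvdM; exact: pdvd_sg.
Qed.

Lemma intmx_map g : intmx g -> exists B : 'M[Zp]_(d + d), map_mx (@of_int p p_pr) B = g.
Proof.
move=> ig; have ig' x y : exists c : Zp, g x y = of_int c.
  by have [c ->] := ig x y; exists c; rewrite expr0z mul1r.
exists (\matrix_(x, y) sval (cid (ig' x y))); apply/matrixP => x y; rewrite !mxE.
by case: cid.
Qed.

Lemma GLZp_intmx g : GLZp g -> intmx g.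
Proof. by case=> B _ <- x y; rewrite mxE; exact: pdvd_int. Qed.

Lemma intmx_GLZp g : g \in unitmx -> intmx g -> intmx (invmx g) -> GLZp g.
Proof.
move=> ug /intmx_map[B eB] /intmx_map[B' eB']; exists B => //.
have BB' : B *m B' = 1%:M.
  have := mulmxV ug; rewrite -{1}eB -eB' -[map_mx _ B]/(map_mx (@tofrac Zp) B).
  rewrite -[map_mx _ B']/(map_mx (@tofrac Zp) B') -map_mxM => /matrixP e.
  apply/matrixP => x y; have := e x y; rewrite [LHS]mxE [RHS]mxE => e1.
  apply/eqP; rewrite -(@tofrac_eq Zp); apply/eqP; rewrite [LHS]e1 mxE.
  by case: (x == y) => /=; rewrite ?tofrac1 ?tofrac0.
by have [] := mulmx1_unit BB'.
Qed.

(** The inverse has the same entries up to place and sign, so integrality of [g] passes to it. *)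
Lemma unitri_GLZp w g : barsym w -> unitri w g -> GLZp g <-> intmx g.
Proof.
move=> ws Ug; split=> [|ig]; first exact: GLZp_intmx.
apply: intmx_GLZp => //; last exact: intmx_unitriV ws Ug ig.
by have [] := unitri_invE d_gt0 ws Ug.
Qed.

Lemma rootmx_intmx a b c : pdvd 0 c -> intmx (rootmx a b c).
Proof.
move=> ic x y; rewrite addmxE; apply: pdvdD; first exact: intmx1.
rewrite mxE; case: ifP => _; last exact: pdvd0.
by rewrite -[0]addr0; apply: pdvdM => //; exact: pdvd_sg.
Qed.

Lemma off_diag1 g x y : x != y -> (g - 1%:M) x y = g x y.
Proof. by move=> xy; rewrite addmxE oppmxE [_%:M _ _]mxE (negPf xy) oppr0 addr0. Qed.

Lemma rootmx_mulE a b c g x y :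
  (rootmx a b c *m g) x y = g x y + \sum_z (rootmx a b c - 1%:M) x z * g z y.
Proof. by rewrite -{1}[rootmx a b c](subrK 1%:M) mulmxDl mul1mx addmxE addrC [X in _ + X]mxE. Qed.

(* An element of height at least [ht (wt a + wt b)] has, up to sign, the same entry at
   the two positions of the root [wt a + wt b]. *)
Lemma unitri_opp_entry a b g : b != bar a -> w0 a < w0 (bar b) -> unitri w0 g ->
  (forall x y, x != y -> g x y != 0 -> ht (wt a + wt b) <= ht (wt x - wt y)) ->
  g b (bar a) = sg p_pr a * sg p_pr b * g a (bar b).
Proof.
move=> ba wab Ug hg; have [ug gE] := unitri_invE d_gt0 (w0_barsym d) Ug.
have := congr1 (fun M : mat => M b (bar a)) (mulmxV ug).
have g1 : forall x, g x x = 1 by case: Ug.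
have wba : w0 b < w0 (bar a) by rewrite -[b]barK (barsym_lt _ _ (w0_barsym d)).
rewrite /= [RHS]mxE (negPf ba) mxE (bigD1 b) //= (bigD1 (bar a)) /=; last by rewrite eq_sym.
rewrite g1 mul1r big1 ?addr0 => [|z /andP[zb za]].
  rewrite !gE barK g1 sgM mulr1 sg_bar mulr1 addrC => /eqP.
  by rewrite addr_eq0 => /eqP->; rewrite mulrN !mulNr opprK [sg _ b * _]mulrC.
(* A middle index [z] with both factors nonzero would satisfy [w0 (bar a) <= w0 z] and
   [w0 z <= w0 b] by the bound on heights, against [w0 b < w0 (bar a)]. *)
apply/eqP; apply: contraT; rewrite gE !mulf_eq0 !negb_or barK => /and3P[gbz _ gaz].
have h1 := hg _ _ _ gbz; have h2 := hg _ _ _ gaz; rewrite eq_sym in zb.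
have az : a != bar z by rewrite -bar_eq eq_sym.
have hab : ht (wt a + wt b) = (w0 (bar b) - w0 a) *+ 2 by rewrite -ht_wtB wt_bar opprK.
move: (h1 zb) (h2 az); rewrite hab !ht_wtB.
have [k e] := w0_barsym d; have := e a; have := e b; have := e z.
case: Ug => _ _ gu.
have [ez|] := gu _ _ gbz; first by rewrite ez eqxx in zb.
have [ez|] := gu _ _ gaz; first by rewrite ez eqxx in az.
lia.
Qed.

(** Peel off a root of least height: multiplying by one root element clears both of its positions
    and otherwise changes [g] only at roots of greater height. The list [s] holds the roots at which
    [g] may still be nonzero and is closed under passing to greater heights. The parameters are
    entries of the successive matrices, so integrality is inherited. *)
Lemma unitri_factor (s : seq 'rV[int]_d) : sorted (fun al be => ht al <= ht be) s -> uniq s ->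
  (forall alpha, alpha \in s -> Phi_pos alpha) ->
  (forall alpha beta, alpha \in s -> Phi_pos beta -> ht alpha < ht beta -> beta \in s) ->
  forall g, unitri w0 g -> (forall x y, x != y -> g x y != 0 -> wt x - wt y \in s) ->
  exists u : 'rV[int]_d -> mat, [/\ forall alpha, alpha \in s -> Nroot alpha (u alpha),
     intmx g -> forall alpha, alpha \in s -> intmx (u alpha)
   & g = \prod_(alpha <- s) u alpha].
Proof.
have ht_trans : transitive (fun al be : 'rV[int]_d => ht al <= ht be).
  by move=> x y z; exact: le_trans.
elim: s => [|alpha s IH].
  move=> _ _ _ _ g [_ g1 _] gs; exists (fun=> 1%:M); split=> //; rewrite big_nil.
  apply/matrixP => x y; rewrite [RHS]mxE; have [->|xy] := eqVneq x y; first exact: g1.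
  by apply/eqP; apply: contraT => /(gs _ _ xy).
move=> s_sorted /andP[als s_uniq] s_pos s_up g Ug gs.
have hmin beta : beta \in alpha :: s -> ht alpha <= ht beta.
  rewrite inE => /orP[/eqP->|] //.
  by move: s_sorted; rewrite /= (path_sortedE ht_trans) => /andP[/allP h _] /h.
have [a [b [wab ab]]] : exists a b, w0 a < w0 (bar b) /\ alpha = wt a + wt b.
  have /Phi_posP[x [y [xy e]]] := s_pos _ (mem_head alpha s).
  by exists x, (bar y); rewrite barK wt_bar.
have ba : b != bar a.
  by apply: contraTneq wab => ->; rewrite barK ltxx.
(* The entry of [rootmx a b c] at [(a, bar b)] is [c] times the sign of [a], so this [c] reproduces
   the entry of [g]; [gab] below does the same for the second position. *)
pose c := sg p_pr a * g a (bar b).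
have gab : g b (bar a) = sg p_pr a * sg p_pr b * g a (bar b).
  by apply: unitri_opp_entry => // x y xy gxy; rewrite -ab; apply: hmin; exact: gs.
pose g' := rootmx a b (- c) *m g.
have alpha_pos := s_pos _ (mem_head alpha s).
have Nc (c' : Qp) : Nroot alpha (rootmx a b c') by rewrite ab; exact: rootmx_Nroot.
have Uc (c' : Qp) : unitri w0 (rootmx a b c') := Nroot_pos_unitri d_gt0 alpha_pos (Nc c').
have Ug' : unitri w0 g' by exact: unitriM.
have gK : g = rootmx a b c *m g' by rewrite mulmxA rootmxM // subrr rootmx0 mul1mx.
have g1 : forall x, g x x = 1 by case: Ug.
have g's x y : x != y -> g' x y != 0 -> wt x - wt y \in s.
  move=> xy; have [exy|nxy] := eqVneq (wt x - wt y) alpha.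
    suff -> : g' x y = 0 by rewrite eqxx.
    have Xx z : (rootmx a b (- c) - 1%:M) x z != 0 -> z = y.
      move/(NrootP d_gt0): (Nc (- c)) => [_ h] /h; rewrite -exy => /addrI.
      by move/(congr1 -%R); rewrite !opprK => /wt_inj.
    rewrite rootmx_mulE (bigD1 y) //= big1 ?addr0 => [|z zy]; last first.
      by apply/eqP; apply: contraT; rewrite mulf_eq0 negb_or => /andP[/Xx e]; rewrite e eqxx in zy.
    rewrite g1 mulr1 rootmxE.
    have : wt a + wt b = wt x + wt (bar y) by rewrite wt_bar exy.
    move=> /(wtD_inj ba)[[<- e]|[e <-]].
      by rewrite -e eqxx eqxx /= /c -(barK y) -e mulNr mulrAC sgM mul1r subrr.
    have ey : y = bar a by rewrite e barK.
    by rewrite -e !eqxx orbT ey gab /c mulNr mulrAC subrr.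
  have in_s : wt x - wt y \in alpha :: s -> wt x - wt y \in s.
    by rewrite inE (negPf nxy).
  have [gxy|gxy _] := eqVneq (g x y) 0; last by apply: in_s; exact: gs.
  (* An entry created at [(x, y)] comes from one at [(x, z)], of weight [alpha], and one of [g] at
     [(z, y)], of positive height; so its root is strictly higher than [alpha]. *)
  rewrite rootmx_mulE gxy add0r => H.
  have [z hz] : exists z, (rootmx a b (- c) - 1%:M) x z * g z y != 0.
    apply/existsP; apply: contraNT H; rewrite negb_exists => /forallP H.
    by rewrite big1 // => z _; have := H z; rewrite negbK => /eqP.
  move: hz; rewrite mulf_eq0 negb_or => /andP[hx gzy].
  move/(NrootP d_gt0): (Nc (- c)) => [_ /(_ _ _ hx) e].
  have zy : z != y by apply: contraNneq nxy => <-; rewrite -e.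
  have wzy : w0 z < w0 y.
    by case: Ug => _ _ /(_ _ _ gzy)[ez|//]; rewrite ez eqxx in zy.
  have wxz : w0 x < w0 z.
    have := Nroot_pos_unitri d_gt0 alpha_pos (Nc (- c)).
    have xz : x != z.
      apply: contraTneq hx => ->; case: (Uc (- c)) => _ r1 _.
      by rewrite addmxE oppmxE r1 [_%:M _ _]mxE eqxx subrr eqxx.
    by move: hx; rewrite off_diag1 // => hx [_ _ /(_ _ _ hx)[ez|//]]; rewrite ez eqxx in xz.
  apply: in_s; apply: (s_up alpha); first exact: mem_head.
    by apply/Phi_posP; exists x, y; split=> //; exact: lt_trans wxz wzy.
  rewrite e !ht_wtB; lia.
have [||||u [uN uI uE]] := IH _ _ _ _ g' Ug' g's.
- exact: path_sorted s_sorted.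
- by [].
- by move=> be bes; apply: s_pos; rewrite inE bes orbT.
- move=> be ga bes ga_pos lt_ht.
  have : ga \in alpha :: s by apply: (s_up be) => //; rewrite inE bes orbT.
  rewrite inE => /orP[/eqP ega|//]; have := hmin be; rewrite inE bes orbT => /(_ isT).
  by rewrite -ega leNgt lt_ht.
exists (fun be => if be == alpha then rootmx a b c else u be); split.
- move=> be; rewrite inE; case: eqP => [->|_] //=; exact: uN.
- move=> ig; have ic : pdvd 0 c.
    by rewrite /c -[0]addr0; apply: pdvdM => //; exact: pdvd_sg.
  have ig' : intmx g'.
    by apply: intmxM => //; apply: rootmx_intmx; exact: pdvdN.
  move=> be; rewrite inE; case: eqP => [_ _|_] /=; first exact: rootmx_intmx.
  exact: uI.
- rewrite big_cons eqxx -mulmxE {1}gK uE; congr (_ *m _).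
  by apply: eq_big_seq => be bes; rewrite ifN //; apply: contraNneq als => <-.
Qed.

Definition pos_roots : seq 'rV[int]_d := sort (fun al be => ht al <= ht be)
  (undup [seq wt xy.1 - wt xy.2 | xy <- enum {: I * I} & w0 xy.1 < w0 xy.2]).

Lemma mem_pos_roots alpha : alpha \in pos_roots <-> Phi_pos alpha.
Proof.
rewrite mem_sort mem_undup Phi_posP; split=> [/mapP[[x y]]|[x [y [xy ->]]]].
  by rewrite mem_filter /= => /andP[xy _] ->; exists x, y.
by apply/mapP; exists (x, y); rewrite // mem_filter xy mem_enum.
Qed.

Lemma unitri_pos_factor g : unitri w0 g ->
  exists u : 'rV[int]_d -> mat, [/\ forall alpha, Phi_pos alpha -> Nroot alpha (u alpha),
     intmx g -> forall alpha, Phi_pos alpha -> intmx (u alpha)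
   & g = \prod_(alpha <- pos_roots) u alpha].
Proof.
move=> Ug; have [|||||u [uN uI uE]] := @unitri_factor pos_roots _ _ _ _ g Ug.
- by apply: sort_sorted => x y; exact: le_total.
- by rewrite sort_uniq undup_uniq.
- by move=> al /mem_pos_roots.
- by move=> al be _ be_pos _; apply/mem_pos_roots.
- move=> x y xy gxy; apply/mem_pos_roots/Phi_posP; exists x, y; split=> //.
  by case: Ug => _ _ /(_ _ _ gxy)[exy|//]; rewrite exy eqxx in xy.
exists u; split=> // [al /mem_pos_roots|ig al /mem_pos_roots]; [exact: uN|exact: uI].
Qed.

Lemma prod_subgroup (H : set mat) (s : seq 'rV[int]_d) (u : 'rV[int]_d -> mat) :
  subgroup H -> (forall al, al \in s -> H (u al)) -> H (\prod_(al <- s) u al).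
Proof.
move=> [_ H1 HM _]; elim: s => [|al s IH] Hs; first by rewrite big_nil.
rewrite big_cons -mulmxE; apply: HM; first by apply: Hs; exact: mem_head.
by apply: IH => be bes; apply: Hs; rewrite inE bes orbT.
Qed.

(** Products in order of height already exhaust the unitriangular group; so N is a group, and
    membership becomes a condition on entries. *)
Lemma NposE : @Npos _ p_pr d = unitri w0.
Proof.
apply/seteqP; split=> [g [s [u [_ sP uN ->]]]|g Ug].
  apply: prod_subgroup; first exact: unitri_subgroup (w0_barsym d).
  by move=> al /sP al_pos; apply: (Nroot_pos_unitri d_gt0 al_pos); exact: uN.
have [u [uN _ uE]] := unitri_pos_factor Ug; exists pos_roots, u; split=> //.
  by rewrite sort_uniq undup_uniq.
exact: mem_pos_roots.
Qed.

(** An integral element of N factors into integral root elements, so N_0 is all of the integral part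
    of N. *)
Lemma N0E : @N0 _ p_pr d = [set g | unitri w0 g /\ intmx g].
Proof.
have w0s := w0_barsym d.
apply/seteqP; split=> [g|g [Ug ig]].
  apply; first split.
  - by move=> {}g [Ug _]; have [] := unitri_invE d_gt0 w0s Ug.
  - by split; [exact: unitri1|exact: intmx1].
  - by move=> h k [Uh ih] [Uk ik]; split; [exact: unitriM|exact: intmxM].
  - by move=> h [Uh ih]; split; [exact: unitriV|exact: intmx_unitriV Uh ih].
  move=> u [al al_pos [Nu /GLZp_intmx iu]]; split=> //.
  exact: (Nroot_pos_unitri d_gt0 al_pos).
have [u [uN uI ->]] := unitri_pos_factor Ug => H sH genH.
apply: prod_subgroup => // al /mem_pos_roots al_pos; apply: genH.
exists al => //; split; first exact: uN.
apply/(unitri_GLZp w0s); last exact: uI.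
by apply: (Nroot_pos_unitri d_gt0 al_pos); exact: uN.
Qed.
End Factorization.

Lemma mulr_involK (R : comPzRingType) (a s q q' : R) :
  s * s = 1 -> q * q' = 1 -> a = s * (q * (a * s * q')).
Proof.
move=> ss qq; have -> : s * (q * (a * s * q')) = (s * s) * (q * q') * a by ring.
by rewrite ss qq !mul1r.
Qed.

(** * Chambers of the apartment *)

Section Weights.
Variables (d : nat) (d_gt0 : (0 < d)%N).
Local Notation I := 'I_(d + d).
Local Notation n := ((d + d)%:Z).
Implicit Types (x y : I) (t k m : int) (w : I -> int).

Definition cdiv (k : int) : int := - ((- k) %/ n)%Z.

Lemma cdivP k : k <= n * cdiv k /\ n * cdiv k <= k + n - 1.
Proof.
have n0 : n != 0 by have := d_gt0; lia.
have := divz_eq (- k) n; have := modz_ge0 (- k) n0; have := ltz_mod (- k) n0.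
rewrite /cdiv; set q := (_ %/ _)%Z; set r := (_ %% _)%Z; rewrite gtr0_norm; last by lia.
by rewrite mulrN [n * q]mulrC; set qn := q * n; lia.
Qed.

Lemma cdiv_le k m : (cdiv k <= m) = (k <= n * m).
Proof.
have [h1 h2] := cdivP k; have := d_gt0 => d0; move: (cdiv k) h1 h2 => c h1 h2.
by apply/idP/idP; nia.
Qed.

Definition sep w := forall x y m, w x - w y = n * m -> x = y.

(** Injectivity of the residues of 2d weights modulo 2d forces surjectivity. Hence raising [t] by
    one shrinks the lattice at exactly one coordinate, and the chain has no gaps. *)
Lemma sep_full w t : sep w -> exists x m, w x + t = n * m.
Proof.
move=> ws; have n0 : n != 0 by have := d_gt0; lia.
have lt_mod k : (`|(k %% n)%Z| < d + d)%N.
  by have := modz_ge0 k n0; have := ltz_mod k n0; lia.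
pose f x : I := Ordinal (lt_mod (w x + t)).
have f_inj : injective f.
  move=> x y /(congr1 val) /= e.
  have {}e : ((w x + t) %% n = (w y + t) %% n)%Z.
    by have := modz_ge0 (w x + t) n0; have := modz_ge0 (w y + t) n0; lia.
  apply: (ws _ _ (((w x + t) %/ n)%Z - ((w y + t) %/ n)%Z)).
  rewrite mulrBr; have := divz_eq (w x + t) n; have := divz_eq (w y + t) n.
  by rewrite e; lia.
have [g fK gK] := injF_bij f_inj; have lt0 : (0 < d + d)%N by have := d_gt0; lia.
exists (g (Ordinal lt0)), ((w (g (Ordinal lt0)) + t) %/ n)%Z.
have := congr1 val (gK (Ordinal lt0)); rewrite /= => e0.
have := divz_eq (w (g (Ordinal lt0)) + t) n.
have -> : ((w (g (Ordinal lt0)) + t) %% n)%Z = 0 by apply/eqP; rewrite -absz_eq0 e0.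
by lia.
Qed.

Lemma w0_sep : sep (@w0 d).
Proof.
move=> x y m e; apply: w0_inj; have := w0_bound x; have := w0_bound y.
move: e; move: (w0 x) (w0 y) => k l e.
have : m = 0 \/ m <= -1 \/ 1 <= m by lia.
by case=> [m0|[m1|m1]]; [rewrite m0 in e; lia|nia|nia].
Qed.

End Weights.

(** * Lattices attached to weights, their homothety and duality *)

Section LatticeChains.
Variables (p : nat) (p_pr : prime p) (d : nat) (d_gt0 : (0 < d)%N).
Local Notation Zp := (padic_int p_pr).
Local Notation Qp := (padic p_pr).
Local Notation I := 'I_(d + d).
Local Notation mat := 'M[Qp]_(d + d).
Local Notation vec := 'cV[Qp]_(d + d).
Local Notation S := (Shat p_pr d).
Local Notation n := ((d + d)%:Z).
Implicit Types (A B g h u : mat) (x y : I) (t k m : int) (w : I -> int) (z : Qp) (v : vec).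
Implicit Types (L M : set vec) (D : set (set vec)).

(* [gdvd k z] : the valuation of [z] is at least [k / (2 d)]. *)
Definition gdvd (k : int) z := exists m : int, k <= n * m /\ pdvd m z.

Lemma gdvd_le k k' z : k' <= k -> gdvd k z -> gdvd k' z.
Proof. by move=> kk [m [km mz]]; exists m; split=> //; exact: le_trans km. Qed.

Lemma gdvd0 k : gdvd k 0.
Proof.
exists `|k|; split; last exact: pdvd0.
have := d_gt0; nia.
Qed.

Lemma gdvdD k z z' : gdvd k z -> gdvd k z' -> gdvd k (z + z').
Proof.
move=> [m [km mz]] [m' [km' mz']]; case: (leP m m') => mm.
  by exists m; split=> //; apply: pdvdD => //; exact: pdvd_le mz'.
by exists m'; split=> //; apply: pdvdD => //; exact: pdvd_le (ltW mm) mz.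
Qed.

Lemma gdvdN k z : gdvd k z -> gdvd k (- z).
Proof. by move=> [m [km mz]]; exists m; split=> //; exact: pdvdN. Qed.

Lemma gdvdM k k' z z' : gdvd k z -> gdvd k' z' -> gdvd (k + k') (z * z').
Proof.
move=> [m [km mz]] [m' [km' mz']]; exists (m + m'); split; last exact: pdvdM.
by rewrite mulrDr lerD.
Qed.

Lemma gdvd_sum k (J : Type) (r : seq J) (P : pred J) (F : J -> Qp) :
  (forall i, P i -> gdvd k (F i)) -> gdvd k (\sum_(i <- r | P i) F i).
Proof. by move=> h; elim/big_ind: _ => //; [exact: gdvd0 | exact: gdvdD]. Qed.

Lemma pdvd_gdvd m z : pdvd m z -> gdvd (n * m) z.
Proof. by exists m. Qed.

(** Valuations are integers, so a bound that is not an integer may be raised to the next multiple of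
    1 / (2d). *)
Lemma gdvd_step k z : (forall m, k <> n * m) -> gdvd k z -> gdvd (k + 1) z.
Proof.
move=> nk [m [km mz]]; exists m; split=> //.
by rewrite lezD1 lt_neqAle km andbT; apply/eqP; exact: nk.
Qed.

Lemma gdvdE k z : gdvd k z <-> pdvd (cdiv d k) z.
Proof.
split=> [[m [km mz]]|h]; first by apply: pdvd_le mz; rewrite (cdiv_le d_gt0).
by exists (cdiv d k); split=> //; have [] := cdivP d_gt0 k.
Qed.

Lemma gdvd_int z : gdvd (1 - n) z <-> pdvd 0 z.
Proof.
have -> : pdvd 0 z <-> pdvd (cdiv d (1 - n)) z; last exact: gdvdE.
suff -> : cdiv d (1 - n) = 0 by [].
by have [h1 h2] := cdivP d_gt0 (1 - n); have := d_gt0; move: (cdiv _ _) h1 h2 => c; nia.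
Qed.

Lemma gdvd_pexp k m : gdvd k (p%:R ^ m) <-> k <= n * m.
Proof.
split=> [[m' [km]]|km]; last by exists m; split=> //; exact: pdvd_exp.
rewrite -[_ ^ m]mulr1 -of_int1 => /(pdvd_unit (mulr1 1)) mm.
by apply: le_trans km _; have := d_gt0; nia.
Qed.

Lemma gdvd_ex z : exists k, gdvd k z.
Proof. by have [m h] := pdvd_ex z; exists (n * m); exact: pdvd_gdvd. Qed.

Lemma gdvd_bot z : z != 0 -> exists k, ~ gdvd k z.
Proof.
move=> /pdvd_val[m [_ _ h]]; exists (n * m + 1) => -[m' [mm]].
have mm' : m + 1 <= m' by move: mm; have := d_gt0; nia.
by move/(pdvd_le mm').
Qed.

Definition Lat w (t : int) : set vec := [set v | forall x, gdvd (w x + t) (v x 0)].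
Definition chain w : set (set vec) := [set Lat w t | t in [set: int]].
Lemma Lat_le w t t' : t <= t' -> Lat w t' `<=` Lat w t.
Proof. by move=> tt v vL x; apply: gdvd_le (vL x); rewrite lerD2l. Qed.

Definition pvec x (m : int) : vec := \col_y if y == x then p%:R ^ m else 0.

Lemma LatZ w t (m : int) (c : Qp) v : pdvd m c -> Lat w t v -> Lat w (t + n * m) (c *: v).
Proof.
by move=> mc h x; rewrite mxE addrA addrC; apply: gdvdM => //; exact: pdvd_gdvd.
Qed.

Lemma pvec_Lat w t x m : Lat w t (pvec x m) <-> w x + t <= n * m.
Proof.
split=> [/(_ x)|h y]; first by rewrite mxE eqxx => /gdvd_pexp.
by rewrite mxE; case: eqP => [->|_]; [exact/gdvd_pexp|exact: gdvd0].
Qed.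

Lemma LatS w t t' : sep w -> Lat w t `<=` Lat w t' -> t' <= t.
Proof.
move=> ws h; have [x [m e]] := sep_full d_gt0 t ws.
have /h/pvec_Lat : Lat w t (pvec x m) by apply/pvec_Lat; rewrite e.
by lia.
Qed.

Lemma Lat_inj w t t' : sep w -> Lat w t = Lat w t' -> t = t'.
Proof.
by move=> ws e; apply/eqP; rewrite eq_le !(@LatS w) // e.
Qed.

Lemma homothetic_Lat w t c : c != 0 -> exists m, homothetic c (Lat w t) = Lat w (t + n * m).
Proof.
move=> c0; have [m [mc mV _]] := pdvd_val c0; exists m.
apply/seteqP; split=> [_ [v vL <-]|v vL]; first exact: LatZ.
exists (c^-1 *: v); last by rewrite scalerA mulfV // scale1r.
by have := LatZ mV vL; rewrite mulrN addrK.
Qed.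

Lemma homothetic_pexp w t m : homothetic (p%:R ^ m) (Lat w t) = Lat w (t + n * m).
Proof.
have p0 k : (p%:R : Qp) ^ k != 0 by rewrite expfz_neq0 // pQ_neq0.
apply/seteqP; split=> [_ [v vL <-]|v vL]; first by apply: LatZ => //; exact: pdvd_exp.
exists (p%:R ^ (- m) *: v); last by rewrite scalerA -expfzDr ?pQ_neq0 // subrr expr0z scale1r.
by have := LatZ (pdvd_exp _ (- m)) vL; rewrite mulrN addrK; apply.
Qed.

(** Testing on vectors supported at [bar x], duality bounds the valuation of [v x 0] below by minus
    the ceiling of (w (bar x) + t) / 2d, which is a floor. The shift [1 - n] turns this floor back
    into a ceiling. *)
Lemma dual_Lat w t c : (forall x, w x + w (bar x) = c) ->
  dual (Lat w t) = Lat w (1 - n - c - t).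
Proof.
move=> wc; have E v v' : (v^T *m S *m v') 0 0 = \sum_x v x 0 * sg p_pr x * v' (bar x) 0.
  by rewrite -mulmxA mxE; apply: eq_bigr => x _; rewrite mul_Shatmx mxE mulrA.
apply/seteqP; split=> v h.
  move=> x; pose M := cdiv d (w (bar x) + t).
  have [M1 M2] := cdivP d_gt0 (w (bar x) + t).
  have /h[z] : Lat w t (pvec (bar x) M) by apply/pvec_Lat.
  rewrite E (bigD1 x) //= big1 ?addr0; last first.
    by move=> y yx; rewrite mxE (inj_eq (can_inj (@barK d))) (negPf yx) mulr0.
  rewrite mxE eqxx => e.
  have ev : v x 0 = sg p_pr x * (p%:R ^ (- M) * of_int z).
    have pM : (p%:R : Qp) ^ (- M) * p%:R ^ M = 1.
      by rewrite -expfzDr ?pQ_neq0 // addNr expr0z.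
    by rewrite -e; apply: mulr_involK => //; exact: sgM.
  rewrite ev; exists (- M); split.
    by have := wc x; rewrite /M in M1 M2 *; lia.
  suff: pdvd (0 + - M) (sg p_pr x * (p%:R ^ (- M) * of_int z)) by rewrite add0r.
  by apply: pdvdM; [exact: pdvd_sg|exists z].
move=> u uL; rewrite E; suff : pdvd 0 (\sum_x v x 0 * sg p_pr x * u (bar x) 0).
  by case=> z ->; exists z; rewrite expr0z mul1r.
apply: pdvd_sum => x _; apply/gdvd_int.
have -> : 1 - n = (w x + (1 - n - c - t)) + n * 0 + (w (bar x) + t) by have := wc x; lia.
by apply: gdvdM => //; apply: gdvdM => //; apply: pdvd_gdvd; exact: pdvd_sg.
Qed.

Lemma Lat_split w t : split_lattice (Lat w t).
Proof.
exists (fun x => cdiv d (w x + t)); apply/seteqP; split=> v h x.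
  by have /gdvdE := h x.
by apply/gdvdE; exact: h.
Qed.

Lemma Lat_lattice w t : lattice (Lat w t).
Proof.
pose f x : Qp := p%:R ^ cdiv d (w x + t).
exists (diag_mx (\row_x f x)).
  rewrite unitmxE det_diag unitfE; apply/prodf_neq0 => x _.
  by rewrite mxE expfz_neq0 // pQ_neq0.
apply/seteqP; split=> [v vL|_ [c _ <-] x].
  have h x : exists c : Zp, v x 0 = f x * of_int c by have /gdvdE := vL x.
  exists (\col_x sval (cid (h x))) => //; apply/matrixP => x j; rewrite ord1.
  by rewrite mul_diag_mx !mxE; case: cid.
by apply/gdvdE; rewrite mul_diag_mx !mxE; exists (c x 0).
Qed.
End LatticeChains.

Lemma int_switch (P : int -> Prop) a (k : nat) :
  P a -> ~ P (a + k%:Z) -> exists t, P t /\ ~ P (t + 1).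
Proof.
elim: k a => [|k IH] a Pa; first by rewrite addr0.
move=> nP; have [Pa1|nPa1] := pselect (P (a + 1)); last by exists a.
by apply: IH Pa1 _; rewrite -addrA -[1 + _]/(k.+1%:Z).
Qed.

Lemma finite_lower_bound (J : finType) (P : J -> int -> Prop) :
  (forall j k k', k' <= k -> P j k -> P j k') ->
  (forall j, exists k, P j k) -> exists k, forall j, P j k.
Proof.
move=> Ple /(_ _)/cid Pex; exists (- \sum_j `|sval (Pex j)|) => j.
apply: Ple (svalP (Pex j)); rewrite (bigD1 j) //=.
have : 0 <= \sum_(i | i != j) `|sval (Pex i)| by apply: sumr_ge0.
move: (\sum_(i | _) _) (sval _) => s v; lia.
Qed.

(** * Chambers and panels as chains of lattices *)

Section Chambers.
Variables (p : nat) (p_pr : prime p) (d : nat) (d_gt0 : (0 < d)%N).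
Local Notation Zp := (padic_int p_pr).
Local Notation Qp := (padic p_pr).
Local Notation I := 'I_(d + d).
Local Notation mat := 'M[Qp]_(d + d).
Local Notation vec := 'cV[Qp]_(d + d).
Local Notation n := ((d + d)%:Z).
Local Notation Lat := (@Lat p p_pr d).
Local Notation chain := (@chain p p_pr d).
Implicit Types (A B g h u : mat) (x y : I) (t k m : int) (w : I -> int) (z : Qp) (v : vec).
Implicit Types (L M : set vec) (D P : set (set vec)) (T : set int).

Definition subchain w T : set (set vec) := [set Lat w t | t in T].

Lemma subchain_facet w T c : (forall x, w x + w (bar x) = c) -> T !=set0 ->
  (forall t m, T t -> T (t + n * m)) -> (forall t, T t -> T (1 - n - c - t)) ->
  facet (subchain w T).
Proof.
move=> wc [t0 Tt0] Tn Td; split.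
- by exists (Lat w t0), t0.
- by move=> _ [t _ <-]; exact: Lat_lattice.
- move=> _ _ [t _ <-] [t' _ <-]; case: (leP t t') => tt; [right|left].
    exact: Lat_le.
  by apply: Lat_le; exact: ltW.
- move=> _ c' [t Tt <-] c0; have [m ->] := homothetic_Lat w t c0.
  by exists (t + n * m) => //; exact: Tn.
- move=> _ [t Tt <-]; rewrite (dual_Lat p_pr d_gt0 t wc).
  by exists (1 - n - c - t) => //; exact: Td.
Qed.

Lemma chain_facet w : barsym w -> facet (chain w).
Proof. by move=> [c wc]; apply: (subchain_facet wc) => //; exists 0. Qed.

Lemma lattice_add L v v' : lattice L -> L v -> L v' -> L (v + v').
Proof.
move=> [g _ ->] [a _ <-] [b _ <-]; exists (a + b) => //.
rewrite -mulmxDr; congr (_ *m _); apply/matrixP => x y.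
by rewrite addmxE !mxE of_intD.
Qed.

Lemma lattice_scale L (c : Zp) v : lattice L -> L v -> L (of_int c *: v).
Proof.
move=> [g _ ->] [a _ <-]; exists (c *: a) => //.
by rewrite scalemxAr; congr (_ *m _); apply/matrixP => x y; rewrite !mxE of_intM.
Qed.

Lemma lattice_neq0 L : lattice L -> exists v x, L v /\ v x 0 != 0.
Proof.
move=> [g ug ->]; pose x0 : I := ix false (Ordinal d_gt0).
pose e : 'cV[Zp]_(d + d) := \col_y (y == x0)%:R.
exists (g *m map_mx (@of_int p p_pr) e).
have ge x : (g *m map_mx (@of_int p p_pr) e) x 0 = g x x0.
  rewrite mxE (bigD1 x0) //= big1 ?addr0 => [|y yx].
    by rewrite !mxE eqxx of_int1 mulr1.
  by rewrite !mxE (negPf yx) of_int0 mulr0.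
have [x gx] : exists x, g x x0 != 0.
  apply: contrapT => h; have g0 x : g x x0 = 0.
    by apply/eqP; apply: contraT => gx; case: h; exists x.
  have := congr1 (fun M : mat => M x0 x0) (mulVmx ug).
  rewrite /= mxE big1 => [|y _]; last by rewrite g0 mulr0.
  by rewrite mxE eqxx => /eqP; rewrite eq_sym oner_eq0.
by exists x; split; [exists e|rewrite ge].
Qed.

Lemma lattice_bounded L w : lattice L -> exists t, L `<=` Lat w t.
Proof.
move=> [g ug ->].
have [t ht] : exists t, forall xy : I * I, gdvd d (w xy.1 + t) (g xy.1 xy.2).
  apply: finite_lower_bound => [xy k k' kk|[x y]]; first by apply: gdvd_le; rewrite lerD2l.
  by have [k h] := gdvd_ex d (g x y); exists (k - w x); rewrite subrKC.
exists t => _ [c _ <-] x; rewrite mxE; apply: (gdvd_sum d_gt0) => y _.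
rewrite -[w x + t]addr0 mxE; apply: gdvdM; first exact: (ht (x, y)).
by exists 0; rewrite mulr0; split=> //; exact: pdvd_int.
Qed.

Lemma lattice_unbounded L w : lattice L -> exists t, ~ (L `<=` Lat w t).
Proof.
move=> /lattice_neq0[v [x [Lv vx]]]; have [k hk] := gdvd_bot d_gt0 vx.
by exists (k - w x) => /(_ v Lv x); rewrite subrKC.
Qed.

(** For the last [t] with [L] inside [Lat w t], comparability puts [L] between [Lat w (t + 1)] and
    [Lat w t]. The quotient of these two is a line over F_p, since only one coordinate [x] has
    [w x + t] divisible by 2d; any vector of [L] outside the smaller lattice spans it, and [L] is
    the larger one. This gives maximality of the chain. *)
Lemma comparable_chain w L : sep w -> lattice L ->
  (forall t, L `<=` Lat w t \/ Lat w t `<=` L) -> chain w L.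
Proof.
move=> ws latL cmpL.
have [t1 h1] := lattice_bounded w latL; have [t2 h2] := lattice_unbounded w latL.
have t12 : t1 <= t2.
  rewrite leNgt; apply/negP => tt; apply: h2; apply: subset_trans h1 _.
  by apply: Lat_le; exact: ltW.
have [t [Lt nLt1]] : exists t, L `<=` Lat w t /\ ~ (L `<=` Lat w (t + 1)).
  apply: (@int_switch (fun t => L `<=` Lat w t) t1 `|t2 - t1|%N) => //.
  by rewrite abszE ger0_norm ?subr_ge0 // subrKC.
have Lt1 : Lat w (t + 1) `<=` L by case: (cmpL (t + 1)).
exists t => //; apply/seteqP; split=> // u uL.
have [v [Lv nv]] : exists v, L v /\ ~ Lat w (t + 1) v.
  by move/existsNP: nLt1 => [v /not_implyP]; exists v.
have [x nx] : exists x, ~ gdvd d (w x + (t + 1)) (v x 0) by move/existsNP: nv.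
have vx := Lt v Lv x.
have [m em] : exists m, w x + t = n * m.
  apply: contrapT => h; apply: nx; rewrite addrA; apply: gdvd_step => // m e.
  by apply: h; exists m.
have vx0 : v x 0 != 0 by apply: contra_not_neq nx => ->; exact: gdvd0.
have [k [k1 k2 k3]] := pdvd_val vx0.
have km : k = m.
  move: vx; rewrite em => -[m' [mm' m'v]].
  have h1' : m <= m' by move: mm'; have := d_gt0; nia.
  have h2' : m' <= k.
    by rewrite leNgt; apply/negP => km; apply: k3; apply: pdvd_le m'v; lia.
  have h3' : k <= m.
    rewrite leNgt; apply/negP => km; apply: nx; exists k; split=> //.
    by rewrite addrA em; move: km; have := d_gt0; nia.
  by apply/eqP; rewrite eq_le h3' (le_trans h1').
have [c ec] : exists c : Zp, u x 0 / v x 0 = of_int c.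
  have : gdvd d (n * m + n * (- m)) (u x 0 / v x 0).
    apply: gdvdM; first by rewrite -em; exact: uL.
    by apply: pdvd_gdvd; rewrite -km.
  rewrite mulrN subrr => h.
  have : pdvd 0 (u x 0 / v x 0).
    by apply/(gdvd_int d_gt0); apply: gdvd_le h; have := d_gt0; lia.
  by case=> c ->; exists c; rewrite expr0z mul1r.
(* Subtracting this multiple of [v] kills the coordinate [x]; at every other coordinate the bound at
   level [t] is not an integer and improves to level [t + 1] for free. *)
have -> : u = of_int c *: v + (u - of_int c *: v) by rewrite subrKC.
apply: lattice_add => //; first exact: lattice_scale.
apply: Lt1 => y; rewrite addmxE oppmxE [(_ *: v) _ _]mxE.
have [->|yx] := eqVneq y x.
  by rewrite -ec divfK // subrr; exact: gdvd0.
rewrite addrA; apply: gdvd_step => [k' e|].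
  by move/eqP: yx; apply; apply: (ws _ _ (k' - m)); rewrite mulrBr -em -e; ring.
apply: gdvdD; first exact: uL.
apply: gdvdN; rewrite -[w y + t]add0r; apply: gdvdM; last exact: Lt.
by exists 0; rewrite mulr0; split=> //; exact: pdvd_int.
Qed.

Lemma chain_apartment_chamber w : sep w -> barsym w -> apartment_chamber (chain w).
Proof.
move=> ws wb; split=> [|_ [t _ <-]]; last exact: Lat_split.
split=> [|D' [_ latD cmpD _ _] sub]; first exact: chain_facet.
apply/seteqP; split=> // L DL; apply: comparable_chain => //; first exact: latD.
by move=> t; apply: cmpD => //; apply: sub; exists t.
Qed.

(** The levels left after removing the homothety classes of [Lat w (- w x)] and [Lat w (- w y)] from
    the chain; these two classes coincide when [x = y]. *)
Definition off_wall w x y : set int :=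
  [set t | forall m, t <> - w x + n * m /\ t <> - w y + n * m].

(** The condition on [w x + w y] says that duality exchanges the two removed classes, so the rest is
    a facet; a facet within the chain that contains the rest and one removed lattice recovers both
    classes, hence the whole chain. *)
Lemma off_wall_panel w x y e c : sep w -> (forall a, w a + w (bar a) = c) -> y != bar x ->
  w x + w y = c - 1 + n * e -> panel (subchain w (off_wall w x y)) (chain w).
Proof.
move=> ws wc yx exy; split.
- apply: (subchain_facet wc).
  + exists (- w (bar x)) => m; split=> e1.
      have /ws : w x - w (bar x) = n * m by lia.
      by move/eqP; rewrite eq_sym (negPf (bar_neq x)).
    have /ws : w y - w (bar x) = n * m by lia.
    by move/eqP; rewrite (negPf yx).
  + move=> t m ht k; have := ht (k - m); rewrite mulrBr => -[h1 h2].
    by move: h1 h2; set a := n * k; set b := n * m; split; lia.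
  + move=> t ht k; have := ht (e - 1 - k); rewrite !mulrBr mulr1 => -[h1 h2].
    move: h1 h2 exy; set a := n * k; set b := n * e; split; lia.
- split=> [_ [t _ <-]|]; first by exists t.
  move=> /(_ (Lat w (- w x))); case; first by exists (- w x).
  by move=> t ht /(Lat_inj d_gt0 ws) e1; have [] := ht 0; rewrite mulr0 addr0 e1.
- move=> P' [_ _ _ homP dualP] subP [P'D nDP']; apply/seteqP; split=> // L P'L.
  have [t _ eL] := P'D _ P'L; exists t => // m; apply: contrapT => /not_andP h.
  apply: nDP' => _ [t' _ <-].
  have p0 k : (p%:R : Qp) ^ k != 0 by rewrite expfz_neq0 // pQ_neq0.
  have homT t1 m1 : P' (Lat w t1) -> P' (Lat w (t1 + n * m1)).
    by rewrite -homothetic_pexp; move/homP; apply.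
  have dualT t1 : P' (Lat w t1) -> P' (Lat w (1 - n - c - t1)).
    by rewrite -(dual_Lat p_pr d_gt0 t1 wc); exact: dualP.
  rewrite -eL in P'L.
  have [Px Py] : P' (Lat w (- w x)) /\ P' (Lat w (- w y)).
    have swap a b : w a + w b = c - 1 + n * e -> P' (Lat w (- w a)) -> P' (Lat w (- w b)).
      move=> eab /dualT/(homT _ (1 - e)); congr (P' (Lat w _)); rewrite mulrBr mulr1.
      by move: eab; set q := n * e; lia.
    case: h => /contrapT et; move: P'L => /(homT _ (- m)); rewrite et mulrN addrK => Pa.
      by split=> //; exact: swap Pa.
    by split=> //; apply: swap Pa; rewrite addrC.
  have [Tt'|] := pselect (off_wall w x y t'); first by apply: subP; exists t'.
  move=> /existsNP[k /not_andP[]] /contrapT ->; exact: homT.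
Qed.
End Chambers.

(** * Iwahori subgroups and walls *)

Section Index.
Variables (F : fieldType) (n : nat).
Implicit Types (g h : 'M[F]_n) (H K : set 'M[F]_n).

Lemma index_reps H K (m : nat) (r : nat -> 'M[F]_n) : subgroup K -> K `<=` H ->
  (forall g h, H g -> H h -> H (g *m h)) ->
  (forall i, (i < m)%N -> H (r i) /\ r i \in unitmx) ->
  (forall g, H g -> exists2 i, (i < m)%N & K (invmx (r i) *m g)) ->
  (forall i j, (i < m)%N -> (j < m)%N -> K (invmx (r i) *m r j) -> i = j) ->
  index_eq H K m.
Proof.
move=> [Ku K1 KM KV] KH HM rH r_ex r_inj; split=> //.
pose f i := [set r i *m k | k in K].
have -> : left_cosets H K = f @` `I_m.
  apply/seteqP; split=> [_ [g Hg <-]|_ [i im <-]]; last first.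
    by exists (r i) => //; have [] := rH i im.
  have [i im Kg] := r_ex g Hg; have [_ ur] := rH i im; exists i => //.
  have ug : g \in unitmx by rewrite -[g](mulKVmx ur) unitmx_mul ur Ku.
  apply/seteqP; split=> _ [k Kk <-].
    exists (invmx (invmx (r i) *m g) *m k); first by apply: KM => //; exact: KV.
    by rewrite -[X in X *m _](mulKVmx ur) -mulmxA mulKVmx // Ku.
  by exists (invmx (r i) *m g *m k); [exact: KM|rewrite !mulmxA mulmxV // mul1mx].
apply: inj_card_eq => i j; rewrite !inE => im jm e; apply: r_inj => //.
have [_ ur] := rH i im; have : f j (r j) by exists 1%:M; rewrite ?mulmx1.
by rewrite -e => -[k Kk <-]; rewrite mulKmx.
Qed.

Lemma index_self H (m : nat) : subgroup H -> index_eq H H m -> m = 1%N.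
Proof.
move=> [Hu H1 HM HV] [_ Hm].
suff e : left_cosets H H = [set H].
  by move: Hm; rewrite e => /card_esym/card_eq_trans/(_ card_set1)/card_eq_II.
apply/seteqP; split=> [_ [g Hg <-]|_ ->].
  apply/seteqP; split=> [_ [k Hk <-]|k Hk]; first exact: HM.
  by exists (invmx g *m k); [apply: HM => //; exact: HV|rewrite mulKVmx // Hu].
exists 1%:M => //; apply/seteqP; split=> [_ [k Hk <-]|k Hk]; first by rewrite mul1mx.
by exists k; rewrite ?mul1mx.
Qed.
End Index.

Lemma bool_step1 (k l : int) (u v u' v' : bool) : ~~ (u && v') ->
  (k + u%:Z - v%:Z) - (l + u'%:Z - v'%:Z) <= k - l + 1.
Proof. by case: u; case: v; case: u'; case: v' => //= _; lia. Qed.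

Lemma bool_step2 (k l : int) (u v u' v' : bool) :
  (k + u%:Z - v%:Z) - (l + u'%:Z - v'%:Z) <= k - l + 1 + 1.
Proof. by case: u; case: v; case: u'; case: v' => //=; lia. Qed.

Section Steps.
Variable d : nat.
Local Notation I := 'I_(d + d).
Local Notation n := ((d + d)%:Z).
Implicit Types (x y : I) (k m : int) (w : I -> int).

(* The chambers of [w] and [w'] are adjacent, and the coordinates [a] and [bar b] (hence
   [b] and [bar a]) are exchanged modulo [2 d]. *)
Record step (w w' : I -> int) a b : Prop := Step {
  step_eq : forall x, w' x = w x + ((x == a) || (x == b))%:Z
                           - ((x == bar a) || (x == bar b))%:Z;
  step_neq : b != bar a;
  step_sep : sep w;
  step_bar : barsym w;
  step_mod : exists e, w a - w (bar b) = n * e - 1 }.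

Section Step.
Variables (w w' : I -> int) (a b : I).
Hypothesis ww' : step w w' a b.

Let ab : b != bar a := step_neq ww'.

Lemma step_neqs : [/\ (a == bar b) = false, (bar b == a) = false, (bar a == b) = false,
  (b == bar a) = false & [/\ (bar a == a) = false, (a == bar a) = false,
  (bar b == b) = false & (b == bar b) = false]].
Proof.
have ab' := negPf ab; have e : (a == bar b) = false by rewrite -bar_eq eq_sym.
have nb x : (bar x == x) = false by exact: negPf (bar_neq x).
have nb' x : (x == bar x) = false by rewrite eq_sym.
by split; [|rewrite eq_sym|rewrite eq_sym| |split].
Qed.

Lemma step_at : [/\ w' a = w a + 1, w' b = w b + 1, w' (bar a) = w (bar a) - 1
  & w' (bar b) = w (bar b) - 1].
Proof.
have [e1 e2 e3 e4 [e5 e6 e7 e8]] := step_neqs; split; rewrite (step_eq ww') ?eqxx ?orbT.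
- by rewrite e6 e1 subr0.
- by rewrite e4 e8 subr0.
- by rewrite e5 e3 addr0.
- by rewrite e2 e7 addr0.
Qed.

Lemma step_mods : exists e, w a - w (bar b) = n * e - 1 /\ w b - w (bar a) = n * e - 1.
Proof.
have [e he] := step_mod ww'; have [c wc] := step_bar ww'.
by exists e; split=> //; have := wc a; have := wc b; lia.
Qed.

(** The permutation through which [w'] agrees with [w] modulo 2d. As it is an involution, the
    weights [w'] are again separated. *)
Definition step_swap x : I := if x == a then bar b else if x == bar b then a else
  if x == b then bar a else if x == bar a then b else x.

Lemma step_swapK : involutive step_swap.
Proof.
have [e1 e2 e3 e4 [e5 e6 e7 e8]] := step_neqs => x; rewrite {2}/step_swap.
case: (x =P a) => [->|/eqP xa]; first by rewrite /step_swap e2 eqxx.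
case: (x =P bar b) => [->|/eqP xb']; first by rewrite /step_swap eqxx.
case: (x =P b) => [xb|/eqP xb].
  have ba : (bar a == bar b) = false.
    by rewrite (inj_eq (can_inj (@barK d))) eq_sym -xb; exact: negPf.
  by rewrite /step_swap e5 ba e3 eqxx.
case: (x =P bar a) => [xa'|/eqP xa'].
  have ba : (b == a) = false.
    by rewrite -(inj_eq (can_inj (@barK d))) -xa' eq_sym; exact: negPf.
  by rewrite /step_swap ba e8 eqxx.
by rewrite /step_swap (negPf xa) (negPf xb') (negPf xb) (negPf xa').
Qed.

Lemma step_swap_mod x : exists k, w' x = w (step_swap x) + n * k.
Proof.
have [h1 h2 h3 h4] := step_at; have [e [he he']] := step_mods; rewrite /step_swap.
case: eqP => [->|/eqP xa]; first by exists e; lia.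
case: eqP => [->|/eqP xb']; first by exists (- e); lia.
case: eqP => [->|/eqP xb]; first by exists e; lia.
case: eqP => [->|/eqP xa']; first by exists (- e); lia.
by exists 0; rewrite (step_eq ww') (negPf xa) (negPf xb) (negPf xa') (negPf xb'); lia.
Qed.

Lemma step_sep' : sep w'.
Proof.
move=> x y m e; apply: (can_inj step_swapK).
have [k hk] := step_swap_mod x; have [l hl] := step_swap_mod y.
by apply: (step_sep ww' (m := m - k + l)); move: e; rewrite hk hl; lia.
Qed.

(** A step is undone by a step, with [bar a] and [bar b] rising. One-sided statements about steps
    thus give both inclusions. *)
Lemma step_sym : step w' w (bar a) (bar b).
Proof.
have [h1 h2 h3 h4] := step_at; have [e [he he']] := step_mods.
split.
- by move=> x; rewrite (step_eq ww') !barK; lia.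
- by rewrite (inj_eq (can_inj (@barK d))).
- exact: step_sep'.
- have [c wc] := step_bar ww'; exists c => x; rewrite !(step_eq ww') -(wc x).
  by rewrite !(inj_eq (can_inj (@barK d))) !bar_eq; lia.
- by exists (- e); rewrite barK; lia.
Qed.

End Step.
End Steps.

Section Iwahori.
Variables (p : nat) (p_pr : prime p) (d : nat) (d_gt0 : (0 < d)%N).
Local Notation Qp := (padic p_pr).
Local Notation I := 'I_(d + d).
Local Notation mat := 'M[Qp]_(d + d).
Local Notation vec := 'cV[Qp]_(d + d).
Local Notation n := ((d + d)%:Z).
Local Notation Lat := (@Lat p p_pr d).
Local Notation chain := (@chain p p_pr d).
Local Notation gdvd := (@gdvd p p_pr d).
Implicit Types (g h u : mat) (x y : I) (t k m : int) (w : I -> int) (z : Qp) (v : vec).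
Implicit Types (L M : set vec) (D : set (set vec)) (alpha delta : 'rV[int]_d).

Lemma Iwahori_subgroup D : subgroup (@Iwahori p p_pr d D).
Proof.
split=> [g [[]]||g h [Gg gD] [Gh hD]|g [Gg gD]] //.
- split=> [|L _]; first exact: GSp1.
  apply/seteqP; split=> [_ [v vL <-]|v vL]; first by rewrite mul1mx.
  by exists v; rewrite ?mul1mx.
- split=> [|L DL]; first exact: GSpM.
  rewrite -{2}(gD L DL) -{2}(hD L DL); apply/seteqP; split.
    by move=> _ [v vL <-]; exists (h *m v); [exists v|rewrite mulmxA].
  by move=> _ [_ [v vL <-] <-]; exists v; rewrite ?mulmxA.
- split=> [|L DL]; first exact: GSpV.
  have ug : g \in unitmx by case: Gg.
  rewrite -{1}(gD L DL); apply/seteqP; split.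
    by move=> _ [_ [v vL <-] <-]; rewrite mulKmx.
  by move=> v vL; exists (g *m v); [exists v|rewrite mulKmx].
Qed.

(** The entrywise form of the condition that [g] maps [Lat w t] into [Lat w' t] for every [t]. *)
Definition okm (w' w : I -> int) g := forall x y, gdvd (w' x - w y) (g x y).

Lemma gdvd_unit01 (k : int) : k <= 0 -> gdvd k 1.
Proof. by move=> k0; exists 0; rewrite mulr0 -of_int1; split=> //; exact: pdvd_int. Qed.

Lemma okm1 w : okm w w 1%:M.
Proof.
move=> x y; rewrite mxE; case: eqP => [->|_]; last exact: gdvd0.
by apply: gdvd_unit01; rewrite subrr.
Qed.

Lemma okmM w1 w2 w3 g h : okm w1 w2 g -> okm w2 w3 h -> okm w1 w3 (g *m h).
Proof.
move=> og oh x y; rewrite mxE; apply: (gdvd_sum d_gt0) => z _.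
have -> : w1 x - w3 y = (w1 x - w2 z) + (w2 z - w3 y) by rewrite addrA subrK.
exact: gdvdM.
Qed.

Lemma okm_act w' w g t v : okm w' w g -> Lat w t v -> Lat w' t (g *m v).
Proof.
move=> og vL x; rewrite mxE; apply: (gdvd_sum d_gt0) => z _.
have -> : w' x + t = (w' x - w z) + (w z + t) by rewrite addrA subrK.
exact: gdvdM.
Qed.

Lemma okm_of_act w' w g : (forall t v, Lat w t v -> Lat w' t (g *m v)) -> okm w' w g.
Proof.
move=> h x y; have /h/(_ x) : Lat w (- w y) (pvec p_pr y 0).
  by apply/(pvec_Lat _ d_gt0); rewrite subrr mulr0.
rewrite mxE (bigD1 y) //= big1 ?addr0; last first.
  by move=> z zy; rewrite mxE (negPf zy) mulr0.
by rewrite mxE eqxx expr0z mulr1.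
Qed.

Lemma Iwahori_chainP w g :
  Iwahori (chain w) g <-> [/\ GSp g, okm w w g & okm w w (invmx g)].
Proof.
split=> [[Gg gC]|[Gg og og']].
  have ug : g \in unitmx by case: Gg.
  have gL t : act_lattice g (Lat w t) = Lat w t by apply: gC; exists t.
  split=> //; apply: okm_of_act => t v; first by move=> vL; rewrite -gL; exists v.
  by rewrite -{1}gL => -[u uL <-]; rewrite mulKmx.
have ug : g \in unitmx by case: Gg.
split=> // _ [t _ <-]; apply/seteqP; split=> [_ [v vL <-]|v vL]; first exact: okm_act vL.
by exists (invmx g *m v); [exact: okm_act vL|rewrite mulKVmx].
Qed.

Lemma okm_unitriV w om g : barsym w -> barsym om -> unitri om g ->
  okm w w g -> okm w w (invmx g).
Proof.
move=> [c wc] oms Ug og x y; have [_ ->] := unitri_invE d_gt0 oms Ug.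
have -> : w x - w y = n * 0 + n * 0 + (w (bar y) - w (bar x)).
  by have := wc x; have := wc y; lia.
by apply: gdvdM; [apply: gdvdM; apply: pdvd_gdvd; exact: pdvd_sg|exact: og].
Qed.

Lemma Iwahori_unitri w om g : barsym w -> barsym om -> unitri om g ->
  Iwahori (chain w) g <-> okm w w g.
Proof.
move=> ws oms Ug; split=> [/Iwahori_chainP[]//|og]; apply/Iwahori_chainP.
by split=> //; [case: Ug|exact: okm_unitriV Ug og].
Qed.

(** Off the diagonal a bound rises for free by one. It rises by two only if [x] goes up and [y] goes
    down, and then the second rise is free as well outside the two excluded positions: at
    [(a, bar a)] or [(b, bar b)] an obstruction would force [a = b] by separation, and the position
    would be an excluded one. *)
Lemma step_gdvd w w' a b x y z : step w w' a b ->
  ~ (x = a /\ y = bar b) -> ~ (x = b /\ y = bar a) ->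
  gdvd (w x - w y) z -> gdvd (w' x - w' y) z.
Proof.
move=> ww' nab nba; have [->|xy] := eqVneq x y; first by rewrite !subrr.
have xy0 k : w x - w y <> n * k by move=> /(step_sep ww') e; rewrite e eqxx in xy.
have [e [he he']] := step_mods ww'.
rewrite !(step_eq ww') => h; have h1 := gdvd_step xy0 h.
case: (boolP (((x == a) || (x == b)) && ((y == bar a) || (y == bar b)))) => [|ud]; last first.
  by apply: gdvd_le h1; exact: bool_step1.
case/andP => /orP up_x /orP dn_y.
suff H : gdvd (w x - w y + 1 + 1) z by apply: gdvd_le H; exact: bool_step2.
apply: gdvd_step h1 => k.
case: up_x dn_y => /eqP ex [] /eqP ey; subst x y.
- by move=> H; have /(step_sep ww') : w (bar b) - w (bar a) = n * (k - e); [lia|];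
    move/(can_inj (@barK d)) => eba; apply: nab; rewrite eba.
- by case: nab.
- by case: nba.
- by move=> H; have /(step_sep ww') : w (bar a) - w (bar b) = n * (k - e); [lia|];
    move/(can_inj (@barK d)) => eba; apply: nba; rewrite eba.
Qed.
End Iwahori.

Lemma subNDKB (V : zmodType) (x y z : V) : x - (- y + z) + (z - y) = x.
Proof. by rewrite opprD opprK -addrA subrKA subrr addr0. Qed.

Section Walls.
Variables (p : nat) (p_pr : prime p) (d : nat) (d_gt0 : (0 < d)%N).
Local Notation Zp := (padic_int p_pr).
Local Notation Qp := (padic p_pr).
Local Notation I := 'I_(d + d).
Local Notation mat := 'M[Qp]_(d + d).
Local Notation vec := 'cV[Qp]_(d + d).
Local Notation n := ((d + d)%:Z).
Local Notation Lat := (@Lat p p_pr d).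
Local Notation chain := (@chain p p_pr d).
Local Notation gdvd := (@gdvd p p_pr d).
Local Notation subchain := (@subchain p p_pr d).
Implicit Types (g h u : mat) (x y : I) (t k m : int) (w : I -> int) (z : Qp) (v : vec).
Implicit Types (L M : set vec) (D : set (set vec)) (alpha delta : 'rV[int]_d).

(* Modulo higher valuation, the entry at [(a, b)] is additive on [okm w w]: by separation
   no intermediate product reaches the minimal valuation. *)
Lemma okm_entryM w g h a b : sep w -> a != b -> (forall x, g x x = 1) -> (forall x, h x x = 1) ->
  okm w w g -> okm w w h -> gdvd (w a - w b + 1 + 1) ((g *m h) a b - (g a b + h a b)).
Proof.
move=> ws ab g1 h1 og oh; rewrite mxE (bigD1 a) //= (bigD1 b) /=; last by rewrite eq_sym.
rewrite g1 h1 mul1r mulr1 addrA [g a b + h a b]addrC [X in gdvd _ X]addrC addKr.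
apply: (gdvd_sum d_gt0) => z /andP[za zb].
have nab x y k : x != y -> w x - w y <> n * k by move=> xy /ws e; rewrite e eqxx in xy.
have -> : w a - w b + 1 + 1 = (w a - w z + 1) + (w z - w b + 1) by ring.
apply: gdvdM; apply: gdvd_step => // k; apply: nab => //.
by rewrite eq_sym.
Qed.

Section Step.
Variables (w w' : I -> int) (a b : I).
Hypothesis ww' : step w w' a b.

(** Only the bounds at [a] and [b] rise, by one, and off the wall neither of them is an integer. *)
Lemma step_lattice e t : w a - w (bar b) = n * e - 1 -> off_wall w a b t ->
  Lat w t `<=` Lat w' t.
Proof.
move=> he ht v vL x; have := vL x; rewrite (step_eq ww').
have [/orP ux|nux] := boolP ((x == a) || (x == b)); last first.
  by apply: gdvd_le; case: (_ || _); rewrite /=; lia.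
move=> h; suff h1 : gdvd (w x + t + 1) (v x 0).
  by apply: gdvd_le h1; case: (_ || _); rewrite /=; lia.
apply: gdvd_step h => k; have := ht k.
by case: ux => /eqP -> [] h1 h2 ?; [apply: h1|apply: h2]; lia.
Qed.

Lemma step_off_wall t : off_wall w a b t -> off_wall w' (bar a) (bar b) t.
Proof.
have [_ _ h3 h4] := step_at ww'; have [e [he he']] := step_mods ww'.
move=> ht k; have := ht (k + e); rewrite h3 h4 mulrDr.
by move: he he'; set q := n * e; set r := n * k => he he' []; split; lia.
Qed.
End Step.

Lemma step_subchain w w' a b : step w w' a b ->
  subchain w (off_wall w a b) = subchain w' (off_wall w' (bar a) (bar b)).
Proof.
have sub (v v' : I -> int) x y : step v v' x y ->
    subchain v (off_wall v x y) `<=` subchain v' (off_wall v' (bar x) (bar y)).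
  move=> vv' _ [t ht <-]; have ht' := step_off_wall vv' ht; exists t => //.
  have [e he] := step_mod vv'; have [e' he'] := step_mod (step_sym vv').
  apply/seteqP; split; first by move=> u; apply: (step_lattice (step_sym vv') he' ht').
  by move=> u; apply: (step_lattice vv' he ht).
move=> ww'; apply/seteqP; split; first exact: sub.
by have := sub _ _ _ _ (step_sym ww'); rewrite !barK.
Qed.

Lemma step_panels w w' a b : step w w' a b ->
  exists2 P, panel P (chain w) & panel P (chain w').
Proof.
have pan (v v' : I -> int) x y : step v v' x y -> panel (subchain v (off_wall v x y)) (chain v).
  move=> vv'; have [c vc] := step_bar vv'; have [e he] := step_mod vv'.
  apply: (off_wall_panel p_pr d_gt0 (step_sep vv') vc (step_neq vv') (e := e)).
  by have := vc y; lia.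
move=> ww'; exists (subchain w (off_wall w a b)); first exact: pan ww'.
by rewrite (step_subchain ww'); exact: pan (step_sym ww').
Qed.

(** * The index p across a wall, inside a unipotent group [V] such as N or a root subgroup *)

Section StepIndex.
Variables (w w' om : I -> int) (a b : I) (V : set mat).
Hypotheses (ww' : step w w' a b) (oms : barsym om) (omab : om a < om (bar b)).
Hypotheses (V_subgroup : subgroup V) (V_unitri : V `<=` unitri om).
Hypothesis V_root : forall c, V (rootmx a b c).

Let ws := step_sep ww'.
Let ab : b != bar a := step_neq ww'.
Let abb : a != bar b. Proof. by rewrite -bar_eq eq_sym. Qed.

(** Going back across the wall could lose a bound only at [(bar b, a)] and [(bar a, b)], where an
    element of [V] vanishes because [om a < om (bar b)]. *)
Lemma step_index_okm g : V g -> okm w' w' g -> okm w w g.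
Proof.
move=> Vg og x y; have [_ _ gu] := V_unitri Vg.
have omba : om b < om (bar a) by rewrite -[b]barK (barsym_lt _ _ oms).
have [->|gxy] := eqVneq (g x y) 0; first exact: gdvd0.
apply: (step_gdvd d_gt0 (step_sym ww')); last exact: og.
  rewrite barK => -[ex ey]; subst x y; case: (gu _ _ gxy) => [e|].
    by have := ab; rewrite -e eqxx.
  by rewrite ltNge ltW.
rewrite barK => -[ex ey]; subst x y; case: (gu _ _ gxy) => [e|].
  by have := abb; rewrite e eqxx.
by rewrite ltNge ltW.
Qed.

Lemma step_index_entry g : V g -> okm w w g ->
  okm w' w' g <-> gdvd (w a - w (bar b) + 1 + 1) (g a (bar b)).
Proof.
move=> Vg og; have [h1 h2 h3 h4] := step_at ww'; have [e [he he']] := step_mods ww'.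
have eab : w' a - w' (bar b) = w a - w (bar b) + 1 + 1 by rewrite h1 h4; ring.
have eba : w' b - w' (bar a) = w b - w (bar a) + 1 + 1 by rewrite h2 h3; ring.
split=> [/(_ a (bar b))|h x y]; first by rewrite eab.
have [exy|nxy] := pselect (x = a /\ y = bar b).
  by have [-> ->] := exy; rewrite eab.
have [exy'|nxy'] := pselect (x = b /\ y = bar a); last by apply: (step_gdvd d_gt0 ww').
have [-> ->] := exy'; rewrite eba.
have Ug := V_unitri Vg; have [ug gE] := unitri_invE d_gt0 oms Ug.
have Uv := unitriV d_gt0 oms Ug.
have ov := okm_unitriV d_gt0 (step_bar ww') oms Ug og.
(* The product with the inverse is 1, so up to higher valuation the entry of [g] at [(b, bar a)] is
   minus that of the inverse, which is the entry of [g] at [(a, bar b)] up to sign. One entry thus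
   controls both positions. *)
have := okm_entryM ws ab _ _ og ov; rewrite (mulmxV ug) mxE (negPf ab).
have [_ g1 _] := Ug; have [_ v1 _] := Uv => /(_ g1 v1); rewrite sub0r opprD.
move=> H; rewrite -[g b (bar a)]opprK -[- g _ _](subrK (invmx g b (bar a))) opprD.
apply: gdvdD; first exact: gdvdN.
apply: gdvdN; rewrite gE barK.
have -> : w b - w (bar a) + 1 + 1 = n * 0 + n * 0 + (w a - w (bar b) + 1 + 1) by lia.
by apply: gdvdM => //; apply: gdvdM; apply: pdvd_gdvd; exact: pdvd_sg.
Qed.

(** The two sides of the wall: the bounds [n * e - 1] and, in [gdvd_succn], [n * e + 1] differ by 2
    but enclose one multiple of 2d, so they differ by one digit. *)
Lemma gdvd_predn e z : gdvd (n * e - 1) z <-> pdvd e z.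
Proof.
split=> [[m [em mz]]|h]; last by exists e; split=> //; lia.
by apply: pdvd_le mz; have := d_gt0; nia.
Qed.

Lemma gdvd_succn e z : gdvd (n * e - 1 + 1 + 1) z <-> pdvd (e + 1) z.
Proof.
split=> [[m [em mz]]|h]; last by exists (e + 1); split=> //; have := d_gt0; nia.
by apply: pdvd_le mz; have := d_gt0; nia.
Qed.

(** Modulo p^(e+1) the entry at [(a, bar b)] is additive on the larger group by [okm_entryM], takes
    values in the multiples of p^e, and its kernel is the smaller group. The root elements with
    entry i p^e there, for the digits i, represent the cosets. *)
Lemma step_index : index_eq (Iwahori (chain w) `&` V) (Iwahori (chain w') `&` V) p.
Proof.
have ws' := step_bar ww'; have wb' := step_bar (step_sym ww').
have [e [he _]] := step_mods ww'.
have IwE g : V g -> Iwahori (chain w) g <-> okm w w g.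
  by move=> Vg; apply: (Iwahori_unitri d_gt0 ws' oms (V_unitri Vg)).
have IwE' g : V g -> Iwahori (chain w') g <-> okm w' w' g.
  by move=> Vg; apply: (Iwahori_unitri d_gt0 wb' oms (V_unitri Vg)).
have [Vu V1 VM VV] := V_subgroup.
pose f i : Qp := i%:R * p%:R ^ e.
pose r (i : nat) : mat := rootmx a b (sg p_pr a * f i).
have rE c : rootmx a b (sg p_pr a * c) a (bar b) = c.
  by rewrite -off_diag1 // rootmxE !eqxx barK eqxx /= mulrAC sgM mul1r.
have rV i : invmx (r i) = rootmx a b (sg p_pr a * (- f i)).
  have e1 : r i *m rootmx a b (sg p_pr a * (- f i)) = 1%:M.
    by rewrite /r rootmxM // -mulrDr subrr mulr0 rootmx0.
  by have [ur _] := mulmx1_unit e1; rewrite -[RHS](mulKmx ur) e1 mulmx1.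
have f_pdvd i : pdvd e (f i).
  by rewrite /f -[e]add0r; apply: pdvdM; [rewrite -of_int_nat; exact: pdvd_int|
    rewrite add0r; exact: pdvd_exp].
have r_okm c : pdvd e c -> okm w w (rootmx a b (sg p_pr a * c)).
  move=> ec x y; rewrite addmxE; apply: gdvdD; first exact: okm1.
  rewrite mxE; case: ifP => [|_]; last exact: gdvd0.
  move=> pos_xy; have wxy : w x - w y = n * 0 + (n * e - 1) + n * 0.
    have [c' wc] := ws'; have := wc y; have := wc a; have := wc b.
    by case/orP: pos_xy => /andP[/eqP-> /eqP->]; lia.
  rewrite wxy; apply: gdvdM; last by apply: pdvd_gdvd; exact: pdvd_sg.
  by apply: gdvdM; [apply: pdvd_gdvd; exact: pdvd_sg|apply/gdvd_predn].
have inK g : V g -> okm w w g -> pdvd (e + 1) (g a (bar b)) ->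
    (Iwahori (chain w') `&` V) g.
  move=> Vg og h; split=> //; apply/IwE' => //; apply/step_index_entry => //.
  by rewrite he; apply/gdvd_succn.
apply: (@index_reps _ _ _ _ p r).
- by apply: subgroupI => //; exact: Iwahori_subgroup.
- move=> g [Ig Vg]; split=> //; apply/IwE => //.
  by apply: step_index_okm => //; apply/IwE'.
- move=> g h [Ig Vg] [Ih Vh]; split; last exact: VM.
  by have [_ _ IM _] := Iwahori_subgroup (chain w); apply: IM.
- move=> i _; split; last by apply: Vu; exact: V_root.
  split; last exact: V_root.
  by apply/IwE; [exact: V_root|exact: r_okm].
- move=> g [Ig Vg]; have og : okm w w g by apply/IwE.
  have [] := @pdvd_digit p p_pr e (g a (bar b)).
    by apply/gdvd_predn; rewrite -he; exact: og.
  move=> i hi; exists i => //; have or' : okm w w (invmx (r i)).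
    by rewrite rV; apply: r_okm; exact: pdvdN.
  have Vr' : V (invmx (r i)) by rewrite rV; exact: V_root.
  apply: inK; [exact: VM|exact (okmM d_gt0 or' og)|].
  have [_ r1 _] := V_unitri Vr'; have [_ g1 _] := V_unitri Vg.
  have := okm_entryM ws abb r1 g1 or' og; rewrite he => /gdvd_succn H.
  have e1 : invmx (r i) a (bar b) = - f i by rewrite rV rE.
  have := pdvdD H hi; rewrite e1; congr (pdvd _ _).
  exact: subNDKB.
- move=> i j ip jp [/IwE' h Vh]; have Vrj := V_root (sg p_pr a * (- f i + f j)).
  have e1 : invmx (r i) *m r j = rootmx a b (sg p_pr a * (- f i + f j)).
    by rewrite rV rootmxM // -mulrDr.
  move: h; rewrite e1 => /(_ Vrj) h.
  have : pdvd (e + 1) (- f i + f j).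
    rewrite -[- f i + _]rE; apply/gdvd_succn; rewrite -he.
    by apply/step_index_entry => //; exact: step_index_okm.
  rewrite [X in pdvd _ X]addrC => H.
  by have /(congr1 val) /= := @pdvd_digit_inj p p_pr e (Ordinal jp) (Ordinal ip) H.
Qed.
End StepIndex.
End Walls.

(** * The root of a wall, and the chamber fixed by the pro-p-Iwahori subgroup *)

Section WallRoots.
Variables (p : nat) (p_pr : prime p) (d : nat) (d_gt0 : (0 < d)%N).
Local Notation Qp := (padic p_pr).
Local Notation I := 'I_(d + d).
Local Notation mat := 'M[Qp]_(d + d).
Local Notation vec := 'cV[Qp]_(d + d).
Local Notation Lat := (@Lat p p_pr d).
Local Notation chain := (@chain p p_pr d).
Local Notation w0 := (@w0 d).
Implicit Types (g h u : mat) (x y : I) (t k m : int) (w : I -> int) (z : Qp) (v : vec).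
Implicit Types (L M : set vec) (D : set (set vec)) (alpha delta : 'rV[int]_d).

Lemma wall_index_neq D alpha : Phi alpha ->
  ~ index_eq (Iwahori D `&` @Nroot p p_pr d alpha) (Iwahori D `&` Nroot alpha) p.
Proof.
move=> al; move/index_self => p1; have : p = 1%N.
  by apply: p1; apply: subgroupI; [exact: Iwahori_subgroup|exact: Nroot_subgroup].
by move=> e; move: p_pr; rewrite e.
Qed.

(** If another root satisfied the conditions, both chambers would give the same group for [delta]:
    directly, or, when the other root is [- delta], by inclusions in both directions. But a group
    does not have index p in itself. *)
Lemma wall_root_unique D1 D2 delta delta' :
  wall_root D1 D2 delta -> wall_root D1 D2 delta' -> delta' = delta.
Proof.
move=> [_ Pd eq_d _ id] [_ Pd' eq_d' id' _].
have [//|nd] := eqVneq delta' delta; exfalso.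
apply: (@wall_index_neq D1 delta Pd).
suff e : Iwahori D1 `&` Nroot delta = Iwahori D2 `&` Nroot delta by rewrite -e in id.
have [e|nd'] := eqVneq delta' (- delta).
  move: id'; rewrite e opprK => id'; apply/seteqP; split; first by case: id'.
  by case: id.
apply: eq_d' => // e; first by rewrite e eqxx in nd.
by rewrite e opprK eqxx in nd'.
Qed.

(** Either [w0] or the reversed order works, so a root subgroup of either sign is unitriangular for
    some order and [step_index] covers both [delta] and [- delta]. *)
Lemma root_order a b : b != bar a -> exists2 om : I -> int, barsym om & om a < om (bar b).
Proof.
move=> ba; have ab : a != bar b by rewrite -bar_eq eq_sym.
have [lt|gt|/w0_inj e] := ltgtP (w0 a) (w0 (bar b)); last by rewrite e eqxx in ab.
  by exists w0; first exact: w0_barsym.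
exists (fun x => - w0 x); last by rewrite ltrN2.
by have [c wc] := w0_barsym d; exists (- c) => x; rewrite -opprD wc.
Qed.

Lemma step_Nroot_index w w' a b : step w w' a b ->
  index_eq (Iwahori (chain w) `&` Nroot (wt a + wt b))
           (Iwahori (chain w') `&` Nroot (wt a + wt b)) p.
Proof.
move=> ww'; have ab := step_neq ww'; have [om oms omab] := root_order ab.
apply: (step_index d_gt0 ww' oms omab).
- by apply: Nroot_subgroup => //; apply/PhiP; exists a, b.
- exact: Nroot_unitri.
- by move=> c; exact: rootmx_Nroot.
Qed.

Lemma step_Nroot_eq w w' a b delta : step w w' a b -> Phi delta ->
  delta <> wt a + wt b -> delta <> - (wt a + wt b) ->
  Iwahori (chain w) `&` Nroot delta `<=` Iwahori (chain w') `&` Nroot delta.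
Proof.
move=> ww' Pd nd nd' g [/(Iwahori_chainP d_gt0)[Gg og ov] Ng]; split=> //.
have okN h : Nroot delta h -> okm w w h -> okm w' w' h.
  move=> /(NrootP d_gt0)[_ hN] oh x y; have [<-|xy] := eqVneq x y.
    by have := oh x x; rewrite !subrr.
  have [->|hxy] := eqVneq (h x y) 0; first exact: gdvd0.
  have e : delta = wt x - wt y by apply: hN; rewrite off_diag1.
  apply: (step_gdvd d_gt0 ww'); last exact: oh.
    by case=> ex ey; apply: nd; rewrite e ex ey wt_bar opprK.
  by case=> ex ey; apply: nd; rewrite e ex ey wt_bar opprK addrC.
apply/(Iwahori_chainP d_gt0); split=> //; apply: okN => //.
by have [_ _ _ NV] := Nroot_subgroup p_pr d_gt0 Pd; exact: NV.
Qed.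

Lemma step_wall_root w w' a b : step w w' a b ->
  wall_root (chain w) (chain w') (wt a + wt b).
Proof.
move=> ww'; have w'w := step_sym ww'; have Pd : Phi (wt a + wt b).
  by apply/PhiP; exists a, b; split=> //; exact: step_neq ww'.
have eN : - (wt a + wt b) = wt (bar a) + wt (bar b) by rewrite !wt_bar opprD.
split=> //.
- split.
  + by apply: chain_apartment_chamber => //; [exact: step_sep ww'|exact: step_bar ww'].
  + by apply: chain_apartment_chamber => //; [exact: step_sep w'w|exact: step_bar w'w].
  + split; last exact (step_panels p_pr d_gt0 ww').
    (* The two chambers differ because their groups for this root have relative index p. *)
    move=> e; apply: (@wall_index_neq (chain w) _ Pd).
    by have := step_Nroot_index ww'; rewrite -e.
- move=> delta' Pd' nd nd'; apply/seteqP; split; first exact: step_Nroot_eq ww' _ nd nd'.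
  by apply: (step_Nroot_eq w'w) => //; rewrite -eN ?opprK.
- by rewrite eN; exact: step_Nroot_index.
- exact: step_Nroot_index.
Qed.

Definition split_set (f : I -> int) : set vec := [set v | forall x, pdvd (f x) (v x 0)].

Lemma split_set_fix (f : I -> int) g x y k : act_lattice g (split_set f) = split_set f ->
  x != y -> pdvd k (g x y) -> ~ pdvd (k + 1) (g x y) -> f x <= f y + k.
Proof.
move=> gL xy gxy ngxy.
have : split_set f (g *m pvec p_pr y (f y)).
  rewrite -gL; exists (pvec p_pr y (f y)) => // z; rewrite mxE.
  by case: eqP => [->|_]; [exact: pdvd_exp|exact: pdvd0].
move/(_ x); rewrite mxE (bigD1 y) //= big1 ?addr0; last first.
  by move=> z zy; rewrite mxE (negPf zy) mulr0.
rewrite mxE eqxx => h; rewrite leNgt; apply/negP => lt; apply: ngxy.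
have := pdvdM h (pdvd_exp p_pr (- f y)); rewrite -mulrA -expfzDr ?pQ_neq0 //.
rewrite subrr expr0z mulr1; apply: pdvd_le; lia.
Qed.

(** Along [w0] each function is a weakly increasing step function with at most two values, which are
    consecutive; two such functions are pointwise comparable. *)
Lemma split_comparable (f f' : I -> int) :
  (forall x y, w0 x < w0 y -> f x <= f y) -> (forall x y, f y <= f x + 1) ->
  (forall x y, w0 x < w0 y -> f' x <= f' y) -> (forall x y, f' y <= f' x + 1) ->
  split_set f `<=` split_set f' \/ split_set f' `<=` split_set f.
Proof.
move=> f1 f2 f1' f2'; have [le|] := pselect (forall x, f' x <= f x).
  by left=> v vf x; exact: pdvd_le (le x) (vf x).
move=> /existsNP[x /negP]; rewrite -ltNge => ltx; right=> v vf y.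
apply: pdvd_le (vf y); rewrite leNgt; apply/negP => lty.
have := f2 x y; have := f2' y x; have [h|h|/w0_inj e] := ltgtP (w0 x) (w0 y).
- by have := f1' _ _ h; lia.
- by have := f1 _ _ h; lia.
- by subst y; lia.
Qed.

Lemma split_set_Lat w t : split_set (fun x => cdiv d (w x + t)) = Lat w t.
Proof. by apply/seteqP; split=> v h x; apply/(gdvdE d_gt0); exact: h. Qed.

Lemma rootmxX (a b : I) (c : Qp) (k : nat) : b != bar a ->
  rootmx a b c ^+ k = rootmx a b (k%:R * c).
Proof.
move=> ba; elim: k => [|k IH]; first by rewrite expr0 mul0r rootmx0.
by rewrite exprS IH -mulmxE rootmxM // mulrS mulrDl mul1r.
Qed.

Lemma rootmx_entry (a b : I) (c : Qp) : b != bar a -> rootmx a b c a (bar b) = c * sg p_pr a.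
Proof.
move=> ba; have abb : a != bar b by rewrite -bar_eq eq_sym.
by rewrite -off_diag1 // rootmxE !eqxx barK eqxx.
Qed.

Lemma rootmx_GLZp (a b : I) : b != bar a -> GLZp (rootmx a b (1 : Qp)).
Proof.
move=> ba; have [om oms omab] := root_order ba.
apply/(unitri_GLZp d_gt0 oms).
  by apply: (Nroot_unitri d_gt0 oms ba omab); exact: rootmx_Nroot.
by apply: rootmx_intmx; rewrite -of_int1; exact: pdvd_int.
Qed.

Lemma pdvd_pexp_sg (k : nat) (a : I) :
  pdvd k (p%:R ^+ k * sg p_pr a) /\ ~ pdvd (k%:Z + 1) (p%:R ^+ k * sg p_pr a).
Proof.
rewrite exprnP; split.
  by rewrite -[k%:Z]addr0; apply: pdvdM; [rewrite addr0; exact: pdvd_exp|exact: pdvd_sg].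
move=> h; have := pdvdM h (pdvd_sg p_pr a); rewrite -mulrA sgM mulr1 addr0.
rewrite -[_ ^ _]mulr1 -of_int1 => /(pdvd_unit (mulr1 1)); lia.
Qed.

(** Let [f] be the exponents of a lattice of [C]. Root elements of [I0] for the positive roots make
    [f] weakly increase along [w0], and the p-th power of one for - 2e_1 bounds its total rise by
    one. The lattice is then comparable with the whole standard chain, hence belongs to it, and
    maximality of [C] concludes. *)
Lemma fixed_chamber C : apartment_chamber C -> @I0 p p_pr d `<=` Iwahori C -> C = chain w0.
Proof.
move=> [[fC maxC] splitC] I0C; have wb := w0_barsym d.
apply/esym/maxC; first exact: chain_facet.
move=> L CL; have [f eL] := splitC L CL.
have {}eL : L = split_set f by [].
have fixL g : I0 g -> act_lattice g (split_set f) = split_set f.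
  by move=> /I0C[_ gC]; rewrite -eL; exact: gC.
have f1 x y : w0 x < w0 y -> f x <= f y.
  move=> xy; have ne : x != y by apply: contraTneq xy => ->; rewrite ltxx.
  have ba : bar y != bar x by rewrite (inj_eq (can_inj (@barK d))) eq_sym.
  have := rootmx_entry 1 ba; rewrite barK => e.
  have [h1 h2] := pdvd_pexp_sg 0 x; rewrite expr0 -e in h1 h2.
  have := split_set_fix (fixL _ _) ne h1 h2; rewrite addr0; apply=> H _ sH.
  apply: sH; left; left; exists (wt x - wt y); first by apply/Phi_posP; exists x, y.
  by rewrite -wt_bar; split; [exact: rootmx_Nroot|exact: rootmx_GLZp].
(* The last and the first coordinate in the order [w0], with [w0] equal to 2d - 1 and 0. *)
pose i0 := Ordinal d_gt0; pose top : I := ix true i0; pose bot : I := ix false i0.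
have f_top : f top <= f bot + 1.
  have ne : top != bot by rewrite ix_eq.
  have ba : top != bar top by rewrite eq_sym bar_neq.
  have := rootmx_entry p%:R ba; rewrite {3}/top bar_ix -/bot => e.
  have [h1 h2] := pdvd_pexp_sg 1 top; rewrite expr1 -e in h1 h2.
  apply: (split_set_fix (fixL _ _) ne h1 h2) => H _ sH.
  apply: sH; left; right; exists (wt bot + wt bot).
    by right; exists i0; rewrite wt_ix expr0 scale1r mulr2n.
  exists (rootmx top top 1); last by rewrite rootmxX // mulr1.
  have -> : - (wt bot + wt bot) = wt top + wt top.
    by rewrite opprD -wt_bar bar_ix.
  by split; [exact: rootmx_Nroot|exact: rootmx_GLZp].
have f_mono x y : w0 x <= w0 y -> f x <= f y.
  by rewrite le_eqVlt => /orP[/eqP/w0_inj->|/f1].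
have f2 x y : f y <= f x + 1.
  apply: (le_trans (f_mono y top _)); last apply: (le_trans f_top).
    by have := w0_bound y; rewrite w0_ix /=; lia.
  by rewrite lerD2r; apply: f_mono; have := w0_bound x; rewrite w0_ix /=; lia.
have [_ latC _ _ _] := fC.
apply: comparable_chain => //; [exact: (w0_sep d_gt0)|exact: latC|move=> t].
rewrite eL -split_set_Lat; apply: split_comparable => // [x y xy|x y].
  by rewrite (cdiv_le d_gt0); have [] := cdivP d_gt0 (w0 y + t); lia.
rewrite (cdiv_le d_gt0) mulrDr mulr1; have [] := cdivP d_gt0 (w0 x + t).
by have := w0_bound x; have := w0_bound y; lia.
Qed.
End WallRoots.

(** * The gallery *)

Section GalleryPermutations.
Variables (d : nat) (d_gt0 : (0 < d)%N).
Local Notation I := 'I_(d + d).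
Implicit Types (x y : I) (k b : nat).

Definition swap_pos k (i : 'I_d) : 'I_d :=
  insubd i (if i == k.-1 :> nat then k else if i == k :> nat then k.-1 else i).

(** The column of the nonzero entry in row [x] of [sdot k], while [sdot_val] is the valuation of
    that entry. Positions count from 0, so s_k with 0 < k < d exchanges the positions k - 1 and
    k. *)
Definition sdot_perm k x : I :=
  if k == 0%N then ix (half x (+) (pos x == 0%N :> nat)) (pos x)
  else if k == d then ix (half x (+) (pos x == d.-1 :> nat)) (pos x)
  else ix (half x) (swap_pos k (pos x)).

Definition sdot_val k x : int :=
  if (k == 0%N) && (pos x == 0%N :> nat) then (if half x then 1 else -1) else 0.

Fixpoint sdots_perm b x : I :=
  if b is b'.+1 then sdot_perm (d - b') (sdots_perm b' x) else x.

Fixpoint sdots_val b x : int :=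
  if b is b'.+1 then sdots_val b' x + sdot_val (d - b') (sdots_perm b' x) else 0.

Lemma val_swap_pos k (i : 'I_d) : (k < d)%N -> nat_of_ord (swap_pos k i) =
  (if i == k.-1 :> nat then k else if i == k :> nat then k.-1 else i) :> nat.
Proof.
move=> kd; rewrite [LHS]val_insubd ifT //; case: ifP => // _; case: ifP => // _.
exact: leq_ltn_trans (leq_pred _) kd.
Qed.

(** The factor s_d sends the coordinate in position d - 1 to the other half; each further factor
    moves it down by one position and the coordinate it passes up by one. *)
Lemma half_sdots_perm b x : (b <= d)%N ->
  half (sdots_perm b x) = half x (+) ((0 < b)%N && (pos x == d.-1 :> nat)) /\
  nat_of_ord (pos (sdots_perm b x)) = (if pos x < d - b then nat_of_ord (pos x)
    else if pos x == d.-1 :> nat then d - b else (pos x).+1)%N :> nat.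
Proof.
elim: b => [|b IH] bd; first by rewrite /= addbF subn0 ltn_ord.
have [IHh IHp] := IH (ltnW bd); have k0 : (d - b == 0)%N = false by apply/eqP; lia.
rewrite /= /sdot_perm k0; have xd := ltn_ord (pos x).
case: eqP => [kd|kd]; rewrite half_ix pos_ix.
  have b0 : b = 0%N by lia.
  by subst b; split=> /=; last (case: ifP => ?; last case: eqP => ?); lia.
have b0 : (0 < b)%N by lia.
rewrite IHh b0 val_swap_pos; last by lia.
split=> //; rewrite IHp; move: (nat_of_ord (pos x)) xd => i xd.
case: (ltnP i (d - b)) => h1; [|case: (i =P d.-1) => h2];
  by case: (ltnP i (d - b.+1)) => h3; repeat case: eqP => ?; lia.
Qed.

Lemma sdots_val0 b x : (b <= d)%N -> sdots_val b x = 0.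
Proof.
elim: b => [|b IH] bd //=; rewrite IH; last exact: ltnW.
by rewrite /sdot_val (_ : (d - b == 0)%N = false) //; apply/eqP; lia.
Qed.

Definition phi_perm : I -> I := sdots_perm d.+1.
Definition phi_val x : int := 1 + sdots_val d.+1 x.

(** The coordinate that s_d puts into the other half has descended to position 0 when s_0 acts, and
    s_0 puts it back. What remains on each half is the cyclic shift of positions, so the d-th
    iterate is the identity and phi^d is diagonal. *)
Lemma half_phi_perm x : half (phi_perm x) = half x.
Proof.
have [hh hp] := half_sdots_perm x (leqnn d).
rewrite /phi_perm /= /sdot_perm subnn eqxx half_ix hh hp subnn ltn0 d_gt0 /=.
by case: (pos x == d.-1 :> nat); case: (half x).
Qed.

Lemma pos_phi_perm x : nat_of_ord (pos (phi_perm x)) = ((pos x).+1 %% d)%N.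
Proof.
have [hh hp] := half_sdots_perm x (leqnn d).
rewrite /phi_perm /= /sdot_perm subnn eqxx pos_ix [LHS]hp subnn ltn0.
have xd := ltn_ord (pos x); case: eqP => [->|ne]; first by rewrite prednK // modnn.
by rewrite modn_small //; lia.
Qed.

Lemma phi_valE x : phi_val x =
  1 + (if pos x == d.-1 :> nat then (if half x then -1 else 1) else 0).
Proof.
have [hh hp] := half_sdots_perm x (leqnn d).
rewrite /phi_val /= sdots_val0 // add0r subnn /sdot_val eqxx hh hp subnn ltn0 d_gt0 /=.
by case: (pos x == d.-1 :> nat); case: (half x).
Qed.

Fixpoint phi_pow_val a x : int :=
  if a is a'.+1 then phi_pow_val a' x + phi_val (iter a' phi_perm x) else 0.

Lemma half_iter_phi a x : half (iter a phi_perm x) = half x.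
Proof. by elim: a => //= a <-; rewrite half_phi_perm. Qed.

Lemma pos_iter_phi a x : nat_of_ord (pos (iter a phi_perm x)) = ((pos x + a) %% d)%N.
Proof.
elim: a => [|a IH] /=; first by rewrite addn0 modn_small.
by rewrite pos_phi_perm [nat_of_ord _]IH -addn1 modnDml addn1 addnS.
Qed.

Lemma iter_phi_d x : iter d phi_perm x = x.
Proof.
apply/eqP; rewrite eq_half_pos half_iter_phi eqxx -val_eqE /= pos_iter_phi.
by rewrite modnDr modn_small.
Qed.

Lemma iter_phi_trans x y : half x = half y -> exists a, iter a phi_perm x = y.
Proof.
move=> hxy; exists (pos y + (d - pos x))%N; apply/eqP.
rewrite eq_half_pos half_iter_phi hxy eqxx -val_eqE /= pos_iter_phi.
have xd := ltn_ord (pos x).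
have -> : (pos x + (pos y + (d - pos x)) = pos y + d)%N by lia.
by rewrite modnDr modn_small.
Qed.

(** Each factor phi contributes a valuation 1 or 2 on the first half and 1 or 0 on the second; this
    is what makes phi^d contract N_0. *)
Lemma phi_pow_val_bar a x : ~~ half x -> phi_pow_val a (bar x) <= phi_pow_val a x.
Proof.
move=> hx; elim: a => //= a IH; apply: lerD => //; rewrite !phi_valE.
have -> : pos (iter a phi_perm (bar x)) = pos (iter a phi_perm x).
  by apply/val_inj; rewrite /= !pos_iter_phi pos_bar.
by rewrite !half_iter_phi half_bar (negPf hx) /=; case: ifP.
Qed.
End GalleryPermutations.

(** * Monomial similitudes and their action on weights *)

Section Monomial.
Variables (p : nat) (p_pr : prime p) (d : nat) (d_gt0 : (0 < d)%N).
Local Notation Qp := (padic p_pr).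
Local Notation I := 'I_(d + d).
Local Notation mat := 'M[Qp]_(d + d).
Local Notation n := ((d + d)%:Z).
Local Notation Lat := (@Lat p p_pr d).
Local Notation chain := (@chain p p_pr d).
Implicit Types (g h : mat) (x y : I) (w : I -> int) (s : I -> I) (c : I -> Qp) (v : I -> int).

(* [v] is the valuation of the nonzero entries [c] and [kap] the similitude factor. *)
Record monomial g s c v (kap : Qp) : Prop := Monomial {
  monomial_entry : forall x y, g x y = if y == s x then c x else 0;
  monomial_inj : injective s;
  monomial_bar : forall x, s (bar x) = bar (s x);
  monomial_neq0 : forall x, c x != 0;
  monomial_val : forall x, pdvd (v x) (c x) /\ pdvd (- v x) (c x)^-1;
  monomial_val_bar : exists k, forall x, v x + v (bar x) = k;
  monomial_kappa : forall x, c x * c (bar x) * sg p_pr x = kap * sg p_pr (s x);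
  monomial_kappa0 : kap != 0 }.

Lemma pdvd_unit_val (m : int) : pdvd m (p%:R ^ m : Qp) /\ pdvd (- m) ((p%:R : Qp) ^ m)^-1.
Proof. by rewrite invr_expz; split; exact: pdvd_exp. Qed.

Lemma monomial_scalar m :
  monomial ((p%:R ^ m)%:M) id (fun=> p%:R ^ m) (fun=> m) (p%:R ^ m * p%:R ^ m).
Proof.
have p0 : (p%:R : Qp) ^ m != 0 by rewrite expfz_neq0 // pQ_neq0.
split=> // [x y|x||]; last by rewrite mulf_neq0.
- by rewrite mxE [y == x]eq_sym; case: eqP.
- exact: pdvd_unit_val.
- by exists (m + m).
Qed.

Lemma monomial1 : monomial 1%:M id (fun=> 1) (fun=> 0) 1.
Proof. by have := monomial_scalar 0; rewrite expr0z mul1r. Qed.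

Lemma monomialM g g' s s' c c' v v' kap kap' :
  monomial g s c v kap -> monomial g' s' c' v' kap' ->
  monomial (g *m g') (fun x => s' (s x)) (fun x => c x * c' (s x))
    (fun x => v x + v' (s x)) (kap * kap').
Proof.
move=> [gE si sb c0 cv [k vk] ck k0] [gE' si' sb' c0' cv' [k' vk'] ck' k0']; split.
- move=> x y; rewrite mxE (bigD1 (s x)) //= big1 ?addr0; last first.
    by move=> z zx; rewrite gE (negPf zx) mul0r.
  by rewrite gE eqxx gE'; case: eqP => // _; rewrite mulr0.
- by move=> x y /si'/si.
- by move=> x; rewrite sb sb'.
- by move=> x; rewrite mulf_neq0.
- move=> x; have [h1 h2] := cv x; have [h1' h2'] := cv' (s x); split; first exact: pdvdM.
  by rewrite opprD invfM; exact: pdvdM.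
- by exists (k + k') => x; rewrite sb addrACA vk vk'.
- by move=> x; rewrite sb mulrACA [LHS]mulrAC ck [LHS]mulrAC -mulrA ck' mulrA.
- by rewrite mulf_neq0.
Qed.

Lemma monomial_similitude g s c v kap : monomial g s c v kap -> similitude g kap.
Proof.
move=> [gE si sb c0 _ _ ck _]; apply/matrixP => x y; rewrite sympE mxE.
have [s' sK s'K] := injF_bij si.
rewrite (bigD1 (s' x)) //= big1 ?addr0; last first.
  move=> z zx; rewrite gE ifF ?mul0r //; apply/negP => /eqP e.
  by rewrite e sK eqxx in zx.
rewrite gE s'K eqxx gE sb s'K ShatE; case: eqP => _; last by rewrite mul0r !mulr0.
by rewrite mul1r mulrAC ck s'K.
Qed.

Lemma monomial_GSp g s c v kap : monomial g s c v kap -> GSp g.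
Proof.
move=> m; apply/GSp_similitude; exists kap; first exact: monomial_kappa0 m.
exact: monomial_similitude m.
Qed.

Lemma monomial_chain g s c v kap w : monomial g s c v kap ->
  act g (chain w) = chain (fun x => w (s x) + n * v x).
Proof.
move=> [gE si _ c0 cv _ _ _]; have [s' sK s'K] := injF_bij si.
have gv (u : 'cV[Qp]_(d + d)) x : (g *m u) x 0 = c x * u (s x) 0.
  rewrite mxE (bigD1 (s x)) //= big1 ?addr0; last first.
    by move=> z zx; rewrite gE (negPf zx) mul0r.
  by rewrite gE eqxx.
suff gL t : act_lattice g (Lat w t) = Lat (fun x => w (s x) + n * v x) t.
  apply/seteqP; split=> [_ [_ [t _ <-] <-]|_ [t _ <-]]; first by rewrite gL; exists t.
  by exists (Lat w t); [exists t|exact: gL].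
apply/seteqP; split=> [_ [u uL <-] x|u uL].
  rewrite gv [w _ + _]addrC -addrA; apply: gdvdM; last exact: uL.
  by apply: pdvd_gdvd; have [] := cv x.
exists (\col_y ((c (s' y))^-1 * u (s' y) 0)).
  move=> y; rewrite mxE; have := uL (s' y); rewrite s'K => h.
  have -> : w y + t = n * (- v (s' y)) + (w y + n * v (s' y) + t) by rewrite mulrN; ring.
  by apply: gdvdM => //; apply: pdvd_gdvd; have [] := cv (s' y).
by apply/matrixP => x j; rewrite ord1 gv mxE sK mulrA mulfV // mul1r.
Qed.

Lemma chain_shift w (k : int) : chain (fun x => w x + k) = chain w.
Proof.
apply/seteqP; split=> _ [t _ <-].
  exists (k + t) => //; apply/seteqP.
  by split=> v h x; have := h x; rewrite addrA.
exists (t - k) => //; apply/seteqP.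
by split=> v h x; have := h x; rewrite -addrA subrKC.
Qed.

Lemma ix_val (h : bool) (i : 'I_d) : nat_of_ord (ix h i) = (h * d + i)%N.
Proof. by rewrite /ix; case: h; rewrite /= ?mul1n ?mul0n. Qed.

(** Covers both ends of the affine diagram: s_d with entries 1, -1 and [e = 0], and s_0 with entries
    - 1/p, p and [e = -1]. The relation [al * be = -1] makes the similitude factor 1. *)
Lemma monomial_long_swap (o : 'I_d) (al be : Qp) (e : int) :
  al * be = -1 -> pdvd e al -> pdvd (- e) be ->
  monomial (swap_mx (d + d) o (d + o) al be)
    (fun x => ix (half x (+) (pos x == o)) (pos x))
    (fun x => if pos x == o then if half x then be else al else 1)
    (fun x => if pos x == o then if half x then - e else e else 0) 1.
Proof.
move=> albe eal ebe.
have al0 : al != 0.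
  by apply/eqP => e0; move: albe; rewrite e0 mul0r => /eqP; rewrite eq_sym oppr_eq0 oner_eq0.
have be0 : be != 0.
  by apply/eqP => e0; move: albe; rewrite e0 mulr0 => /eqP; rewrite eq_sym oppr_eq0 oner_eq0.
have alV : al^-1 = - be.
  by apply: (mulfI al0); rewrite mulfV // mulrN albe opprK.
have beV : be^-1 = - al.
  by apply: (mulfI be0); rewrite mulfV // mulrN [be * al]mulrC albe opprK.
split.
- move=> x y; rewrite mxE.
  have xo : nat_of_ord o = ix false o by rewrite ix_val.
  have xo' : (d + o)%N = ix true o by rewrite ix_val mul1n.
  rewrite xo' xo !val_eqE.
  have [h [i ->]] := ixP x; have [k [j ->]] := ixP y.
  rewrite half_ix pos_ix !ix_eq [j == i]eq_sym.
  have [->|io] := eqVneq i o; last by rewrite !andbF /= addbF andbT [k == h]eq_sym; case: ifP.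
  have [_|jo] := eqVneq j o; last by rewrite ?andbF /= ?andbF.
  by case: h; case: k.
- move=> x y /eqP; rewrite ix_eq => /andP[/eqP hh /eqP pp].
  by apply/eqP; rewrite eq_half_pos pp eqxx andbT; move: hh; rewrite pp => /addIb->.
- by move=> x; rewrite half_bar pos_bar bar_ix addNb.
- by move=> x; case: ifP => _; [case: half|exact: oner_neq0].
- move=> x; case: ifP => _; last first.
    by rewrite oppr0 invr1 -of_int1; split; exact: pdvd_int.
  by case: half; rewrite ?opprK ?alV ?beV; split=> //; exact: pdvdN.
- exists 0 => x; rewrite half_bar pos_bar; case: ifP => _; last exact: addr0.
  by case: half; rewrite /= ?addNr ?subrr.
- move=> x; rewrite /sg half_bar half_ix pos_bar mul1r; case: ifP => _; last first.
    by rewrite mulr1 mul1r addbF.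
  by rewrite addbT; case: half; rewrite /= ?[be * al]mulrC albe ?mulrNN mulr1.
- exact: oner_neq0.
Qed.

Lemma monomial_short_swap k : (0 < k < d)%N ->
  monomial (block_mx (swap_mx d k.-1 k 1 (-1)) 0 0 (swap_mx d k.-1 k 1 (-1)))
    (fun x => ix (half x) (swap_pos k (pos x)))
    (fun x => if pos x == k :> nat then -1 else 1) (fun=> 0) 1.
Proof.
move=> /andP[k0 kd]; have swpK (i : 'I_d) : swap_pos k (swap_pos k i) = i.
  apply/val_inj; rewrite /= !val_swap_pos //; move: (nat_of_ord i) => {}i.
  case: (i =P k.-1) => e1; [|case: (i =P k) => e2]; by repeat case: eqP => ?; lia.
split.
- move=> x y; have [h [i ->]] := ixP x; have [h' [j ->]] := ixP y.
  have E : swap_mx d k.-1 k 1 (-1) i j =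
      if j == swap_pos k i then if i == k :> nat then -1 else 1 else 0 :> Qp.
    have -> : (j == swap_pos k i) = (nat_of_ord j == if i == k.-1 :> nat then k
        else if i == k :> nat then k.-1 else i).
      by rewrite -val_eqE /= val_swap_pos.
    rewrite mxE -(val_eqE i j) /=.
    move: (nat_of_ord i) (nat_of_ord j) => a b.
    case: (a =P k.-1) => [->|e1] /=.
      have -> : (k.-1 == k) = false by apply/eqP; lia.
      by case: (b =P k) => //= _; rewrite andbF.
    case: (a =P k) => [->|e2] /=; first by case: (b =P k.-1) => //= _; rewrite andbF.
    by rewrite andbT [b == a]eq_sym; case: (a == b).
  rewrite half_ix pos_ix ix_eq [h' == h]eq_sym /ix.
  case: h; case: h'; rewrite /= -?E.
  + by rewrite [LHS]block_mxEdr.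
  + by rewrite [LHS]block_mxEdl mxE.
  + by rewrite [LHS]block_mxEur mxE.
  + by rewrite [LHS]block_mxEul.
- move=> x y /eqP; rewrite ix_eq => /andP[/eqP hh /eqP pp].
  by apply/eqP; rewrite eq_half_pos hh eqxx /= -(swpK (pos x)) pp swpK.
- by move=> x; rewrite half_bar pos_bar bar_ix.
- by move=> x; case: ifP; rewrite ?oppr_eq0 oner_neq0.
- move=> x; rewrite oppr0; case: ifP => _; rewrite ?invrN invr1 -of_int1 -?of_intN;
    by split; exact: pdvd_int.
- by exists 0 => x; rewrite addr0.
- by move=> x; rewrite /sg pos_bar half_ix; case: ifP; rewrite ?mulrNN mulr1.
- exact: oner_neq0.
Qed.

Lemma sdot_monomial k : (k <= d)%N ->
  exists c, monomial (sdot p_pr d k) (sdot_perm k) c (@sdot_val d k) 1.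
Proof.
move=> kd; rewrite /sdot /sdot_perm /sdot_val; case: eqP => [_|/eqP k0] /=.
  exists (fun x => if pos x == Ordinal d_gt0 then if half x then p%:R else - (p%:R)^-1 else 1).
  have := @monomial_long_swap (Ordinal d_gt0) (- (p%:R)^-1) p%:R (-1).
  rewrite addn0 opprK; apply.
  - by rewrite mulNr mulVf // pQ_neq0.
  - by apply: pdvdN; rewrite -exprN1; exact: pdvd_exp.
  - by rewrite -[p%:R]expr1z; exact: pdvd_exp.
case: eqP => [_|/eqP kd'].
  have lt : (d.-1 < d)%N by rewrite prednK.
  exists (fun x => if pos x == Ordinal lt then if half x then -1 else 1 else 1).
  have e1 : (d + d.-1)%N = (d + d).-1 by lia.
  have -> : (fun=> 0) = fun x : I =>
      if pos x == Ordinal lt then if half x then - 0 else 0 else 0 :> int.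
    by apply: funext => x; rewrite oppr0; do 2?case: ifP.
  have := @monomial_long_swap (Ordinal lt) 1 (-1) 0; rewrite /= e1; apply.
  - by rewrite mul1r.
  - by rewrite -of_int1; exact: pdvd_int.
  - by rewrite oppr0 -of_int1 -of_intN; exact: pdvd_int.
by eexists; apply: monomial_short_swap; rewrite lt0n k0 ltn_neqAle kd'.
Qed.
End Monomial.

(** * The weights along the gallery *)

Section Gallery.
Variables (p : nat) (p_pr : prime p) (d : nat) (d_gt0 : (0 < d)%N).
Local Notation Qp := (padic p_pr).
Local Notation I := 'I_(d + d).
Local Notation mat := 'M[Qp]_(d + d).
Local Notation n := ((d + d)%:Z).
Local Notation chain := (@chain p p_pr d).
Local Notation w0 := (@w0 d).
Local Notation phi := (phi p_pr d).
Local Notation sdots := (sdots p_pr d).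
Implicit Types (g h : mat) (x y : I) (w : I -> int) (s : I -> I) (c : I -> Qp) (v : I -> int).

Lemma sdots_monomial b : (b <= d.+1)%N ->
  exists c, monomial (sdots b) (@sdots_perm d b) c (@sdots_val d b) 1.
Proof.
elim: b => [|b IH] bd.
  by exists (fun=> 1); rewrite /sdots /Defs.sdots big_nil; exact: monomial1.
have [c mc] := IH (ltnW bd); have [c' mc'] := sdot_monomial p_pr d_gt0 (leq_subr b d).
exists (fun x => c x * c' (sdots_perm b x)).
rewrite /sdots /Defs.sdots big_nat_recr //= -mulmxE -[X in monomial _ _ _ _ X]mulr1.
exact: monomialM mc mc'.
Qed.

Lemma phi_monomial : exists c kap, monomial phi (@phi_perm d) c (@phi_val d) kap.
Proof.
have [c mc] := sdots_monomial (leqnn d.+1).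
do 2 eexists; rewrite /phi /Defs.phi -[p%:R]expr1z.
exact: monomialM (monomial_scalar p_pr d 1) mc.
Qed.

Lemma phi_pow_monomial a : exists c kap,
  monomial (phi ^+ a) (iter a (@phi_perm d)) c (@phi_pow_val d a) kap.
Proof.
elim: a => [|a [c [kap mc]]].
  by exists (fun=> 1), 1; rewrite expr0; exact: monomial1.
have [c' [kap' mc']] := phi_monomial.
do 2 eexists; rewrite exprSr -mulmxE; exact: monomialM mc mc'.
Qed.

Definition gal_perm a b x : I := sdots_perm b (iter a (@phi_perm d) x).
Definition gal_val a x : int := phi_pow_val a x.
Definition gal_wt a b x : int := w0 (gal_perm a b x) + n * gal_val a x.
(** The weights of the next chamber, written for every b as the translate of s_(d-b) C by phi^a s_d
    ... s_(d-b+1). For b = d they differ from [gal_wt a.+1 0] by the constant 2d, which leaves the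
    chain unchanged. *)
Definition gal_wt' a b x : int := w0 (sdot_perm (d - b) (gal_perm a b x)) +
  n * (gal_val a x + sdot_val (d - b) (gal_perm a b x)).

Lemma gallery_monomial a b : (b <= d)%N -> exists c kap,
  monomial (phi ^+ a *m sdots b) (gal_perm a b) c (gal_val a) kap.
Proof.
move=> bd; have [c [kap mc]] := phi_pow_monomial a.
have [c' mc'] := sdots_monomial (leqW bd); do 2 eexists.
have -> : gal_val a = fun x => phi_pow_val a x + sdots_val b (iter a (@phi_perm d) x).
  by apply: funext => x; rewrite sdots_val0 // addr0.
exact: monomialM mc mc'.
Qed.

Lemma gallery_chain a b : (b <= d)%N ->
  act (phi ^+ a *m sdots b) (chain w0) = chain (gal_wt a b).
Proof.
by move=> bd; have [c [kap mc]] := gallery_monomial a bd; rewrite (monomial_chain _ mc).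
Qed.

Lemma gallery_chain_next a b : (b < d)%N -> gal_wt' a b = gal_wt a b.+1.
Proof.
move=> bd; apply: funext => x; rewrite /gal_wt' /gal_wt /gal_perm /=.
by rewrite /sdot_val subn_eq0 leqNgt bd addr0.
Qed.

Lemma gallery_chain_wrap a : chain (gal_wt' a d) = chain (gal_wt a.+1 0).
Proof.
rewrite -(chain_shift p_pr (gal_wt' a d) n); congr (chain _); apply: funext => x.
rewrite /gal_wt' /gal_wt /gal_perm /gal_val /= /phi_perm /phi_val /= subnn.
rewrite sdots_val0 // add0r; ring.
Qed.

Lemma step_transport (w w' : I -> int) s v x y : step w w' (s x) (s y) ->
  injective s -> (forall z, s (bar z) = bar (s z)) -> (exists k, forall z, v z + v (bar z) = k) ->
  step (fun z => w (s z) + n * v z) (fun z => w' (s z) + n * v z) x y.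
Proof.
move=> [wE AB ws [c wc] [e we]] si sb [k vk]; split.
- by move=> z; rewrite (wE (s z)) -!sb !(inj_eq si); ring.
- by move: AB; rewrite -sb (inj_eq si).
- by move=> a b m e1; apply: si; apply: (ws _ _ (m - v a + v b)); rewrite mulrDr mulrBr; lia.
- by exists (c + n * k) => z; rewrite sb addrACA wc -mulrDr vk.
- by exists (e + v x - v (bar y)); rewrite sb mulrBr mulrDr; lia.
Qed.

(** The affine wall of C: the last coordinate rises from 2d - 1 to 2d, a multiple of 2d, while the
    first falls from 0 to - 1. This is why [e = 1] here and [e = 0] for the other reflections. *)
Lemma base_step0 : step w0 (fun x => w0 (sdot_perm 0 x) + n * sdot_val 0 x)
  (ix true (Ordinal d_gt0)) (ix true (Ordinal d_gt0)).
Proof.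
split; [|by rewrite eq_sym bar_neq|exact: w0_sep|exact: w0_barsym|].
- move=> x; have [h [i ->]] := ixP x.
  rewrite /sdot_perm /sdot_val half_ix pos_ix !bar_ix !w0_ix !ix_eq -val_eqE /=.
  by case: (nat_of_ord i =P 0%N) => [->|_]; case: h => /=; lia.
- by exists 1; rewrite bar_ix !w0_ix /=; lia.
Qed.

Lemma base_step_last (o : 'I_d) : nat_of_ord o = d.-1 ->
  step w0 (fun x => w0 (sdot_perm d x) + n * sdot_val d x) (ix false o) (ix false o).
Proof.
move=> od; split; [|by rewrite eq_sym bar_neq|exact: w0_sep|exact: w0_barsym|].
- move=> x; have [h [i ->]] := ixP x; have d0 := negPf (lt0n_neq0 d_gt0).
  rewrite /sdot_perm /sdot_val d0 eqxx half_ix pos_ix !bar_ix !w0_ix !ix_eq -val_eqE /= od.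
  by case: (nat_of_ord i =P d.-1) => [->|_]; case: h => /=; lia.
- by exists 0; rewrite bar_ix !w0_ix /= od; lia.
Qed.

Lemma base_step_mid k (o o' : 'I_d) : (0 < k < d)%N -> nat_of_ord o = k.-1 ->
  nat_of_ord o' = k ->
  step w0 (fun x => w0 (sdot_perm k x) + n * sdot_val k x) (ix false o) (ix true o').
Proof.
move=> /andP[k0 kd] ok ok'; split; [| |exact: w0_sep|exact: w0_barsym|].
- move=> x; have [h [i ->]] := ixP x.
  have kd' : (k == d) = false by apply/eqP; lia.
  rewrite /sdot_perm /sdot_val (negPf (lt0n_neq0 k0)) kd' half_ix pos_ix.
  rewrite !bar_ix !w0_ix !ix_eq -!val_eqE /= ok ok' val_swap_pos //.
  case: (nat_of_ord i =P k.-1) => [->|_].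
    have -> : (k.-1 == k) = false by apply/eqP; lia.
    by case: h => /=; lia.
  by case: (nat_of_ord i =P k) => [->|_]; case: h => /=; lia.
- by rewrite bar_ix ix_eq -val_eqE /= ok ok'; apply/eqP; lia.
- by exists 0; rewrite bar_ix !w0_ix /= ok ok'; lia.
Qed.

(** The cases b = 0, 0 < b < d and b = d concern s_d, s_(d-b) and s_0. For b > 0 the base step
    raises a coordinate of the second half; it is the image of one of the first half, since the
    prefix has moved position d - 1 across and phi^a preserves halves. *)
Lemma gallery_step a b : (b <= d)%N ->
  exists x y, [/\ half x = false, half y = false & step (gal_wt a b) (gal_wt' a b) x y].
Proof.
move=> bd; have dlt : (d.-1 < d)%N by rewrite prednK.
have [c [kap mc]] := gallery_monomial a bd.
have [c1 [kap1 mc1]] := phi_pow_monomial a.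
have [s' sK s'K] := injF_bij (monomial_inj mc1).
have hs' x : half (s' x) = half x by rewrite -[in RHS](s'K x) half_iter_phi.
(* The coordinate that the permutation of phi^a takes to position d - 1 of the first half, which the
   prefix sends across when b > 0. *)
pose last := s' (ix false (Ordinal dlt)).
have half_last : half last = false by rewrite hs' half_ix.
have [hh hp] := half_sdots_perm d_gt0 (ix false (Ordinal dlt)) bd.
rewrite half_ix pos_ix /= eqxx andbT in hh; rewrite pos_ix /= eqxx in hp.
have gal_last : gal_perm a b last = sdots_perm b (ix false (Ordinal dlt)).
  by rewrite /gal_perm s'K.
have transport x y : step w0 (fun z => w0 (sdot_perm (d - b) z) + n * sdot_val (d - b) z)
    (gal_perm a b x) (gal_perm a b y) -> step (gal_wt a b) (gal_wt' a b) x y.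
  move=> st; have := step_transport st (monomial_inj mc) (monomial_bar mc) (monomial_val_bar mc).
  suff -> : (fun z => w0 (sdot_perm (d - b) (gal_perm a b z)) +
     n * sdot_val (d - b) (gal_perm a b z) + n * gal_val a z) = gal_wt' a b by [].
  by apply: funext => z; rewrite /gal_wt' mulrDr addrAC addrA.
have [b0|b0] := posnP b.
  subst b; exists last, last; split=> //; apply: transport.
  by rewrite gal_last subn0; exact: base_step_last.
have ltF : (d.-1 < d - b)%N = false by apply/negP; lia.
rewrite ltF in hp; rewrite b0 in hh.
have [bd'|bd'] := eqVneq b d.
  subst b; exists last, last; split=> //; apply: transport.
  have -> : gal_perm a d last = ix true (Ordinal d_gt0).
    rewrite gal_last; apply/eqP; rewrite eq_half_pos hh half_ix pos_ix /= -val_eqE /= hp.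
    by rewrite subnn.
  by rewrite subnn; exact: base_step0.
have kd : (0 < d - b < d)%N by lia.
have k1 : ((d - b).-1 < d)%N by lia.
have k2 : (d - b < d)%N by lia.
have [hh' hp'] := half_sdots_perm d_gt0 (ix false (Ordinal k1)) bd.
rewrite half_ix pos_ix /= b0 /= in hh'; rewrite pos_ix /= in hp'.
exists (s' (ix false (Ordinal k1))), last; split=> //; first by rewrite hs' half_ix.
apply: transport.
have -> : gal_perm a b last = ix true (Ordinal k2).
  rewrite gal_last; apply/eqP; rewrite eq_half_pos hh half_ix pos_ix /= -val_eqE /= hp //.
have -> : gal_perm a b (s' (ix false (Ordinal k1))) = ix false (Ordinal k1).
  rewrite /gal_perm s'K; apply/eqP; rewrite eq_half_pos half_ix pos_ix hh'.
  rewrite -val_eqE /= hp' ifT; last by lia.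
  by rewrite (_ : ((d - b).-1 == d.-1) = false) ?eqxx //; apply/eqP; lia.
exact: base_step_mid.
Qed.
End Gallery.

(** * Contraction by phi^d, the cocharacter tau, and the filtration of N_0 *)

Section Conclusion.
Variables (p : nat) (p_pr : prime p) (d : nat) (d_gt0 : (0 < d)%N).
Local Notation Zp := (padic_int p_pr).
Local Notation Qp := (padic p_pr).
Local Notation I := 'I_(d + d).
Local Notation mat := 'M[Qp]_(d + d).
Local Notation chain := (@chain p p_pr d).
Local Notation w0 := (@w0 d).
Local Notation phi := (phi p_pr d).
Local Notation tau := (@tau p p_pr d).
Implicit Types (g h : mat) (x y : I) (z : Zp).

Lemma act1 (D : set (set 'cV[Qp]_(d + d))) : act 1%:M D = D.
Proof.
have act_lattice1 (L : set 'cV[Qp]_(d + d)) : act_lattice 1%:M L = L.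
  by apply/seteqP; split=> [_ [v vL <-]|v vL]; [rewrite mul1mx|exists v; rewrite ?mul1mx].
apply/seteqP; split=> [_ [L DL <-]|L DL]; first by rewrite act_lattice1.
by exists L; rewrite ?act_lattice1.
Qed.

Lemma phi_d_torus : torus (phi ^+ d).
Proof.
have [c [kap mc]] := phi_pow_monomial p_pr d_gt0 d; split; first exact: monomial_GSp mc.
apply/is_diag_mxP => x y xy; rewrite (monomial_entry mc) iter_phi_d // ifN //.
by rewrite eq_sym.
Qed.

(** The diagonal matrix phi^d commutes with phi, which permutes the coordinates of each half
    transitively. *)
Lemma phi_d_invariant x y : half x = half y -> (phi ^+ d) x x = (phi ^+ d) y y.
Proof.
have [c [kap mc]] := phi_pow_monomial p_pr d_gt0 d.
have [c1 [kap1 mc1]] := phi_monomial p_pr d_gt0.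
have td x' y' : x' != y' -> (phi ^+ d) x' y' = 0.
  by move=> xy; rewrite (monomial_entry mc) iter_phi_d // ifN // eq_sym.
have inv (z : I) : (phi ^+ d) (phi_perm z) (phi_perm z) = (phi ^+ d) z z.
  have := congr1 (fun M : mat => M z (phi_perm z)) (commrX d (commr_refl phi)).
  rewrite /= -!mulmxE !mxE (bigD1 (phi_perm z)) //= big1 ?addr0; last first.
    by move=> y' yz; rewrite td ?mulr0.
  rewrite (bigD1 z) //= big1 ?addr0; last first.
    by move=> y' yz; rewrite td ?mul0r // eq_sym.
  rewrite (monomial_entry mc1) eqxx mulrC => /(mulIf (monomial_neq0 mc1 z)).
  by [].
move=> /(iter_phi_trans d_gt0)[a <-].
by elim: a => //= a ->; rewrite inv.
Qed.

(** Within a half the ratio is 1. Otherwise [x] lies in the first half and [y] in the second, where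
    [y] may be replaced by [bar x] and [phi_pow_val_bar] applies. *)
Lemma phi_d_ratio x y : w0 x <= w0 y -> pdvd 0 ((phi ^+ d) x x / (phi ^+ d) y y).
Proof.
move=> xy.
have [c [_ [_ _ tn _]]] := torus_entries d_gt0 phi_d_torus.
have one u v : half u = half v -> pdvd 0 ((phi ^+ d) u u / (phi ^+ d) v v).
  by move=> /phi_d_invariant->; rewrite mulfV // -of_int1; exact: pdvd_int.
have [hxy|hxy] := eqVneq (half x) (half y); first exact: one.
have [hx hy] : half x = false /\ half y = true.
  move: xy hxy; have [h [i ->]] := ixP x; have [k [j ->]] := ixP y.
  rewrite !w0_ix !half_ix; have := ltn_ord i; have := ltn_ord j.
  by case: h; case: k => //= *; lia.
rewrite (@phi_d_invariant y (bar x)); last by rewrite half_bar hx hy.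
have [c' [kap mc]] := phi_pow_monomial p_pr d_gt0 d.
rewrite !(monomial_entry mc) !iter_phi_d // !eqxx.
have le := phi_pow_val_bar d_gt0 d (negbT hx).
have [h1 _] := monomial_val mc x; have [_ h2] := monomial_val mc (bar x).
by apply: pdvd_le (pdvdM h1 h2); rewrite subr_ge0.
Qed.

Lemma phi_d_N0 : conjugate (phi ^+ d) (@N0 p p_pr d) `<=` @N0 p p_pr d.
Proof.
have Tt := phi_d_torus; have [c _ [_ _ tn _]] := torus_entries d_gt0 Tt.
rewrite (N0E p_pr d_gt0) => _ [g [[Gg g1 gu] ig] <-].
have E x y : (phi ^+ d *m g *m invmx (phi ^+ d)) x y =
    (phi ^+ d) x x / (phi ^+ d) y y * g x y by exact: torus_conjE.
split; first split.
- by case: Tt => Gt _; apply: GSpM; [exact: GSpM|exact: GSpV].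
- by move=> x; rewrite E g1 mulr1 mulfV.
- by move=> x y; rewrite E mulf_eq0 negb_or => /andP[_ /gu].
move=> x y; rewrite E; have [->|gxy] := eqVneq (g x y) 0; first by rewrite mulr0; exact: pdvd0.
rewrite -[0]addr0; apply: pdvdM => //; apply: phi_d_ratio.
by case: (gu _ _ gxy) => [->|/ltW].
Qed.

(** All bounds [(w0 x - w0 y)] / 2d exceed - 1, and those above the diagonal are negative, so there
    they round up to 0: the Iwahori condition on N is integrality. *)
Lemma N0_Nfilt : @N0 p p_pr d = Iwahori (chain w0) `&` @Npos p p_pr d.
Proof.
have wb := w0_barsym d; rewrite (N0E p_pr d_gt0) (NposE p_pr d_gt0).
apply/seteqP; split=> g.
  move=> [Ug ig]; split=> //; apply/(Iwahori_unitri d_gt0 wb wb Ug) => x y.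
  have [->|gxy] := eqVneq (g x y) 0; first exact: gdvd0.
  exists 0; split; last exact: ig.
  by case: Ug => _ _ /(_ _ _ gxy)[->|]; lia.
move=> [Ig Ug]; split=> // x y; apply/(gdvd_int d_gt0).
have /(_ x y) := (Iwahori_unitri d_gt0 wb wb Ug).1 Ig; apply: gdvd_le.
by have := w0_bound x; have := w0_bound y; lia.
Qed.

Lemma tauE z x y : tau z x y = if x == y then if half y then 1 else of_int z else 0.
Proof.
have [h [i ->]] := ixP x; have [k [j ->]] := ixP y.
rewrite ix_eq half_ix /ix; case: h; case: k => /=.
- by rewrite [LHS]block_mxEdr mxE; case: eqP.
- by rewrite [LHS]block_mxEdl mxE.
- by rewrite [LHS]block_mxEur mxE.
- by rewrite [LHS]block_mxEul mxE; case: eqP.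
Qed.

(** The matrix [tau z] is scalar on each half, and phi preserves the halves. *)
Lemma tau_phi z : tau z *m phi = phi *m tau z.
Proof.
have [c [kap mc]] := phi_monomial p_pr d_gt0.
apply/matrixP => x y; rewrite !mxE (bigD1 x) //= big1 ?addr0; last first.
  by move=> a ax; rewrite tauE eq_sym (negPf ax) mul0r.
rewrite [RHS](bigD1 y) //= [in RHS]big1 ?addr0; last first.
  by move=> a ay; rewrite tauE (negPf ay) mulr0.
rewrite !tauE !eqxx (monomial_entry mc); case: eqP => [->|_]; last by rewrite mul0r mulr0.
by rewrite half_phi_perm // mulrC.
Qed.

(** Both diagonal entries and the similitude factor equal [z], so the character takes the value z z
    / z. *)
Lemma tau_char z x y : z \is a GRing.unit -> half x = false -> half y = false ->
  char (wt x + wt y) (tau z) = of_int z.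
Proof.
move=> uz hx hy; have z0 : of_int z != 0.
  by rewrite of_int_eq0; apply: contraTneq uz => ->; rewrite unitr0.
pose f (a : I) : Qp := if half a then 1 else of_int z.
have fc a : f a * f (bar a) = of_int z.
  by rewrite /f half_bar; case: half; rewrite /= ?mul1r ?mulr1.
have Tt : torus (tau z).
  have := torus_diag z0 fc; congr torus.
  by apply/matrixP => a b; rewrite tauE mxE; case: eqP => [->|].
have [c _ [kt _ _ tc]] := torus_entries d_gt0 Tt.
rewrite (char_wtD d_gt0) // kt -(tc x) !tauE !eqxx half_bar hx hy mulr1.
by rewrite mulfK.
Qed.

Lemma gallery_steps j : exists w w' x y,
  [/\ half x = false, half y = false, gallery (chain w0) j = chain w,
      gallery (chain w0) j.+1 = chain w' & step w w' x y].
Proof.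
have := divn_eq j d.+1; set a := (j %/ d.+1)%N; set b := (j %% d.+1)%N => ej.
have bd : (b <= d)%N by rewrite -ltnS ltn_mod.
have [x [y [hx hy st]]] := gallery_step p_pr d_gt0 a bd.
exists (gal_wt a b), (gal_wt' a b), x, y; split=> //; first exact: gallery_chain.
rewrite /gallery; have ej' : (j.+1 = a * d.+1 + b.+1)%N by rewrite addnS -ej.
have [eb|nb] := eqVneq b d.
  have -> : (j.+1 %/ d.+1)%N = a.+1 by rewrite ej' eb -mulSnr mulnK.
  have -> : (j.+1 %% d.+1)%N = 0%N by rewrite ej' eb -mulSnr modnMl.
  by rewrite eb gallery_chain_wrap // gallery_chain.
have {}bd : (b < d)%N by rewrite ltn_neqAle nb.
have -> : (j.+1 %/ d.+1)%N = a by rewrite ej' divnMDl // divn_small // addn0.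
have -> : (j.+1 %% d.+1)%N = b.+1 by rewrite ej' modnMDl modn_small.
by rewrite gallery_chain_next // gallery_chain.
Qed.

(** Both rising coordinates lie in the first half, so the root is positive and its root elements lie
    in N, as [step_index] requires. *)
Lemma Npos_step_index w w' x y : step w w' x y -> half x = false -> half y = false ->
  index_eq (Iwahori (chain w) `&` @Npos p p_pr d) (Iwahori (chain w') `&` @Npos p p_pr d) p.
Proof.
move=> st hx hy; have xy : w0 x < w0 (bar y) by apply: w0_lt_half; rewrite ?half_bar ?hy.
have wb := w0_barsym d; rewrite (NposE p_pr d_gt0).
apply: (step_index d_gt0 st wb xy) => //; first exact: unitri_subgroup.
move=> c; apply: (Nroot_unitri d_gt0 wb (step_neq st) xy).
by apply: rootmx_Nroot => //; exact: step_neq st.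
Qed.
End Conclusion.

Theorem lemma4p1 (p : nat) (p_pr : prime p) (d : nat) (d_ge2 : (2 <= d)%N)
    (C : set (set 'cV[padic p_pr]_(d + d)))
    (C_chamber : apartment_chamber C)
    (I0_fixes_C : @I0 p p_pr d `<=` Iwahori C) :
  (* (a) *)
  [/\ torus (phi p_pr d ^+ d),
      conjugate (phi p_pr d ^+ d) (@N0 p p_pr d) `<=` @N0 p p_pr d,
      gallery C 0 = C /\ @N0 p p_pr d = Nfilt C 0,
      forall i : nat, index_eq (Nfilt C i) (Nfilt C i.+1) p
    & forall j : nat, exists delta : 'rV[int]_d,
        [/\ Phi_pos delta,
            wall_root (gallery C j) (gallery C j.+1) delta
          & forall delta', wall_root (gallery C j) (gallery C j.+1) delta' ->
              delta' = delta]]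
  (* (b) *)
  /\ (forall (j : nat) (delta : 'rV[int]_d),
        wall_root (gallery C j) (gallery C j.+1) delta ->
        forall x : padic_int p_pr, x \is a GRing.unit ->
          char delta (tau d x) = of_int x)
  (* (c) *)
  /\ (forall a : padic_int p_pr, a \is a GRing.unit ->
        tau d a *m phi p_pr d = phi p_pr d *m tau d a).
Proof.
have d_gt0 : (0 < d)%N by exact: ltnW.
have eC := fixed_chamber d_gt0 C_chamber I0_fixes_C; subst C.
have gal0 : gallery (@chain p p_pr d (@w0 d)) 0 = @chain p p_pr d (@w0 d).
  rewrite /gallery div0n mod0n expr0 /sdots big_nil -[RHS]act1; congr act.
  exact: mul1mx.
have roots j : exists x y, [/\ half x = false, half y = false &
    wall_root (gallery (@chain p p_pr d (@w0 d)) j)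
      (gallery (@chain p p_pr d (@w0 d)) j.+1) (wt x + wt y)].
  have [w [w' [x [y [hx hy -> -> st]]]]] := gallery_steps p_pr d_gt0 j.
  by exists x, y; split=> //; exact: step_wall_root.
split; last split.
- split.
  + exact: phi_d_torus.
  + exact: phi_d_N0.
  + by split=> //; rewrite /Nfilt gal0; exact: N0_Nfilt.
  + move=> i; have [w [w' [x [y [hx hy e e' st]]]]] := gallery_steps p_pr d_gt0 i.
    by rewrite /Nfilt e e'; exact: Npos_step_index st hx hy.
  + move=> j; have [x [y [hx hy wr]]] := roots j; exists (wt x + wt y); split=> //.
      apply/Phi_posP; exists x, (bar y); rewrite wt_bar opprK; split=> //.
      by apply: w0_lt_half; rewrite ?half_bar ?hy.
    by move=> delta'; exact: wall_root_unique.
(* By uniqueness [delta] is the root produced by the gallery, a sum of two weights of the first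
   half. *)
- move=> j delta wr z uz; have [x [y [hx hy wr']]] := roots j.
  by rewrite (wall_root_unique d_gt0 wr' wr); exact: tau_char.
- by move=> a _; exact: tau_phi.
Qed.
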